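(* Let $\Bbbk$ be a field of characteristic zero and $n\ge1$. There exists an isomorphism of Hamiltonian double quasi-Poisson algebras over $B=\Bbbk e_1\oplus\Bbbk e_2$ between: (1) the algebra $\mathcal{B}_n^{\mathrm{loc}}$, obtained by further localising the Boalch algebra $\mathcal{B}(\Gamma_n)$ at the Euler continuants $(a_1,b_1,\dots,a_k,b_k)$ and $(b_k,a_k,\dots,b_1,a_1)$ for $1\le k\le n-1$, endowed with the Hamiltonian double quasi-Poisson structure induced by localisation from that of $\mathcal{B}(\Gamma_n)$; and (2) the fusion algebra $\mathcal{A}_n^{\mathrm{fus}}$, obtained by identifying (fusing) the idempotents in $n$ copies of $\mathcal{B}(\Gamma_1)$, each endowed with its Hamiltonian double quasi-Poisson structure.
   Context: $\otimes=\otimes_{\Bbbk}$. Quiver, continuants: $\Bbbk\overline{\Gamma}_n$ is the path algebra generated by orthogonal idempotents $e_1,e_2$ with $e_1+e_2=1$ and by $a_i=e_2a_ie_1$, $b_i=e_1b_ie_2$ ($1\le i\le n$). For a sequence alternating between letters $a$ and $b$: $(a_i)=a_i$, $(b_i)=b_i$, $(a_i,b_j)=e_2+a_ib_j$, $(b_i,a_j)=e_1+b_ia_j$, and $(y_1,\dots,y_k)=(y_1,\dots,y_{k-1})y_k+(y_1,\dots,y_{k-2})$ for $k\ge3$. Inverting $x\in e_sAe_s$ means adjoining $x^{-1}=e_sx^{-1}e_s$ with $xx^{-1}=x^{-1}x=e_s$. $\mathcal{B}(\Gamma_n)$ is $\Bbbk\overline{\Gamma}_n$ with $(a_1,b_1,\dots,a_n,b_n)$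 and $(b_n,a_n,\dots,b_1,a_1)$ inverted. Double brackets: on an algebra $A$ over $B=\oplus_{s\in I}\Bbbk e_s$ ($1=\sum_s e_s$, orthogonal idempotents), a $B$-linear double bracket is a $\Bbbk$-bilinear map $\{\!\!\{-,-\}\!\!\}:A\times A\to A\otimes A$ with $\{\!\!\{a,b\}\!\!\}=-\tau_{(12)}\{\!\!\{b,a\}\!\!\}$, $\{\!\!\{a,bc\}\!\!\}=\{\!\!\{a,b\}\!\!\}c+b\{\!\!\{a,c\}\!\!\}$ (outer bimodule structure $x(a'\otimes a'')y=xa'\otimes a''y$), and vanishing on $B$. Put $\{\!\!\{a,b\otimes c\}\!\!\}_L=\{\!\!\{a,b\}\!\!\}\otimes c$, $\tau_{(123)}(x_1\otimes x_2\otimes x_3)=x_3\otimes x_1\otimes x_2$, $\tau_{(132)}(x_1\otimes x_2\otimes x_3)=x_2\otimes x_3\otimes x_1$. The double bracket is quasi-Poisson if for all $a,b,c$ the element $\{\!\!\{a,\{\!\!\{b,c\}\!\!\}\}\!\!\}_L+\tau_{(123)}\{\!\!\{b,\{\!\!\{c,a\}\!\!\}\}\!\!\}_L+\tau_{(132)}\{\!\!\{c,\{\!\!\{a,b\}\!\!\}\}\!\!\}_L$ equals $\frac14\sum_{s}(ce_sa\otimes e_sb\otimes e_s-ce_sa\otimes e_s\otimes be_s-ce_s\otimes ae_sb\otimes e_s+ce_s\otimes ae_s\otimes be_s-e_sa\otimes e_sb\otimes e_sc+e_sa\otimes e_s\otimes be_sc+e_s\otimes ae_sb\otimes e_sc-e_s\otimes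 ae_s\otimes be_sc)$. A multiplicative moment map is an invertible $\Phi=\sum_s\Phi_s$, $\Phi_s\in e_sAe_s$, with $\{\!\!\{\Phi_s,a\}\!\!\}=\frac12(ae_s\otimes\Phi_s-e_s\otimes\Phi_sa+a\Phi_s\otimes e_s-\Phi_s\otimes e_sa)$ for all $a\in A$, $s\in I$. A Hamiltonian double quasi-Poisson algebra is an algebra with a quasi-Poisson double bracket and a multiplicative moment map. An isomorphism of such, $(A,\{\!\!\{-,-\}\!\!\},\Phi)\to(A',\{\!\!\{-,-\}\!\!\}',\Phi')$, is an isomorphism $\psi:A\to A'$ of $B$-algebras with $\{\!\!\{\psi(x),\psi(y)\}\!\!\}'=(\psi\otimes\psi)\{\!\!\{x,y\}\!\!\}$ for all $x,y\in A$ and $\psi(\Phi)=\Phi'$. Structure on $\mathcal{B}(\Gamma_n)$: with $\mathrm{sgn}(0)=0$, $\{\!\!\{a_i,a_j\}\!\!\}=\frac12\mathrm{sgn}(i-j)(a_i\otimes a_j+a_j\otimes a_i)$; $\{\!\!\{b_i,b_j\}\!\!\}=\frac12\mathrm{sgn}(i-j)(b_i\otimes b_j+b_j\otimes b_i)$; $\{\!\!\{a_i,b_j\}\!\!\}$ equals $\frac12(e_1\otimes a_ib_j+b_ja_i\otimes e_2)$ if $i<j$, $\frac12(e_1\otimes a_ib_i+b_ia_i\otimes e_2)+e_1\otimes e_2$ if $i=j$, and $-\frac12(e_1\otimes a_ib_j+b_ja_i\otimes e_2)-\delta_{i-j,1}e_1\otimes e_2$ if $i>j$. The moment map is $\Phi=(a_1,b_1,\dots,a_n,b_n)+(b_n,a_n,\dots,b_1,a_1)^{-1}$.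 This is known to be a Hamiltonian double quasi-Poisson structure, and it extends uniquely to localisations. Fusion: let $(A,\{\!\!\{-,-\}\!\!\},\Phi)$ be a Hamiltonian double quasi-Poisson algebra over $B=\oplus_{s\in I}\Bbbk e_s$ and $i\ne j$ in $I$. Let $\bar A$ be $A$ with elements $e_{ij},e_{ji}$ adjoined so that $e_{ii}=e_i,e_{ij},e_{ji},e_{jj}=e_j$ satisfy the matrix relations $e_{st}e_{uv}=\delta_{tu}e_{sv}$. With $\epsilon=1-e_j$, the fusion algebra (fusing $e_j$ onto $e_i$) is $A^f=\epsilon\bar A\epsilon$, generated by $t\in\epsilon A\epsilon$, $e_{ij}u$ with $u\in e_jA\epsilon$, $ve_{ji}$ with $v\in\epsilon Ae_j$, and $e_{ij}we_{ji}$ with $w\in e_jAe_j$. The double bracket on $A$ extends uniquely to a double bracket on $\bar A$ vanishing on $e_{ij},e_{ji}$ and restricts to $A^f$. Let $\{\!\!\{-,-\}\!\!\}_{\mathrm{fus}}$ be the unique double bracket on $A^f$ with (tildes denoting a second element of the same type): $\{\!\!\{t,\tilde t\}\!\!\}_{\mathrm{fus}}=0$; $\{\!\!\{t,e_{ij}u\}\!\!\}_{\mathrm{fus}}=\frac12(e_i\otimes te_{ij}u-e_it\otimes e_{ij}u)$; $\{\!\!\{t,ve_{ji}\}\!\!\}_{\mathrm{fus}}=\frac12(ve_{ji}t\otimes e_i-ve_{ji}\otimes te_i)$; $\{\!\!\{t,e_{ij}we_{ji}\}\!\!\}_{\mathrm{fus}}=\frac12(e_{ij}we_{ji}t\otimes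 e_i+e_i\otimes te_{ij}we_{ji}-e_{ij}we_{ji}\otimes te_i-e_it\otimes e_{ij}we_{ji})$; $\{\!\!\{e_{ij}u,e_{ij}\tilde u\}\!\!\}_{\mathrm{fus}}=\frac12(e_i\otimes e_{ij}ue_{ij}\tilde u-e_{ij}\tilde ue_{ij}u\otimes e_i)$; $\{\!\!\{e_{ij}u,ve_{ji}\}\!\!\}_{\mathrm{fus}}=\frac12(e_{ij}u\otimes e_ive_{ji}-ve_{ji}\otimes e_{ij}ue_i)$; $\{\!\!\{e_{ij}u,e_{ij}we_{ji}\}\!\!\}_{\mathrm{fus}}=\frac12(e_i\otimes e_{ij}ue_{ij}we_{ji}-e_{ij}we_{ji}\otimes e_{ij}ue_i)$; $\{\!\!\{ve_{ji},\tilde ve_{ji}\}\!\!\}_{\mathrm{fus}}=\frac12(\tilde ve_{ji}ve_{ji}\otimes e_i-e_i\otimes ve_{ji}\tilde ve_{ji})$; $\{\!\!\{ve_{ji},e_{ij}we_{ji}\}\!\!\}_{\mathrm{fus}}=\frac12(e_{ij}we_{ji}ve_{ji}\otimes e_i-e_ive_{ji}\otimes e_{ij}we_{ji})$; $\{\!\!\{e_{ij}we_{ji},e_{ij}\tilde we_{ji}\}\!\!\}_{\mathrm{fus}}=0$. Then (Van den Bergh; Fairon) $A^f$ with the double bracket $\{\!\!\{-,-\}\!\!\}+\{\!\!\{-,-\}\!\!\}_{\mathrm{fus}}$ and moment map $\Phi_ie_{ij}\Phi_je_{ji}+\sum_{s\ne i,j}\Phi_s$ is a Hamiltonian double quasi-Poisson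 algebra. The algebra $\mathcal{A}_n^{\mathrm{fus}}$: take the direct sum of $n$ copies of $\mathcal{B}(\Gamma_1)$; in the $\ell$-th copy write $c_\ell,d_\ell$ for $a_1,b_1$ and $e_{1,\ell},e_{2,\ell}$ for $e_1,e_2$. The direct sum is a Hamiltonian double quasi-Poisson algebra over $\oplus_{\ell}(\Bbbk e_{1,\ell}\oplus\Bbbk e_{2,\ell})$ (double brackets between different copies vanish; the moment map is the sum of those of the copies). Set $e_1=e_{1,1}$, $e_2=e_{2,1}$ and, inductively for $\ell=2,\dots,n$, fuse $e_{1,\ell}$ onto $e_1$ and $e_{2,\ell}$ onto $e_2$. The result, over $B=\Bbbk e_1\oplus\Bbbk e_2$, is $\mathcal{A}_n^{\mathrm{fus}}$. *)

(* Defs.v *)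
From HB Require Import structures.
From mathcomp Require Import all_boot all_order all_algebra.
From mathcomp Require Import boolp.

Set Implicit Arguments.
Unset Strict Implicit.
Unset Printing Implicit Defensive.

Import GRing.Theory.
Local Open Scope ring_scope.
Local Open Scope quotient_scope.

Declare Scope tensor_scope.

(* Associative unital k-algebras, as rings with a central ring morphism from *)
(* k.  MathComp's algType is not used because it excludes the zero ring, so *)
(* that an algebra given by generators and relations would need a proof of *)
(* 1 <> 0 in order to be formed. *)

HB.mixin Record isCentralAlgebra (k : fieldType) A of GRing.PzRing A := {
  in_calg : k -> A;
  in_calgD : {morph in_calg : x y / x + y};
  in_calgM : {morph in_calg : x y / x * y};
  in_calg1 : in_calg 1 = 1;
  in_calgC : forall c x, in_calg c * x = x * in_calg c
}.

#[short(type="calgType")]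
HB.structure Definition CentralAlgebra (k : fieldType) :=
  {A of GRing.PzRing A & isCentralAlgebra k A}.

Arguments in_calg {k A} c : rename.

HB.instance Definition _ (k : fieldType) :=
  isCentralAlgebra.Build k k^o
    (fun _ _ => erefl) (fun _ _ => erefl) erefl (@mulrC k).

Section FfunAlgebra.
Variables (k : fieldType) (T : finType) (A : calgType k).

Definition ffun_in (c : k) : {ffun T -> A} := [ffun=> in_calg c].

Fact ffun_inD : {morph ffun_in : x y / x + y}.
Proof. by move=> x y; apply/ffunP => i; rewrite !ffunE in_calgD. Qed.
Fact ffun_inM : {morph ffun_in : x y / x * y}.
Proof. by move=> x y; apply/ffunP => i; rewrite !ffunE in_calgM. Qed.
Fact ffun_in1 : ffun_in 1 = 1.
Proof. by apply/ffunP => i; rewrite !ffunE in_calg1. Qed.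
Fact ffun_inC c x : ffun_in c * x = x * ffun_in c.
Proof. by apply/ffunP => i; rewrite !ffunE in_calgC. Qed.

HB.instance Definition _ :=
  isCentralAlgebra.Build k {ffun T -> A} ffun_inD ffun_inM ffun_in1 ffun_inC.
End FfunAlgebra.

(* The k-module underlying A: c *: x is in_calg c * x. *)
Definition modof (k : fieldType) (A : calgType k) : Type := A.

Section ModOf.
Variables (k : fieldType) (A : calgType k).

HB.instance Definition _ := GRing.Zmodule.copy (modof A) A.

Definition mscale (c : k) (x : modof A) : modof A := (in_calg c : A) * x.

Fact mscaleA c d x : mscale c (mscale d x) = mscale (c * d) x.
Proof. by rewrite /mscale in_calgM mulrA. Qed.
Fact mscale1 : left_id 1 mscale.
Proof. by move=> x; rewrite /mscale in_calg1 mul1r. Qed.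
Fact mscaleDr : right_distributive mscale +%R.
Proof. by move=> c x y; rewrite /mscale [LHS]mulrDr. Qed.
Fact mscaleDl x : {morph mscale^~ x : c d / c + d}.
Proof. by move=> c d; rewrite /mscale in_calgD [LHS]mulrDl. Qed.

HB.instance Definition _ :=
  GRing.Zmodule_isLmodule.Build k (modof A) mscaleA mscale1 mscaleDr mscaleDl.
End ModOf.

(* Tensor products over k: formal expressions modulo the congruence generated *)
(* by the module axioms and bilinearity of (u, v) |-> u (x) v. *)

Section Tensor.
Variables (k : fieldType) (U V : lmodType k).

Inductive tterm : Type :=
| TPure of U & V
| TAdd of tterm & tterm
| TScale of k & tterm.

Inductive tcong : tterm -> tterm -> Prop :=
| tc_refl x : tcong x x
| tc_sym x y : tcong x y -> tcong y x
| tc_trans x y z : tcong x y -> tcong y z -> tcong x z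
| tc_add x x' y y' : tcong x x' -> tcong y y' -> tcong (TAdd x y) (TAdd x' y')
| tc_scale c x x' : tcong x x' -> tcong (TScale c x) (TScale c x')
| tc_addA x y z : tcong (TAdd x (TAdd y z)) (TAdd (TAdd x y) z)
| tc_addC x y : tcong (TAdd x y) (TAdd y x)
| tc_add0 x : tcong (TAdd (TPure 0 0) x) x
| tc_addN x : tcong (TAdd (TScale (-1) x) x) (TPure 0 0)
| tc_scaleA c d x : tcong (TScale c (TScale d x)) (TScale (c * d) x)
| tc_scale1 x : tcong (TScale 1 x) x
| tc_scaleDr c x y : tcong (TScale c (TAdd x y)) (TAdd (TScale c x) (TScale c y))
| tc_scaleDl c d x : tcong (TScale (c + d) x) (TAdd (TScale c x) (TScale d x))
| tc_pureDl u u' v : tcong (TPure (u + u') v) (TAdd (TPure u v) (TPure u' v))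
| tc_pureDr u v v' : tcong (TPure u (v + v')) (TAdd (TPure u v) (TPure u v'))
| tc_pureZl c u v : tcong (TPure (c *: u) v) (TScale c (TPure u v))
| tc_pureZr c u v : tcong (TPure u (c *: v)) (TScale c (TPure u v)).

HB.instance Definition _ := gen_eqMixin tterm.
HB.instance Definition _ := gen_choiceMixin tterm.

Definition trel (x y : tterm) : bool := `[< tcong x y >].

Fact trel_refl : reflexive trel.
Proof. by move=> x; apply/asboolP; apply: tc_refl. Qed.
Fact trel_sym : symmetric trel.
Proof.
by move=> x y; apply/asboolP/asboolP => /tc_sym.
Qed.
Fact trel_trans : transitive trel.
Proof.
by move=> y x z /asboolP xy /asboolP yz; apply/asboolP; apply: tc_trans xy yz.
Qed.

Canonical trel_equiv := EquivRel trel trel_refl trel_sym trel_trans.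

Definition tens : Type := {eq_quot trel_equiv}.
HB.instance Definition _ := Choice.on tens.
HB.instance Definition _ := EqQuotient.on tens.

Lemma tpiP x y : (\pi_tens x = \pi_tens y) <-> tcong x y.
Proof. by split=> [/eqmodP/asboolP //|xy]; apply/eqmodP/asboolP. Qed.

Lemma trepr x : tcong (repr (\pi_tens x)) x.
Proof. by apply/tpiP; rewrite reprK. Qed.

Definition tpure u v : tens := \pi_tens (TPure u v).
Definition tadd (x y : tens) : tens := \pi_tens (TAdd (repr x) (repr y)).
Definition tscale c (x : tens) : tens := \pi_tens (TScale c (repr x)).
Definition tzero : tens := tpure 0 0.
Definition topp (x : tens) : tens := tscale (-1) x.

Lemma tadd_pi x y : tadd (\pi_tens x) (\pi_tens y) = \pi_tens (TAdd x y).
Proof. by apply/tpiP; apply: tc_add; apply: trepr. Qed.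
Lemma tscale_pi c x : tscale c (\pi_tens x) = \pi_tens (TScale c x).
Proof. by apply/tpiP; apply: tc_scale; apply: trepr. Qed.

Fact taddA : associative tadd.
Proof.
elim/quotW=> x; elim/quotW=> y; elim/quotW=> z.
rewrite (tadd_pi y z) (tadd_pi x y) !tadd_pi.
by apply/tpiP; apply: tc_addA.
Qed.
Fact taddC : commutative tadd.
Proof.
by elim/quotW=> x; elim/quotW=> y; rewrite !tadd_pi; apply/tpiP; apply: tc_addC.
Qed.
Fact tadd0 : left_id tzero tadd.
Proof. by elim/quotW=> x; rewrite tadd_pi; apply/tpiP; apply: tc_add0. Qed.
Fact taddN : left_inverse tzero topp tadd.
Proof.
by elim/quotW=> x; rewrite /topp tscale_pi tadd_pi; apply/tpiP; apply: tc_addN.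
Qed.

HB.instance Definition _ := GRing.isZmodule.Build tens taddA taddC tadd0 taddN.

Fact tscaleA c d x : tscale c (tscale d x) = tscale (c * d) x.
Proof.
by elim/quotW: x => x; rewrite (tscale_pi d x) !tscale_pi;
  apply/tpiP; apply: tc_scaleA.
Qed.
Fact tscale1 : left_id 1 tscale.
Proof. by elim/quotW=> x; rewrite tscale_pi; apply/tpiP; apply: tc_scale1. Qed.
Fact tscaleDr : right_distributive tscale +%R.
Proof.
move=> c; elim/quotW=> x; elim/quotW=> y.
rewrite /GRing.add /= (tadd_pi x y) !(tscale_pi c) tadd_pi.
by apply/tpiP; apply: tc_scaleDr.
Qed.
Fact tscaleDl x : {morph tscale^~ x : c d / c + d}.
Proof.
elim/quotW: x => x c d.
rewrite [in RHS]/GRing.add /= (tscale_pi c x) (tscale_pi d x) tscale_pi tadd_pi.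
by apply/tpiP; apply: tc_scaleDl.
Qed.

HB.instance Definition _ :=
  GRing.Zmodule_isLmodule.Build k tens tscaleA tscale1 tscaleDr tscaleDl.

Lemma tpureDl u u' v : tpure (u + u') v = tpure u v + tpure u' v.
Proof. by rewrite [RHS]tadd_pi; apply/tpiP; apply: tc_pureDl. Qed.
Lemma tpureDr u v v' : tpure u (v + v') = tpure u v + tpure u v'.
Proof. by rewrite [RHS]tadd_pi; apply/tpiP; apply: tc_pureDr. Qed.
Lemma tpureZl c u v : tpure (c *: u) v = c *: tpure u v.
Proof. by rewrite [RHS]tscale_pi; apply/tpiP; apply: tc_pureZl. Qed.
Lemma tpureZr c u v : tpure u (c *: v) = c *: tpure u v.
Proof. by rewrite [RHS]tscale_pi; apply/tpiP; apply: tc_pureZr. Qed.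

Lemma tens_ind (P : tens -> Prop) :
    (forall u v, P (tpure u v)) ->
    (forall x y, P x -> P y -> P (x + y)) ->
    (forall c x, P x -> P (c *: x)) ->
  forall x, P x.
Proof.
move=> Ppure Padd Pscale; elim/quotW; elim=> [u v|x Px y Py|c x Px].
- exact: Ppure.
- by rewrite -tadd_pi; apply: Padd.
- by rewrite -tscale_pi; apply: Pscale.
Qed.

(* [tlift f] is the linear map induced by a bilinear map f (see tlift_pure, *)
(* tliftD, tliftZ); its value is irrelevant when f is not bilinear. *)
Section Lift.
Variables (W : lmodType k) (f : U -> V -> W).

Fixpoint teval (x : tterm) : W :=
  match x with
  | TPure u v => f u v
  | TAdd x y => teval x + teval y
  | TScale c x => c *: teval x
  end.

Definition tlift (x : tens) : W := teval (repr x).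

Definition bilinear_map : Prop :=
  (forall v, linear (f^~ v)) /\ (forall u, linear (f u)).

Hypothesis f_bilin : bilinear_map.

Let fDl u u' v : f (u + u') v = f u v + f u' v.
Proof. by have := f_bilin.1 v 1 u u'; rewrite !scale1r. Qed.
Let fDr u v v' : f u (v + v') = f u v + f u v'.
Proof. by have := f_bilin.2 u 1 v v'; rewrite !scale1r. Qed.
Let f0l v : f 0 v = 0.
Proof. by apply: (addrI (f 0 v)); rewrite -fDl !addr0. Qed.
Let f0r u : f u 0 = 0.
Proof. by apply: (addrI (f u 0)); rewrite -fDr !addr0. Qed.
Let fZl c u v : f (c *: u) v = c *: f u v.
Proof. by have := f_bilin.1 v c u 0; rewrite f0l !addr0. Qed.
Let fZr c u v : f u (c *: v) = c *: f u v.
Proof. by have := f_bilin.2 u c v 0; rewrite f0r !addr0. Qed.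

Lemma teval_cong x y : tcong x y -> teval x = teval y.
Proof.
elim=> //= {x y}.
- by move=> x y z _ -> _ ->.
- by move=> x x' y y' _ -> _ ->.
- by move=> c x x' _ ->.
- by move=> x y z; rewrite addrA.
- by move=> x y; rewrite addrC.
- by move=> x; rewrite f0l add0r.
- by move=> x; rewrite f0l scaleN1r addNr.
- by move=> c d x; rewrite scalerA.
- by move=> x; rewrite scale1r.
- by move=> c x y; rewrite scalerDr.
- by move=> c d x; rewrite scalerDl.
Qed.

Lemma tlift_pure u v : tlift (tpure u v) = f u v.
Proof. by rewrite /tlift (teval_cong (trepr _)). Qed.
Lemma tliftD x y : tlift (x + y) = tlift x + tlift y.
Proof. by rewrite {1}/tlift (teval_cong (trepr _)). Qed.
Lemma tliftZ c x : tlift (c *: x) = c *: tlift x.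
Proof. by rewrite {1}/tlift (teval_cong (trepr _)). Qed.
End Lift.
End Tensor.

Notation tens2 A := (tens (modof A) (modof A)).
Notation tens3 A := (tens (tens (modof A) (modof A)) (modof A)).

Local Open Scope tensor_scope.

Definition ptens2 (k : fieldType) (A : calgType k) (x y : A) : tens2 A :=
  tpure (U := modof A) (V := modof A) x y.
Definition ptens3 (k : fieldType) (A : calgType k) (p : tens2 A) (x : A) :
  tens3 A := tpure (V := modof A) p x.

Notation "x ⊗ y" := (ptens2 x y) (at level 45, left associativity)
  : tensor_scope.
Notation "p ⊗₃ x" := (ptens3 p x) (at level 45, left associativity)
  : tensor_scope.

Section TensorOps.
Variables (k : fieldType) (A : calgType k).
Implicit Types (x y : A) (d : A -> A -> tens2 A).

Definition tflip : tens2 A -> tens2 A := tlift (fun a b : modof A => b ⊗ a).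

Definition outer x y : tens2 A -> tens2 A :=
  tlift (fun a b : modof A => (x * a) ⊗ (b * y)).

Definition tau123 : tens3 A -> tens3 A :=
  tlift (fun (p : tens2 A) (x3 : modof A) =>
    tlift (fun x1 x2 : modof A => (x3 ⊗ x1) ⊗₃ x2) p).

Definition tau132 : tens3 A -> tens3 A :=
  tlift (fun (p : tens2 A) (x3 : modof A) =>
    tlift (fun x1 x2 : modof A => (x2 ⊗ x3) ⊗₃ x1) p).

Definition brL d x : tens2 A -> tens3 A :=
  tlift (fun b c : modof A => d x b ⊗₃ c).
End TensorOps.

Definition tmap (k : fieldType) (A B : calgType k) (f : A -> B) :
  tens2 A -> tens2 B := tlift (fun a b : modof A => f a ⊗ f b).

Section TensorOpsTheory.
Variables (k : fieldType) (A : calgType k).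
Implicit Types (a b c x y : A) (d : A -> A -> tens2 A).

Definition is_calg_hom (B : calgType k) (f : A -> B) : Prop :=
  [/\ {morph f : x y / x + y}, {morph f : x y / x * y},
      f 1 = 1 & forall c : k, f (in_calg c) = in_calg c].

Lemma tens2_bilin (B : calgType k) (f g : modof A -> modof B) :
    linear f -> linear g ->
  bilinear_map (fun a b : modof A => f a ⊗ g b) /\
  bilinear_map (fun a b : modof A => g b ⊗ f a).
Proof.
by move=> fl gl; split; split=> [b|a] c u v;
  rewrite /ptens2 ?(fl, gl) ?(tpureDl, tpureDr) ?(tpureZl, tpureZr).
Qed.

Let mulr_lin x : linear (fun a : modof A => (a : A) * x : modof A).
Proof. by move=> c u v; rewrite [LHS]mulrDl -[in LHS]mulrA. Qed.

Let mull_lin x : linear (fun a : modof A => x * (a : A) : modof A).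
Proof.
by move=> c u v; rewrite [LHS]mulrDr [x * (in_calg c * u)]mulrA
  -in_calgC -mulrA.
Qed.

Let id_lin : linear (fun a : modof A => a).
Proof. by []. Qed.

Lemma tflip_pure a b : tflip (a ⊗ b) = b ⊗ a.
Proof. by rewrite /tflip tlift_pure //; case: (tens2_bilin id_lin id_lin). Qed.

Lemma outer_pure x y a b : outer x y (a ⊗ b) = (x * a) ⊗ (b * y).
Proof.
rewrite /outer tlift_pure //.
by case: (tens2_bilin (mull_lin x) (mulr_lin y)).
Qed.

Lemma brL_pure d a b c :
  bilinear_map (d : modof A -> modof A -> tens2 A) ->
  brL d a (b ⊗ c) = d a b ⊗₃ c.
Proof.
move=> [_ dl]; rewrite /brL tlift_pure //; split=> [v|u] e x y.
  by rewrite /ptens3 dl tpureDl tpureZl.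
by rewrite /ptens3 tpureDr tpureZr.
Qed.

Let tau_bilin (f : modof A -> modof A -> modof A -> tens3 A) :
    (forall c, bilinear_map (fun a b : modof A => f a b c)) ->
    (forall a b, linear (f a b : modof A -> tens3 A)) ->
  bilinear_map (fun (p : tens2 A) (c : modof A) =>
    tlift (fun a b : modof A => f a b c) p).
Proof.
move=> f12 f3; split=> [c e x y|p e x y]; first by rewrite tliftD // tliftZ.
elim/tens_ind: p => [a b|p q IHp IHq|e' p IHp].
- by rewrite !tlift_pure // f3.
- by rewrite !tliftD // IHp IHq scalerDr addrACA.
- by rewrite !tliftZ // IHp scalerDr !scalerA mulrC.
Qed.

Lemma tau123_pure a b c : tau123 ((a ⊗ b) ⊗₃ c) = (c ⊗ a) ⊗₃ b.
Proof.
rewrite /tau123 tlift_pure; last first.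
  apply: (tau_bilin (f := fun a b c : modof A => (c ⊗ a) ⊗₃ b)) => [z|x y].
    split=> [v|u] e x y;
      by rewrite /ptens3 /ptens2
    ?tpureDr ?tpureDl ?tpureZr ?tpureZl.
  by move=> e u v /=; rewrite /ptens3 /ptens2 !tpureDl !tpureZl.
by rewrite tlift_pure //;
  split=> [v|u] e x y; rewrite /ptens3 /ptens2
    ?tpureDr ?tpureDl ?tpureZr ?tpureZl.
Qed.

Lemma tau132_pure a b c : tau132 ((a ⊗ b) ⊗₃ c) = (b ⊗ c) ⊗₃ a.
Proof.
rewrite /tau132 tlift_pure; last first.
  apply: (tau_bilin (f := fun a b c : modof A => (b ⊗ c) ⊗₃ a)) => [z|x y].
    split=> [v|u] e x y;
      by rewrite /ptens3 /ptens2
    ?tpureDr ?tpureDl ?tpureZr ?tpureZl.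
  by move=> e u v /=; rewrite /ptens3 /ptens2
    !(tpureDl, tpureDr) !(tpureZl, tpureZr).
by rewrite tlift_pure //;
  split=> [v|u] e x y; rewrite /ptens3 /ptens2
    ?tpureDr ?tpureDl ?tpureZr ?tpureZl.
Qed.

Lemma tmap_pure (B : calgType k) (f : A -> B) a b :
  linear (f : modof A -> modof B) -> tmap f (a ⊗ b) = f a ⊗ f b.
Proof.
by move=> fl; rewrite /tmap tlift_pure //; case: (tens2_bilin fl fl).
Qed.
End TensorOpsTheory.

(* [adjoin R]: the k-algebra obtained from A by freely adjoining the *)
(* elements of X and imposing the relations R. *)

Section Terms.
Variables (k : fieldType) (A : calgType k) (X : Type).

Inductive aterm : Type :=
| ACst of A
| AVar of X
| AAdd of aterm & aterm
| AMul of aterm & aterm.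

Variable R : aterm -> aterm -> Prop.

Inductive acong : aterm -> aterm -> Prop :=
| ac_rel s t : R s t -> acong s t
| ac_refl s : acong s s
| ac_sym s t : acong s t -> acong t s
| ac_trans s t u : acong s t -> acong t u -> acong s u
| ac_add s s' t t' : acong s s' -> acong t t' -> acong (AAdd s t) (AAdd s' t')
| ac_mul s s' t t' : acong s s' -> acong t t' -> acong (AMul s t) (AMul s' t')
| ac_addA s t u : acong (AAdd s (AAdd t u)) (AAdd (AAdd s t) u)
| ac_addC s t : acong (AAdd s t) (AAdd t s)
| ac_add0 s : acong (AAdd (ACst 0) s) s
| ac_addN s : acong (AAdd (AMul (ACst (-1)) s) s) (ACst 0)
| ac_mulA s t u : acong (AMul s (AMul t u)) (AMul (AMul s t) u)
| ac_mul1 s : acong (AMul (ACst 1) s) s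
| ac_1mul s : acong (AMul s (ACst 1)) s
| ac_mulDl s t u : acong (AMul (AAdd s t) u) (AAdd (AMul s u) (AMul t u))
| ac_mulDr s t u : acong (AMul s (AAdd t u)) (AAdd (AMul s t) (AMul s u))
| ac_cstD a b : acong (ACst (a + b)) (AAdd (ACst a) (ACst b))
| ac_cstM a b : acong (ACst (a * b)) (AMul (ACst a) (ACst b))
| ac_central c s :
    acong (AMul (ACst (in_calg c)) s) (AMul s (ACst (in_calg c))).

HB.instance Definition _ := gen_eqMixin aterm.
HB.instance Definition _ := gen_choiceMixin aterm.

Definition arel (s t : aterm) : bool := `[< acong s t >].

Fact arel_refl : reflexive arel.
Proof. by move=> s; apply/asboolP; apply: ac_refl. Qed.
Fact arel_sym : symmetric arel.
Proof. by move=> s t; apply/asboolP/asboolP => /ac_sym. Qed.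
Fact arel_trans : transitive arel.
Proof.
by move=> t s u /asboolP st /asboolP tu; apply/asboolP; apply: ac_trans st tu.
Qed.

Canonical arel_equiv := EquivRel arel arel_refl arel_sym arel_trans.

Definition adjoin : Type := {eq_quot arel_equiv}.
HB.instance Definition _ := Choice.on adjoin.
HB.instance Definition _ := EqQuotient.on adjoin.

Lemma apiP s t : (\pi_adjoin s = \pi_adjoin t) <-> acong s t.
Proof. by split=> [/eqmodP/asboolP //|st]; apply/eqmodP/asboolP. Qed.

Lemma arepr s : acong (repr (\pi_adjoin s)) s.
Proof. by apply/apiP; rewrite reprK. Qed.

Definition aof (s : aterm) : adjoin := \pi_adjoin s.
Definition acst (a : A) : adjoin := aof (ACst a).
Definition avar (x : X) : adjoin := aof (AVar x).
Definition aadd (s t : adjoin) : adjoin := \pi_adjoin (AAdd (repr s) (repr t)).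
Definition amul (s t : adjoin) : adjoin := \pi_adjoin (AMul (repr s) (repr t)).
Definition aopp (s : adjoin) : adjoin := amul (acst (-1)) s.

Lemma aadd_pi s t : aadd (\pi_adjoin s) (\pi_adjoin t) = \pi_adjoin (AAdd s t).
Proof. by apply/apiP; apply: ac_add; apply: arepr. Qed.
Lemma amul_pi s t : amul (\pi_adjoin s) (\pi_adjoin t) = \pi_adjoin (AMul s t).
Proof. by apply/apiP; apply: ac_mul; apply: arepr. Qed.

Fact aaddA : associative aadd.
Proof.
elim/quotW=> s; elim/quotW=> t; elim/quotW=> u.
rewrite (aadd_pi t u) (aadd_pi s t) !aadd_pi.
by apply/apiP; apply: ac_addA.
Qed.
Fact aaddC : commutative aadd.
Proof.
by elim/quotW=> s; elim/quotW=> t; rewrite !aadd_pi; apply/apiP; apply: ac_addC.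
Qed.
Fact aadd0 : left_id (acst 0) aadd.
Proof. by elim/quotW=> s; rewrite aadd_pi; apply/apiP; apply: ac_add0. Qed.
Fact aaddN : left_inverse (acst 0) aopp aadd.
Proof.
by elim/quotW=> s; rewrite /aopp amul_pi aadd_pi; apply/apiP; apply: ac_addN.
Qed.

HB.instance Definition _ :=
  GRing.isZmodule.Build adjoin aaddA aaddC aadd0 aaddN.

Fact amulA : associative amul.
Proof.
elim/quotW=> s; elim/quotW=> t; elim/quotW=> u.
rewrite (amul_pi t u) (amul_pi s t) !amul_pi.
by apply/apiP; apply: ac_mulA.
Qed.
Fact amul1 : left_id (acst 1) amul.
Proof. by elim/quotW=> s; rewrite amul_pi; apply/apiP; apply: ac_mul1. Qed.
Fact a1mul : right_id (acst 1) amul.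
Proof. by elim/quotW=> s; rewrite amul_pi; apply/apiP; apply: ac_1mul. Qed.
Fact amulDl : left_distributive amul +%R.
Proof.
elim/quotW=> s; elim/quotW=> t; elim/quotW=> u.
rewrite /GRing.add /= (aadd_pi s t) (amul_pi s u) (amul_pi t u) amul_pi aadd_pi.
by apply/apiP; apply: ac_mulDl.
Qed.
Fact amulDr : right_distributive amul +%R.
Proof.
elim/quotW=> s; elim/quotW=> t; elim/quotW=> u.
rewrite /GRing.add /= (aadd_pi t u) (amul_pi s t) (amul_pi s u) amul_pi aadd_pi.
by apply/apiP; apply: ac_mulDr.
Qed.

HB.instance Definition _ :=
  GRing.Zmodule_isPzRing.Build adjoin amulA amul1 a1mul amulDl amulDr.

Lemma acstD a b : acst (a + b) = acst a + acst b.
Proof. by rewrite [RHS]aadd_pi; apply/apiP; apply: ac_cstD. Qed.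
Lemma acstM a b : acst (a * b) = acst a * acst b.
Proof. by rewrite [RHS]amul_pi; apply/apiP; apply: ac_cstM. Qed.
Lemma acst0 : acst 0 = 0. Proof. by []. Qed.
Lemma acst1 : acst 1 = 1. Proof. by []. Qed.

Definition adj_in (c : k) : adjoin := acst (in_calg c).

Fact adj_inD : {morph adj_in : x y / x + y}.
Proof. by move=> x y; rewrite /adj_in in_calgD acstD. Qed.
Fact adj_inM : {morph adj_in : x y / x * y}.
Proof. by move=> x y; rewrite /adj_in in_calgM acstM. Qed.
Fact adj_in1 : adj_in 1 = 1.
Proof. by rewrite /adj_in in_calg1. Qed.
Fact adj_inC c x : adj_in c * x = x * adj_in c.
Proof.
by elim/quotW: x => x; rewrite [LHS]amul_pi [RHS]amul_pi;
  apply/apiP; apply: ac_central.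
Qed.

HB.instance Definition _ :=
  isCentralAlgebra.Build k adjoin adj_inD adj_inM adj_in1 adj_inC.

Lemma aofD s t : aof (AAdd s t) = aof s + aof t.
Proof. by rewrite [RHS]aadd_pi. Qed.
Lemma aofM s t : aof (AMul s t) = aof s * aof t.
Proof. by rewrite [RHS]amul_pi. Qed.
Lemma aof_rel s t : R s t -> aof s = aof t.
Proof. by move=> Rst; apply/apiP; apply: ac_rel. Qed.

Lemma adjoin_ind (P : adjoin -> Prop) :
    (forall a, P (acst a)) -> (forall x, P (avar x)) ->
    (forall s t, P s -> P t -> P (s + t)) ->
    (forall s t, P s -> P t -> P (s * t)) ->
  forall s, P s.
Proof.
move=> Pc Pv Pa Pm; elim/quotW; elim=> [a|x|s Ps t Pt|s Ps t Pt].
- exact: Pc.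
- exact: Pv.
- by rewrite -aadd_pi; apply: Pa.
- by rewrite -amul_pi; apply: Pm.
Qed.
End Terms.

(* Algebras over B = \oplus_(s in verts) k e_s: k-algebras with a family of *)
(* orthogonal idempotents indexed by verts and summing to 1.  Elements of I *)
(* outside verts are unused labels; their value is normalised to 0. *)

Record balg (k : fieldType) (I : finType) := BAlg {
  balg_alg :> calgType k;
  verts : {set I};
  idm : I -> balg_alg;
  idm_mul : forall s t, idm s * idm t = if s == t then idm s else 0;
  idm_out : forall s, s \notin verts -> idm s = 0;
  idm_sum : \sum_(s in verts) idm s = 1
}.

Section Hdqp.
Variables (k : fieldType) (I : finType) (A : balg k I).
Implicit Types (d : A -> A -> tens2 A) (a b c Phi : A).

Local Notation e := (idm A).

Definition is_double_bracket d : Prop :=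
  [/\ bilinear_map (d : modof A -> modof A -> tens2 A),
      forall a b, d a b = - tflip (d b a),
      forall a b c, d a (b * c) = outer 1 c (d a b) + outer b 1 (d a c)
    & forall s a, s \in verts A -> d (e s) a = 0].

Definition quasi_poisson_rhs a b c : tens3 A :=
  4%:R^-1 *: \sum_(s in verts A)
    ((c * e s * a) ⊗ (e s * b) ⊗₃ e s
     - (c * e s * a) ⊗ e s ⊗₃ (b * e s)
     - (c * e s) ⊗ (a * e s * b) ⊗₃ e s
     + (c * e s) ⊗ (a * e s) ⊗₃ (b * e s)
     - (e s * a) ⊗ (e s * b) ⊗₃ (e s * c)
     + (e s * a) ⊗ e s ⊗₃ (b * e s * c)
     + e s ⊗ (a * e s * b) ⊗₃ (e s * c)
     - e s ⊗ (a * e s) ⊗₃ (b * e s * c)).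

Definition is_quasi_poisson d : Prop :=
  forall a b c,
    brL d a (d b c) + tau123 (brL d b (d c a)) + tau132 (brL d c (d a b))
    = quasi_poisson_rhs a b c.

Definition mcomp Phi s : A := e s * Phi * e s.

Definition is_moment_map d Phi : Prop :=
  [/\ exists Psi, Phi * Psi = 1 /\ Psi * Phi = 1,
      Phi = \sum_(s in verts A) mcomp Phi s
    & forall s a, s \in verts A ->
        d (mcomp Phi s) a =
          2%:R^-1 *: ((a * e s) ⊗ mcomp Phi s - e s ⊗ (mcomp Phi s * a)
                      + (a * mcomp Phi s) ⊗ e s - mcomp Phi s ⊗ (e s * a))].

(* A Hamiltonian double quasi-Poisson structure on A. *)
Record hdqp := Hdqp {
  dbr : A -> A -> tens2 A;
  mom : A;
  dbrP : is_double_bracket dbr;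
  quasi_poissonP : is_quasi_poisson dbr;
  momP : is_moment_map dbr mom
}.
End Hdqp.

(* Isomorphisms of Hamiltonian double quasi-Poisson algebras over B, where *)
(* the vertex s of A is identified with the vertex h s of A'. *)
Record is_hdqp_iso (k : fieldType) (I J : finType) (h : I -> J)
    (A : balg k I) (A' : balg k J) (H : hdqp A) (H' : hdqp A')
    (psi : A -> A') : Prop := {
  iso_labels : {in verts A &, injective h};
  iso_verts : verts A' = [set h s | s in verts A];
  iso_bij : bijective psi;
  iso_hom : is_calg_hom psi;
  iso_idm : forall s, s \in verts A -> psi (idm A s) = idm A' (h s);
  iso_dbr : forall x y, dbr H' (psi x) (psi y) = tmap psi (dbr H x y);
  iso_mom : psi (mom H) = mom H'
}.

Section AdjoinB.
Variables (k : fieldType) (I : finType) (A : balg k I) (X : Type).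
Variable R : aterm A X -> aterm A X -> Prop.

Let f (a : A) : adjoin R := acst R a.

Fact adj_idm_mul s t :
  f (idm A s) * f (idm A t) = if s == t then f (idm A s) else 0.
Proof. by rewrite /f -acstM idm_mul; case: ifP. Qed.
Fact adj_idm_out s : s \notin verts A -> f (idm A s) = 0.
Proof. by move=> sA; rewrite /f idm_out. Qed.
Fact adj_idm_sum : \sum_(s in verts A) f (idm A s) = 1.
Proof.
by rewrite -(big_morph f (@acstD _ _ _ R) (erefl (f 0))) idm_sum.
Qed.

Definition adjoinB : balg k I := BAlg adj_idm_mul adj_idm_out adj_idm_sum.
End AdjoinB.

Section Localise.
Variables (k : fieldType) (I : finType) (A : balg k I).
(* inverting, for all t : T, the element x t of e_(v t) A e_(v t) *)
Variables (T : Type) (v : T -> I) (x : T -> A).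

Local Notation cst := (@ACst k A T).
Local Notation var := (@AVar k A T).

Inductive loc_rel : aterm A T -> aterm A T -> Prop :=
| loc_corner t :
    loc_rel (var t) (AMul (AMul (cst (idm A (v t))) (var t)) (cst (idm A (v t))))
| loc_invr t : loc_rel (AMul (cst (x t)) (var t)) (cst (idm A (v t)))
| loc_invl t : loc_rel (AMul (var t) (cst (x t))) (cst (idm A (v t))).

Definition localise : balg k I := adjoinB loc_rel.
Definition to_loc (a : A) : localise := acst loc_rel a.
Definition loc_inv (t : T) : localise := avar loc_rel t.
End Localise.

(* The vertices 1 and 2 are false and true. *)
Local Notation v1 := false (only parsing).
Local Notation v2 := true (only parsing).

Variant qgen (n : nat) :=
| Ge of bool
| Ga of 'I_n
| Gb of 'I_n.

Section Path.
Variables (k : fieldType) (n : nat).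

Local Notation cst := (@ACst k k^o (qgen n)).
Local Notation e s := (@AVar k k^o (qgen n) (Ge n s)).
Local Notation a i := (@AVar k k^o (qgen n) (Ga i)).
Local Notation b i := (@AVar k k^o (qgen n) (Gb i)).

Inductive path_rel : aterm k^o (qgen n) -> aterm k^o (qgen n) -> Prop :=
| path_orth s t : path_rel (AMul (e s) (e t)) (if s == t then e s else cst 0)
| path_unit : path_rel (AAdd (e v1) (e v2)) (cst 1)
| path_a i : path_rel (a i) (AMul (AMul (e v2) (a i)) (e v1))
| path_b i : path_rel (b i) (AMul (AMul (e v1) (b i)) (e v2)).

Let pe s : adjoin path_rel := avar path_rel (Ge n s).

Fact path_idm_mul s t : pe s * pe t = if s == t then pe s else 0.
Proof. by rewrite -aofM (aof_rel (path_orth s t)); case: ifP. Qed.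
Fact path_idm_out s : s \notin [set: bool] -> pe s = 0.
Proof. by rewrite in_setT. Qed.
Fact path_idm_sum : \sum_(s in [set: bool]) pe s = 1.
Proof.
rewrite (eq_bigl xpredT) => [|s]; last by rewrite in_setT.
by rewrite big_bool /= addrC -aofD (aof_rel path_unit).
Qed.

Definition path_alg : balg k bool :=
  BAlg path_idm_mul path_idm_out path_idm_sum.
Definition path_a_ (i : 'I_n) : path_alg := avar path_rel (Ga i).
Definition path_b_ (i : 'I_n) : path_alg := avar path_rel (Gb i).
End Path.

Variant letter (n : nat) :=
| La of 'I_n
| Lb of 'I_n.

Section Continuants.
Variables (k : fieldType) (n : nat) (A : balg k bool) (a b : 'I_n -> A).

Definition letter_val (y : letter n) : A :=
  match y with La i => a i | Lb i => b i end.
Definition letter_idm (y : letter n) : A :=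
  match y with La _ => idm A v2 | Lb _ => idm A v1 end.

(* [rcontinuant [:: y_k; ...; y_1]] is (y_1, ..., y_k); only non-empty words *)
(* are meaningful. *)
Fixpoint rcontinuant (w : seq (letter n)) : A :=
  match w with
  | [::] => 1
  | y :: w' =>
    match w' with
    | [::] => letter_val y
    | [:: y1] => letter_idm y1 + letter_val y1 * letter_val y
    | _ :: w'' => rcontinuant w' * letter_val y + rcontinuant w''
    end
  end.

Definition continuant (w : seq (letter n)) : A := rcontinuant (rev w).
End Continuants.

(* (a_1, b_1, ..., a_m, b_m), and (b_m, a_m, ..., b_1, a_1), for m <= n. The *)
(* indices 1, ..., n are represented by 0, ..., n - 1 in 'I_n. *)
Definition word_ab (n m : nat) : seq (letter n) :=
  flatten [seq [:: La i; Lb i] | i <- take m (enum 'I_n)].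
Definition word_ba (n m : nat) : seq (letter n) := rev (word_ab n m).

(* (a_1, ..., b_m) lies in e_2 A e_2 and (b_m, ..., a_1) in e_1 A e_1. *)
Definition euler (k : fieldType) (n : nat) (A : balg k bool)
    (a b : 'I_n -> A) (m : nat) (s : bool) : A :=
  continuant a b (if s then word_ab n m else word_ba n m).

Section Boalch.
Variables (k : fieldType) (n : nat).

Let P := path_alg k n.

Definition boalch : balg k bool :=
  localise (fun s : bool => s) (euler (@path_a_ k n) (@path_b_ k n) n).

Definition to_boalch : P -> boalch := @to_loc k bool P _ _ _.
Definition bo_a (i : 'I_n) : boalch := to_boalch (path_a_ k i).
Definition bo_b (i : 'I_n) : boalch := to_boalch (path_b_ k i).
Definition bo_inv (s : bool) : boalch := @loc_inv k bool P _ _ _ s.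

(* The pair (m, s) : 'I_n.-1 * bool stands for the continuants of index m + 1, *)
(* i.e. 1 <= m + 1 <= n - 1. *)
Definition boalch_loc : balg k bool :=
  localise (fun p : 'I_n.-1 * bool => p.2)
           (fun p => euler bo_a bo_b p.1.+1 p.2).

Definition to_boalch_loc : boalch -> boalch_loc := @to_loc k bool boalch _ _ _.

Local Notation e1 := (idm boalch v1).
Local Notation e2 := (idm boalch v2).
Local Notation a := bo_a.
Local Notation b := bo_b.
Local Notation half := (2%:R^-1 : k).
Local Notation sgn i j := ((sgz (i%:Z - j%:Z))%:~R : k).

Definition is_boalch_hdqp (H : hdqp boalch) : Prop :=
  [/\ forall i j : 'I_n,
        dbr H (a i) (a j) = (half * sgn i j) *: (a i ⊗ a j + a j ⊗ a i),
      forall i j : 'I_n,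
        dbr H (b i) (b j) = (half * sgn i j) *: (b i ⊗ b j + b j ⊗ b i),
      forall i j : 'I_n,
        dbr H (a i) (b j) =
          if (i < j)%N then half *: (e1 ⊗ (a i * b j) + (b j * a i) ⊗ e2)
          else if i == j then
            half *: (e1 ⊗ (a i * b i) + (b i * a i) ⊗ e2) + e1 ⊗ e2
          else - (half *: (e1 ⊗ (a i * b j) + (b j * a i) ⊗ e2))
               - (if (i == j.+1 :> nat) then e1 ⊗ e2 else 0)
    & mom H = euler a b n v2 + bo_inv v1].

Definition is_boalch_loc_hdqp (H : hdqp boalch) (Hloc : hdqp boalch_loc) :
    Prop :=
  (forall x y, dbr Hloc (to_boalch_loc x) (to_boalch_loc y)
               = tmap to_boalch_loc (dbr H x y))
  /\ mom Hloc = to_boalch_loc (mom H).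
End Boalch.

Section DirectSum.
Variables (k : fieldType) (I : finType) (n : nat) (A : balg k I).

Definition dsum_in (l : 'I_n) (x : A) : {ffun 'I_n -> A} :=
  [ffun m => if m == l then x else 0].

Let V : {set 'I_n * I} := [set p | p.2 \in verts A].
Let f (p : 'I_n * I) := dsum_in p.1 (idm A p.2).

Fact dsum_idm_mul p q : f p * f q = if p == q then f p else 0.
Proof.
case: p q => [l s] [m t]; apply/ffunP => i; rewrite xpair_eqE.
transitivity (if (l == m) && (s == t) then f (l, s) i else 0); last first.
  by case: ifP; rewrite ?ffunE.
rewrite !ffunE /=; have [->|_] := eqVneq i l; last by rewrite mul0r; case: ifP.
by have [_|_] := eqVneq l m; rewrite ?idm_mul ?mulr0.
Qed.
Fact dsum_idm_out p : p \notin V -> f p = 0.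
Proof.
rewrite inE => pA; apply/ffunP => i; rewrite !ffunE idm_out //.
by case: ifP.
Qed.
Fact dsum_idm_sum : \sum_(p in V) f p = 1.
Proof.
apply/ffunP => i; rewrite sum_ffunE ffunE.
rewrite (eq_bigl (fun p => xpredT p.1 && (p.2 \in verts A))); last first.
  by move=> p; rewrite inE.
rewrite -(pair_big xpredT (mem (verts A)) (fun l s => f (l, s) i)) /=.
rewrite (bigD1 i) //= [X in _ + X]big1 ?addr0 => [|l il].
  by rewrite -[RHS](idm_sum A); apply: eq_bigr => s _; rewrite ffunE eqxx.
by apply: big1 => s _; rewrite ffunE /= eq_sym (negPf il).
Qed.

Definition dsum : balg k ('I_n * I)%type :=
  @BAlg k _ {ffun 'I_n -> A} V f dsum_idm_mul dsum_idm_out dsum_idm_sum.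

Definition is_dsum_hdqp (H : hdqp A) (Hs : hdqp dsum) : Prop :=
  (forall l m x y, dbr Hs (dsum_in l x) (dsum_in m y)
     = if l == m then @tmap k A dsum (dsum_in l) (dbr H x y) else 0)
  /\ mom Hs = \sum_(l < n) dsum_in l (mom H).
End DirectSum.

Section Corner.
Variables (k : fieldType) (I : finType) (A : balg k I) (j : I).

Definition eps : A := 1 - idm A j.

Lemma epsK : eps * eps = eps.
Proof. by rewrite /eps mulrBl mul1r mulrBr mulr1 idm_mul eqxx subrr subr0. Qed.

Definition in_corner (x : A) : bool := eps * x * eps == x.

Record corner : Type := Corner { cval : A; cvalP : in_corner cval }.

HB.instance Definition _ := [isSub for cval].
HB.instance Definition _ := [Choice of corner by <:].

Fact corner_zmod : zmod_closed in_corner.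
Proof.
have inE z : (z \in in_corner) = (eps * z * eps == z) by [].
split=> [|x y]; rewrite !inE; first by rewrite mulr0 mul0r.
by move=> /eqP xP /eqP yP; rewrite (mulrBr eps) (mulrBl eps) xP yP.
Qed.
HB.instance Definition _ := GRing.isZmodClosed.Build A in_corner corner_zmod.
HB.instance Definition _ := [SubChoice_isSubZmodule of corner by <:].

Fact cproj_subproof x : in_corner (eps * x * eps).
Proof. by apply/eqP; rewrite !mulrA epsK -!mulrA epsK. Qed.

Definition cproj (x : A) : corner := Corner (cproj_subproof x).

Lemma cprojE (x : corner) : cproj (cval x) = x.
Proof. by apply: val_inj; apply/eqP; case: x. Qed.
Lemma cprojD : {morph cproj : x y / x + y}.
Proof.
by move=> x y; apply: val_inj; rewrite /= (mulrDr eps) (mulrDl _ _ eps).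
Qed.

Lemma cvalD : {morph cval : x y / x + y}.
Proof. by []. Qed.

Definition cmul (x y : corner) : corner := cproj (cval x * cval y).

Lemma epsl (x : corner) : eps * cval x = cval x.
Proof. by case: x => x /= /eqP <-; rewrite !mulrA epsK. Qed.
Lemma epsr (x : corner) : cval x * eps = cval x.
Proof. by case: x => x /= /eqP <-; rewrite -!mulrA epsK. Qed.
Lemma cmulE (x y : corner) : cval (cmul x y) = cval x * cval y.
Proof. by rewrite /= !mulrA epsl -mulrA epsr. Qed.

Fact cmulA : associative cmul.
Proof.
by move=> x y z; apply: val_inj; rewrite [LHS]cmulE [RHS]cmulE !cmulE mulrA.
Qed.
Fact cmul1 : left_id (cproj 1) cmul.
Proof. by move=> x; apply: val_inj; rewrite [LHS]cmulE /= mulr1 epsK epsl. Qed.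
Fact c1mul : right_id (cproj 1) cmul.
Proof. by move=> x; apply: val_inj; rewrite [LHS]cmulE /= mulr1 epsK epsr. Qed.
Fact cmulDl : left_distributive cmul +%R.
Proof.
by move=> x y z; apply: val_inj; rewrite [RHS]cvalD [LHS]cmulE !cmulE cvalD mulrDl.
Qed.
Fact cmulDr : right_distributive cmul +%R.
Proof.
by move=> x y z; apply: val_inj; rewrite [RHS]cvalD [LHS]cmulE !cmulE cvalD mulrDr.
Qed.

HB.instance Definition _ :=
  GRing.Zmodule_isPzRing.Build corner cmulA cmul1 c1mul cmulDl cmulDr.

Definition corner_in (c : k) : corner := cproj (in_calg c).

Lemma corner_inE c : cval (corner_in c) = in_calg c * eps.
Proof. by rewrite /= -in_calgC -mulrA epsK. Qed.

Fact corner_inD : {morph corner_in : x y / x + y}.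
Proof. by move=> x y; rewrite /corner_in in_calgD cprojD. Qed.
Fact corner_inM : {morph corner_in : x y / x * y}.
Proof.
move=> x y; apply: val_inj; rewrite [LHS]corner_inE [RHS]cmulE.
rewrite !corner_inE in_calgM.
by rewrite [RHS]mulrA -[_ * _ * in_calg y]mulrA -(in_calgC y eps) -!mulrA epsK.
Qed.
Fact corner_in1 : corner_in 1 = 1.
Proof. by rewrite /corner_in in_calg1. Qed.
Fact corner_inC c x : corner_in c * x = x * corner_in c.
Proof.
apply: val_inj; rewrite [LHS]cmulE [RHS]cmulE !corner_inE.
by rewrite -mulrA epsl (in_calgC c eps) mulrA epsr in_calgC.
Qed.

HB.instance Definition _ :=
  isCentralAlgebra.Build k corner corner_inD corner_inM corner_in1 corner_inC.
End Corner.

Variant funit := Eij | Eji.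

Section Fusion.
Variables (k : fieldType) (I : finType) (A : balg k I) (i j : I).

(* the matrix units e_ii = e_i, e_ij, e_ji, e_jj = e_j; false is i, true is j *)
Definition munit (p q : bool) : aterm A funit :=
  match p, q with
  | false, false => ACst funit (idm A i)
  | false, true => AVar A Eij
  | true, false => AVar A Eji
  | true, true => ACst funit (idm A j)
  end.

Inductive fus_rel : aterm A funit -> aterm A funit -> Prop :=
| fus_unit s t u v :
    fus_rel (AMul (munit s t) (munit u v))
            (if t == u then munit s v else ACst funit 0).

Definition fus_bar : balg k I := adjoinB fus_rel.
Definition to_bar (x : A) : fus_bar := acst fus_rel x.
Definition eij : fus_bar := avar fus_rel Eij.
Definition eji : fus_bar := avar fus_rel Eji.

Let F := corner fus_bar j.
Let fe (s : I) : F := cproj j (idm fus_bar s).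

Let fe_val s : cval (fe s) = if s == j then 0 else idm fus_bar s.
Proof.
have -> : cval (fe s) = eps fus_bar j * idm fus_bar s * eps fus_bar j by [].
have -> : eps fus_bar j * idm fus_bar s = if s == j then 0 else idm fus_bar s.
  rewrite /eps mulrBl mul1r idm_mul [j == s]eq_sym.
  by case: eqP => [->|_]; rewrite ?subrr ?subr0.
case: ifP => [_|sj]; first by rewrite mul0r.
by rewrite /eps mulrBr mulr1 idm_mul sj subr0.
Qed.

Fact fus_idm_mul s t : fe s * fe t = if s == t then fe s else 0.
Proof.
apply: val_inj; rewrite [LHS]cmulE !fe_val.
case: (eqVneq s t) => [<-|st].
  by rewrite [RHS]fe_val; case: ifP; rewrite ?mul0r // idm_mul eqxx.
by do 2![case: ifP => _]; rewrite ?(mul0r, mulr0) // idm_mul (negPf st).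
Qed.
Fact fus_idm_out s : s \notin verts A :\ j -> fe s = 0.
Proof.
rewrite in_setD1 negb_and negbK => sA; apply: val_inj; rewrite [LHS]fe_val.
by case: ifP sA => //= _ sA; apply: (@idm_out _ _ fus_bar s sA).
Qed.
Fact fus_idm_sum : \sum_(s in verts A :\ j) fe s = 1.
Proof.
have E1 : (1 : F) = cproj j 1 by [].
have c0 : cproj j (0 : fus_bar) = 0 by apply: val_inj; rewrite /= mulr0 mul0r.
rewrite E1 -(idm_sum fus_bar) (big_morph _ (@cprojD k I fus_bar j) c0).
have fej : cproj j (idm fus_bar j) = 0.
  by apply: val_inj; rewrite [LHS](fe_val j) eqxx.
have [jA|jA] := boolP (j \in verts A).
  by rewrite [RHS](big_setD1 j) //= fej add0r.
apply: eq_bigl => s; rewrite in_setD1.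
by case: eqVneq => // ->; rewrite (negPf jA).
Qed.

Definition fusion : balg k I :=
  @BAlg k I F (verts A :\ j) fe fus_idm_mul fus_idm_out fus_idm_sum.

Local Notation half := (2%:R^-1 : k).
Local Notation e := (idm fusion i).
Local Notation epsA := (eps A j).

(* the generators t, e_ij u, v e_ji, e_ij w e_ji of the fusion algebra; they *)
(* lie in the corner, where cproj is the identity *)
Definition gen_t (t : A) : fusion := cproj j (to_bar t).
Definition gen_u (u : A) : fusion := cproj j (eij * to_bar u).
Definition gen_v (v : A) : fusion := cproj j (to_bar v * eji).
Definition gen_w (w : A) : fusion := cproj j (eij * to_bar w * eji).

Definition type_t (t : A) : Prop := t = epsA * t * epsA.
Definition type_u (u : A) : Prop := u = idm A j * u * epsA.
Definition type_v (v : A) : Prop := v = epsA * v * idm A j.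
Definition type_w (w : A) : Prop := w = idm A j * w * idm A j.

Record is_dfus (d : fusion -> fusion -> tens2 fusion) : Prop := {
  dfus_double_bracket : is_double_bracket d;
  dfus_tt : forall t t', type_t t -> type_t t' ->
    d (gen_t t) (gen_t t') = 0;
  dfus_tu : forall t u, type_t t -> type_u u ->
    d (gen_t t) (gen_u u) =
      half *: (e ⊗ (gen_t t * gen_u u) - (e * gen_t t) ⊗ gen_u u);
  dfus_tv : forall t v, type_t t -> type_v v ->
    d (gen_t t) (gen_v v) =
      half *: ((gen_v v * gen_t t) ⊗ e - gen_v v ⊗ (gen_t t * e));
  dfus_tw : forall t w, type_t t -> type_w w ->
    d (gen_t t) (gen_w w) =
      half *: ((gen_w w * gen_t t) ⊗ e + e ⊗ (gen_t t * gen_w w)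
               - gen_w w ⊗ (gen_t t * e) - (e * gen_t t) ⊗ gen_w w);
  dfus_uu : forall u u', type_u u -> type_u u' ->
    d (gen_u u) (gen_u u') =
      half *: (e ⊗ (gen_u u * gen_u u') - (gen_u u' * gen_u u) ⊗ e);
  dfus_uv : forall u v, type_u u -> type_v v ->
    d (gen_u u) (gen_v v) =
      half *: (gen_u u ⊗ (e * gen_v v) - gen_v v ⊗ (gen_u u * e));
  dfus_uw : forall u w, type_u u -> type_w w ->
    d (gen_u u) (gen_w w) =
      half *: (e ⊗ (gen_u u * gen_w w) - gen_w w ⊗ (gen_u u * e));
  dfus_vv : forall v v', type_v v -> type_v v' ->
    d (gen_v v) (gen_v v') =
      half *: ((gen_v v' * gen_v v) ⊗ e - e ⊗ (gen_v v * gen_v v'));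
  dfus_vw : forall v w, type_v v -> type_w w ->
    d (gen_v v) (gen_w w) =
      half *: ((gen_w w * gen_v v) ⊗ e - (e * gen_v v) ⊗ gen_w w);
  dfus_ww : forall w w', type_w w -> type_w w' ->
    d (gen_w w) (gen_w w') = 0
}.

Definition is_dbar (H : hdqp A) (dbar : fus_bar -> fus_bar -> tens2 fus_bar) :
    Prop :=
  [/\ is_double_bracket dbar,
      forall x y, dbar (to_bar x) (to_bar y) = tmap to_bar (dbr H x y),
      forall z, dbar eij z = 0
    & forall z, dbar eji z = 0].

Definition cinc (x : fusion) : fus_bar := cval x.

Definition is_fusion_hdqp (H : hdqp A) (Hf : hdqp fusion) : Prop :=
  [/\ [/\ i \in verts A, j \in verts A & i != j],
      exists dbar dres dfus,
        [/\ is_dbar H dbar,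
            forall x y, tmap cinc (dres x y) = dbar (cinc x) (cinc y),
            is_dfus dfus
          & forall x y, dbr Hf x y = dres x y + dfus x y]
    & cinc (mom Hf) =
        to_bar (mcomp (mom H) i) * eij * to_bar (mcomp (mom H) j) * eji
        + \sum_(s in verts A :\: [set i; j]) to_bar (mcomp (mom H) s)].
End Fusion.

Fixpoint fuse_seq (k : fieldType) (I : finType) (l : seq (I * I))
    (A : balg k I) : balg k I :=
  match l with
  | [::] => A
  | (i, j) :: l' => fuse_seq l' (fusion A i j)
  end.

Fixpoint is_fuse_seq_hdqp (k : fieldType) (I : finType) (l : seq (I * I))
    (A : balg k I) : hdqp A -> hdqp (fuse_seq l A) -> Prop :=
  match l return hdqp A -> hdqp (fuse_seq l A) -> Prop with
  | [::] => fun H Hf => Hf = H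
  | (i, j) :: l' => fun H Hf =>
      exists2 H' : hdqp (fusion A i j),
        is_fusion_hdqp H H' & is_fuse_seq_hdqp H' Hf
  end.

Section AFus.
Variables (k : fieldType) (n : nat) (n_gt0 : (0 < n)%N).

(* The label (l, s) stands for e_(s, l); e_1 and e_2 are those of the first *)
(* copy. *)
Definition copy1 : 'I_n := Ordinal n_gt0.

Definition fus_pairs : seq (('I_n * bool) * ('I_n * bool)) :=
  flatten [seq [:: ((copy1, v1), (l, v1)); ((copy1, v2), (l, v2))]
          | l <- enum 'I_n & l != copy1].

Definition A_fus : balg k ('I_n * bool)%type :=
  fuse_seq fus_pairs (dsum n (boalch k 1)).

Definition is_A_fus_hdqp (H : hdqp A_fus) : Prop :=
  exists (H1 : hdqp (boalch k 1)) (Hs : hdqp (dsum n (boalch k 1))),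
    [/\ is_boalch_hdqp H1, is_dsum_hdqp H1 Hs & is_fuse_seq_hdqp Hs H].
End AFus.

(* Main.v *)
(* Write c_l, d_l for the generators of the l-th copy of B(Gamma_1) and put
   P_l = e_2 + c_l d_l, Q_l = e_1 + d_l c_l and u_l = P_l^-1 c_l = c_l Q_l^-1.
   The isomorphism psi sends b_l to d_l and a_l to c_l - u_(l-1), with u_0 = 0.
   The recursions defining continuants then give (a_1, ..., b_m) = P_1 ... P_m
   and (b_m, ..., a_1) = Q_m ... Q_1, so psi extends to the localisation and
   maps the moment map to the fused one.  The inverse sends c_m to
   (a_1, ..., b_(m-1))^-1 (a_1, ..., a_m).

   On the other copies, the bracket with an element of a fused copy is an inner
   derivation, and {c_l, d_l} yields {c_l, u_l} = - 1/2 (c_l (x) u_l + u_l (x) c_l)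
   and {u_l, u_l} = 0.  Hence c_1, u_1, c_2, u_2, ... is a chain in which
   {p, q} = - 1/2 (p (x) q + q (x) p) for p before q, and the brackets of the
   differences a_l follow by bilinearity.  The extra term of {a_(l+1), b_l} comes
   from {u_l, d_l}. *)

Require Import Defs.
From HB Require Import structures.
From mathcomp Require Import all_boot all_order all_algebra.
From mathcomp Require boolp.

Set Implicit Arguments.
Unset Strict Implicit.
Unset Printing Implicit Defensive.

Import GRing.Theory Num.Theory.
Local Open Scope ring_scope.
Local Open Scope quotient_scope.
Local Open Scope tensor_scope.

(** * Tensors and double derivations *)

(** The fused algebra is an iterated corner of algebras with matrix units adjoined, and has no
    presentation at hand from which to define the inverse map. Each stage is therefore described by
    an invariant, [fusion_stage]: generators, one inverse per copy, and a lifting property for data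
    in an algebra [S] containing matrix units. Such lifts need not be unital, hence [is_nhom]. With
    [S] the matrices over the localised Boalch algebra, indexed by all unfused labels, and a
    compression back to that algebra, the lifting property of the last stage yields the inverse of
    psi.

    A companion invariant, [fusion_stage_hdqp], follows the brackets of generators: fusing one
    vertex of copy l adds one term to each of its brackets with the earlier copies.

    The correction u_(l-1) is forced. With F_m = (a_1, ..., b_m) and X_m = (a_1, ..., a_m), the
    recursion X_(m+1) = F_m a_(m+1) + X_m and the wish X_(m+1) = F_m c_(m+1) give a_(m+1) = c_(m+1)
    - F_m^-1 X_m, and F_m^-1 X_m = P_m^-1 c_m. *)

Definition is_lin (k : fieldType) (A B : calgType k) (f : A -> B) : Prop :=
  {morph f : x y / x + y} /\ forall c x, f (in_calg c * x) = in_calg c * f x.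

Lemma in_calg0 (k : fieldType) (A : calgType k) : in_calg 0 = 0 :> A.
Proof. by apply: (addrI (in_calg 0)); rewrite -in_calgD !addr0. Qed.

Lemma in_calgN1 (k : fieldType) (A : calgType k) (x : A) :
  in_calg (-1) * x = - x.
Proof.
apply: (addrI x); rewrite -{1}[x]mul1r -(in_calg1 (s := A)) -mulrDl -in_calgD.
by rewrite !subrr in_calg0 mul0r.
Qed.

Section Lin.
Variables (k : fieldType) (A B : calgType k) (f : A -> B).
Hypothesis f_lin : is_lin f.

Lemma is_lin_linear : linear (f : modof A -> modof B).
Proof. by move=> c x y; rewrite [LHS]f_lin.1 f_lin.2. Qed.

Lemma is_lin0 : f 0 = 0.
Proof. by apply: (addrI (f 0)); rewrite -f_lin.1 !addr0. Qed.

Lemma is_linN x : f (- x) = - f x.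
Proof. by apply: (addrI (f x)); rewrite -f_lin.1 !subrr is_lin0. Qed.

Lemma is_lin_sum (I : Type) (r : seq I) (P : pred I) (F : I -> A) :
  f (\sum_(i <- r | P i) F i) = \sum_(i <- r | P i) f (F i).
Proof. exact: (big_morph f f_lin.1 is_lin0). Qed.
End Lin.

Section TensorLinear.
Variables (k : fieldType) (A : calgType k).
Implicit Types (x y z : A) (p q : tens2 A).

Lemma ptensDl x y z : (x + y) ⊗ z = x ⊗ z + y ⊗ z.
Proof. exact: tpureDl. Qed.
Lemma ptensDr x y z : x ⊗ (y + z) = x ⊗ y + x ⊗ z.
Proof. exact: tpureDr. Qed.
Lemma ptens0l x : 0 ⊗ x = 0.
Proof. by apply: (addrI (0 ⊗ x)); rewrite -ptensDl !addr0. Qed.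
Lemma ptens0r x : x ⊗ 0 = 0.
Proof. by apply: (addrI (x ⊗ 0)); rewrite -ptensDr !addr0. Qed.
Lemma ptensNl x y : (- x) ⊗ y = - (x ⊗ y).
Proof. by apply: (addrI (x ⊗ y)); rewrite -ptensDl !subrr ptens0l. Qed.
Lemma ptensNr x y : x ⊗ (- y) = - (x ⊗ y).
Proof. by apply: (addrI (x ⊗ y)); rewrite -ptensDr !subrr ptens0r. Qed.
Lemma ptensZl c x y : (in_calg c * x) ⊗ y = c *: (x ⊗ y).
Proof. exact: tpureZl. Qed.
Lemma ptensZr c x y : x ⊗ (in_calg c * y) = c *: (x ⊗ y).
Proof. exact: tpureZr. Qed.

Lemma mull_lin x : is_lin (fun a : A => x * a).
Proof.
by split=> [a b|c a]; rewrite ?mulrDr // mulrA -in_calgC -mulrA.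
Qed.
Lemma mulr_lin x : is_lin (fun a : A => a * x).
Proof. by split=> [a b|c a]; rewrite ?mulrDl // mulrA. Qed.
Lemma id_lin : is_lin (fun a : A => a). Proof. by []. Qed.

Lemma tens2_bilinear (B : calgType k) (f g : A -> B) :
    is_lin f -> is_lin g ->
  bilinear_map (fun a b : modof A => f a ⊗ g b) /\
  bilinear_map (fun a b : modof A => g b ⊗ f a).
Proof.
by move=> fl gl; apply: tens2_bilin; apply: is_lin_linear.
Qed.

Let flip_bil : bilinear_map (fun a b : modof A => b ⊗ a).
Proof. by case: (tens2_bilinear id_lin id_lin). Qed.
Let outer_bil x y : bilinear_map (fun a b : modof A => (x * a) ⊗ (b * y)).
Proof. by case: (tens2_bilinear (mull_lin x) (mulr_lin y)). Qed.

Lemma tflipD p q : tflip (p + q) = tflip p + tflip q.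
Proof. exact: tliftD. Qed.
Lemma tflipZ c p : tflip (c *: p) = c *: tflip p.
Proof. exact: tliftZ. Qed.
Lemma tflip0 : tflip (0 : tens2 A) = 0.
Proof. by rewrite -[X in tflip X](scale0r (0 : tens2 A)) tflipZ scale0r. Qed.
Lemma tflipN p : tflip (- p) = - tflip p.
Proof. by rewrite -scaleN1r tflipZ scaleN1r. Qed.
Lemma outerD x y p q : outer x y (p + q) = outer x y p + outer x y q.
Proof. exact: tliftD. Qed.
Lemma outerZ x y c p : outer x y (c *: p) = c *: outer x y p.
Proof. exact: tliftZ. Qed.
Lemma outer0 x y : outer x y (0 : tens2 A) = 0.
Proof. by rewrite -[X in outer x y X](scale0r (0 : tens2 A)) outerZ scale0r. Qed.
Lemma outerN x y p : outer x y (- p) = - outer x y p.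
Proof. by rewrite -scaleN1r outerZ scaleN1r. Qed.

Lemma outer_outer x y x' y' p :
  outer x y (outer x' y' p) = outer (x * x') (y' * y) p.
Proof.
elim/tens_ind: p => [a b|p q IHp IHq|c p IHp].
- by rewrite !outer_pure !mulrA.
- by rewrite !outerD IHp IHq.
- by rewrite !outerZ IHp.
Qed.
Lemma outerDl x x' y p : outer (x + x') y p = outer x y p + outer x' y p.
Proof.
elim/tens_ind: p => [a b|p q IHp IHq|c p IHp].
- by rewrite !outer_pure mulrDl ptensDl.
- by rewrite !outerD IHp IHq addrACA.
- by rewrite !outerZ IHp scalerDr.
Qed.
Lemma outerDr x y y' p : outer x (y + y') p = outer x y p + outer x y' p.
Proof.
elim/tens_ind: p => [a b|p q IHp IHq|c p IHp].
- by rewrite !outer_pure mulrDr ptensDr.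
- by rewrite !outerD IHp IHq addrACA.
- by rewrite !outerZ IHp scalerDr.
Qed.
Lemma outerZl c x y p : outer (in_calg c * x) y p = c *: outer x y p.
Proof.
elim/tens_ind: p => [a b|p q IHp IHq|e p IHp].
- by rewrite !outer_pure -mulrA ptensZl.
- by rewrite !outerD IHp IHq scalerDr.
- by rewrite !outerZ IHp !scalerA mulrC.
Qed.
Lemma outerZr c x y p : outer x (in_calg c * y) p = c *: outer x y p.
Proof.
elim/tens_ind: p => [a b|p q IHp IHq|e p IHp].
- by rewrite !outer_pure mulrA -in_calgC -mulrA ptensZr.
- by rewrite !outerD IHp IHq scalerDr.
- by rewrite !outerZ IHp !scalerA mulrC.
Qed.

(** The inner bimodule structure, obtained from the outer one by the flip. It expresses the
    derivation rule in the first argument of a bracket, see [brMl]. *)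
Definition inner x y p : tens2 A := tflip (outer x y (tflip p)).

Lemma inner_pure x y a b : inner x y (a ⊗ b) = (a * y) ⊗ (x * b).
Proof. by rewrite /inner !(tflip_pure, outer_pure). Qed.
Lemma innerD x y p q : inner x y (p + q) = inner x y p + inner x y q.
Proof. by rewrite /inner !(tflipD, outerD). Qed.
Lemma innerZ x y c p : inner x y (c *: p) = c *: inner x y p.
Proof. by rewrite /inner !(tflipZ, outerZ). Qed.
Lemma inner0 x y : inner x y 0 = 0.
Proof. by rewrite /inner !(tflip0, outer0). Qed.
End TensorLinear.

Section TMap.
Variables (k : fieldType) (A B : calgType k) (f : A -> B).
Hypothesis f_lin : is_lin f.
Implicit Types (p q : tens2 A).

Let tmap_bil : bilinear_map (fun a b : modof A => f a ⊗ f b).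
Proof. by case: (tens2_bilinear f_lin f_lin). Qed.

Lemma tmap_ptens a b : tmap f (a ⊗ b) = f a ⊗ f b.
Proof. exact: tmap_pure (is_lin_linear f_lin). Qed.
Lemma tmapD p q : tmap f (p + q) = tmap f p + tmap f q.
Proof. exact: tliftD. Qed.
Lemma tmapZ c p : tmap f (c *: p) = c *: tmap f p.
Proof. exact: tliftZ. Qed.
Lemma tmap0 : tmap f 0 = 0.
Proof. by rewrite -[X in tmap f X](scale0r (0 : tens2 A)) tmapZ scale0r. Qed.
Lemma tmapN p : tmap f (- p) = - tmap f p.
Proof. by rewrite -scaleN1r tmapZ scaleN1r. Qed.
Lemma tmap_flip p : tmap f (tflip p) = tflip (tmap f p).
Proof.
elim/tens_ind: p => [a b|p q IHp IHq|c p IHp].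
- by rewrite tflip_pure !tmap_ptens tflip_pure.
- by rewrite !(tflipD, tmapD) IHp IHq.
- by rewrite !(tflipZ, tmapZ) IHp.
Qed.
Lemma tmap_outer x y p : {morph f : a b / a * b} ->
  tmap f (outer x y p) = outer (f x) (f y) (tmap f p).
Proof.
move=> fM; elim/tens_ind: p => [a b|p q IHp IHq|c p IHp].
- by rewrite outer_pure !tmap_ptens outer_pure !fM.
- by rewrite !(outerD, tmapD) IHp IHq.
- by rewrite !(outerZ, tmapZ) IHp.
Qed.
End TMap.

Lemma comp_lin (k : fieldType) (A B C : calgType k) (f : A -> B) (g : B -> C) :
  is_lin f -> is_lin g -> is_lin (g \o f).
Proof.
by move=> fl gl; split=> [x y|c x] /=; rewrite ?fl.1 ?gl.1 ?fl.2 ?gl.2.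
Qed.

Lemma tmap_comp (k : fieldType) (A B C : calgType k) (f : A -> B) (g : B -> C)
    (p : tens2 A) :
  is_lin f -> is_lin g -> tmap g (tmap f p) = tmap (g \o f) p.
Proof.
move=> fl gl; have gfl := comp_lin fl gl.
elim/tens_ind: p => [a b|p q IHp IHq|c p IHp].
- by rewrite (tmap_ptens fl) (tmap_ptens gl) (tmap_ptens gfl).
- by rewrite (tmapD fl) (tmapD gl) (tmapD gfl) IHp IHq.
- by rewrite (tmapZ fl) (tmapZ gl) (tmapZ gfl) IHp.
Qed.

Lemma eq_tmap (k : fieldType) (A B : calgType k) (f g : A -> B) (p : tens2 A) :
  is_lin f -> is_lin g -> f =1 g -> tmap f p = tmap g p.
Proof.
move=> fl gl fg; elim/tens_ind: p => [a b|p q IHp IHq|c p IHp].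
- by rewrite (tmap_ptens fl) (tmap_ptens gl) !fg.
- by rewrite (tmapD fl) (tmapD gl) IHp IHq.
- by rewrite (tmapZ fl) (tmapZ gl) IHp.
Qed.

Lemma tmap_id (k : fieldType) (A : calgType k) (p : tens2 A) : tmap id p = p.
Proof.
have il := id_lin A; elim/tens_ind: p => [a b|p q IHp IHq|c p IHp].
- by rewrite (tmap_ptens il).
- by rewrite (tmapD il) IHp IHq.
- by rewrite (tmapZ il) IHp.
Qed.

(* Double derivations along f: for the bracket of a double algebra f is the *)
(* identity, or the morphism along which the bracket is transported. *)
Record is_dder (k : fieldType) (A B : calgType k) (f : A -> B)
    (D : A -> tens2 B) : Prop := {
  dderD : {morph D : x y / x + y};
  dderZ : forall c x, D (in_calg c * x) = c *: D x;
  dderM : forall x y, D (x * y) = outer 1 (f y) (D x) + outer (f x) 1 (D y)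
}.

Section DDer.
Variables (k : fieldType) (A B : calgType k) (f : A -> B).

Lemma dder_sub D D' : is_dder f D -> is_dder f D' ->
  is_dder f (fun x => D x - D' x).
Proof.
move=> Dd Dd'; split=> [x y|c x|x y].
- by rewrite (dderD Dd) (dderD Dd') opprD addrACA.
- by rewrite (dderZ Dd) (dderZ Dd') -scalerBr.
- rewrite (dderM Dd) (dderM Dd') !outerD !outerN opprD addrACA.
  by [].
Qed.

Lemma dder_inv0 D x z e : is_dder f D ->
  x * z = e -> z * x = e -> e * z = z -> {morph f : a b / a * b} ->
  D e = 0 -> D x = 0 -> D z = 0.
Proof.
move=> Dd xz zx ez fM De Dx.
have xDz : outer (f x) 1 (D z) = 0.
  by move: (dderM Dd x z); rewrite xz De Dx outer0 add0r => <-.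
rewrite -ez (dderM Dd) De outer0 add0r -zx fM.
by rewrite -[in outer _ 1](mulr1 1) -outer_outer xDz outer0.
Qed.
End DDer.

Section DoubleBracket.
Variables (k : fieldType) (I : finType) (A : balg k I).
Variable d : A -> A -> tens2 A.
Hypothesis dP : is_double_bracket d.
Implicit Types (x y z : A).

Let d_bil : bilinear_map (d : modof A -> modof A -> tens2 A).
Proof. by case: dP. Qed.

Lemma brDr x y z : d x (y + z) = d x y + d x z.
Proof. by have := d_bil.2 x 1 y z; rewrite !scale1r. Qed.
Lemma brDl x y z : d (x + y) z = d x z + d y z.
Proof. by have := d_bil.1 z 1 x y; rewrite !scale1r. Qed.
Lemma br0r x : d x 0 = 0.
Proof. by apply: (addrI (d x 0)); rewrite -brDr !addr0. Qed.
Lemma br0l x : d 0 x = 0.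
Proof. by apply: (addrI (d 0 x)); rewrite -brDl !addr0. Qed.
Lemma brNr x y : d x (- y) = - d x y.
Proof. by apply: (addrI (d x y)); rewrite -brDr !subrr br0r. Qed.
Lemma brNl x y : d (- x) y = - d x y.
Proof. by apply: (addrI (d x y)); rewrite -brDl !subrr br0l. Qed.
Lemma brZr c x y : d x (in_calg c * y) = c *: d x y.
Proof. by have := d_bil.2 x c y 0; rewrite br0r !addr0. Qed.
Lemma brC x y : d x y = - tflip (d y x).
Proof. by case: dP. Qed.
Lemma brMr x y z : d x (y * z) = outer 1 z (d x y) + outer y 1 (d x z).
Proof. by case: dP. Qed.
Lemma brMl x y z : d (x * y) z = inner 1 y (d x z) + inner x 1 (d y z).
Proof.
by rewrite [LHS]brC brMr [d z x]brC [d z y]brC /inner tflipD opprD !outerN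
  !tflipN !opprK.
Qed.
Lemma br_idml s x : d (idm A s) x = 0.
Proof.
case: (boolP (s \in verts A)) => [sA|/idm_out ->]; last exact: br0l.
by case: dP => _ _ _ ->.
Qed.
Lemma br_idmr s x : d x (idm A s) = 0.
Proof. by rewrite brC br_idml tflip0 oppr0. Qed.

Lemma br_dder x : is_dder id (d x).
Proof. by split; [exact: brDr|move=> c y; exact: brZr|exact: brMr]. Qed.
End DoubleBracket.

Section InnerDerivation.
Variables (k : fieldType) (A B : calgType k) (f : A -> B) (w : tens2 B).

(** The commutator of [f x] with a fixed tensor for the outer bimodule structure. Being a double
    derivation, it can be identified with a bracket by a check on generators. *)
Definition comm_dder (x : A) : tens2 B := outer (f x) 1 w - outer 1 (f x) w.

Lemma comm_dderP : is_lin f -> {morph f : x y / x * y} ->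
  is_dder f comm_dder.
Proof.
move=> fl fM; split=> [x y|c x|x y]; rewrite /comm_dder.
- by rewrite fl.1 outerDl outerDr opprD addrACA.
- by rewrite fl.2 outerZl outerZr scalerBr.
rewrite fM !outerD !outerN !outer_outer !(mul1r, mulr1).
by rewrite [RHS]addrC addrA subrK.
Qed.
End InnerDerivation.

Lemma dder_comp (k : fieldType) (A B C : calgType k) (f : A -> B) (g : B -> C)
    (D : A -> tens2 B) :
  is_lin g -> {morph g : x y / x * y} -> g 1 = 1 -> is_dder f D ->
  is_dder (g \o f) (tmap g \o D).
Proof.
move=> gl gM g1 Dd; split=> [x y|c x|x y] /=.
- by rewrite (dderD Dd) (tmapD gl).
- by rewrite (dderZ Dd) (tmapZ gl).
- by rewrite (dderM Dd) (tmapD gl) !(tmap_outer gl) // g1.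
Qed.

Lemma dder_precomp (k : fieldType) (A B C : calgType k) (f : A -> B)
    (g : B -> C) (D : B -> tens2 C) :
  is_lin f -> {morph f : x y / x * y} -> is_dder g D ->
  is_dder (g \o f) (D \o f).
Proof.
move=> fl fM Dd; split=> [x y|c x|x y] /=.
- by rewrite fl.1 (dderD Dd).
- by rewrite fl.2 (dderZ Dd).
- by rewrite fM (dderM Dd).
Qed.

Section DDerEq.
Variables (k : fieldType) (A B : calgType k) (f : A -> B).
Variables (D D' : A -> tens2 B).
Hypotheses (Dd : is_dder f D) (Dd' : is_dder f D').
Hypothesis fM : {morph f : x y / x * y}.

Lemma dder_eqD x y : D x = D' x -> D y = D' y -> D (x + y) = D' (x + y).
Proof. by rewrite (dderD Dd) (dderD Dd') => -> ->. Qed.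
Lemma dder_eqM x y : D x = D' x -> D y = D' y -> D (x * y) = D' (x * y).
Proof. by rewrite (dderM Dd) (dderM Dd') => -> ->. Qed.
(** The difference of two double derivations is one, so [dder_inv0] applies to it. Brackets on a
    localisation can thus be compared without computing them on inverses. *)
Lemma dder_eq_inv x z e : x * z = e -> z * x = e -> e * z = z ->
  D e = D' e -> D x = D' x -> D z = D' z.
Proof.
move=> xz zx ez De Dx; apply/eqP; rewrite -subr_eq0; apply/eqP.
by apply: (dder_inv0 (dder_sub Dd Dd') xz zx ez fM); rewrite ?De ?Dx subrr.
Qed.
End DDerEq.

(* The unit is only sent to an idempotent: the maps out of the fusion algebras *)
(* are built with values in a corner of a matrix algebra. *)
Record is_nhom (k : fieldType) (A S : calgType k) (f : A -> S) : Prop := {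
  nhomD : {morph f : x y / x + y};
  nhomM : {morph f : x y / x * y};
  nhomC : forall c, f (in_calg c) = in_calg c * f 1
}.

Section NHom.
Variables (k : fieldType) (A S : calgType k) (f : A -> S).
Hypothesis fP : is_nhom f.

Lemma nhom_lin : is_lin f.
Proof.
split; first exact: nhomD fP.
by move=> c x; rewrite (nhomM fP) (nhomC fP) -mulrA -(nhomM fP) mul1r.
Qed.
Lemma nhom0 : f 0 = 0. Proof. exact: is_lin0 nhom_lin. Qed.
Lemma nhomN x : f (- x) = - f x. Proof. exact: is_linN nhom_lin x. Qed.
Lemma nhom1l x : f 1 * f x = f x. Proof. by rewrite -(nhomM fP) mul1r. Qed.
Lemma nhom1r x : f x * f 1 = f x. Proof. by rewrite -(nhomM fP) mulr1. Qed.
End NHom.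

Lemma calg_hom_nhom (k : fieldType) (A S : calgType k) (f : A -> S) :
  is_calg_hom f <-> is_nhom f /\ f 1 = 1.
Proof.
split=> [[fD fM f1 fC]|[[fD fM fC] f1]].
  by split=> //; split=> // c; rewrite f1 mulr1.
by split=> // c; rewrite fC f1 mulr1.
Qed.

(** * Universal properties of presented algebras and of localisations *)

Section AdjoinLift.
Variables (k : fieldType) (A : calgType k) (X : Type).
Variable R : aterm A X -> aterm A X -> Prop.
Variables (S : calgType k) (f : A -> S) (g : X -> S).

Fixpoint aeval (t : aterm A X) : S :=
  match t with
  | ACst a => f a
  | AVar x => g x
  | AAdd s t => aeval s + aeval t
  | AMul s t => aeval s * aeval t
  end.

Definition alift (t : adjoin R) : S := aeval (repr t).

Hypothesis fP : is_nhom f.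
Hypothesis g1 : forall x, f 1 * g x = g x /\ g x * f 1 = g x.
Hypothesis Rg : forall s t, R s t -> aeval s = aeval t.

Let aeval1 t : f 1 * aeval t = aeval t /\ aeval t * f 1 = aeval t.
Proof.
elim: t => [a|x|s [Hs Hs'] t [Ht Ht']|s [Hs Hs'] t [Ht Ht']] //=.
- by rewrite (nhom1l fP) (nhom1r fP).
- by rewrite mulrDr mulrDl Hs Hs' Ht Ht'.
- by rewrite mulrA Hs -mulrA Ht'.
Qed.

(** Since [f 1] is only an idempotent, the unit axioms hold after evaluation because every value
    lies in the corner of [S] at [f 1]; this is what [g1] ensures for the adjoined elements. *)
Lemma aeval_cong s t : acong R s t -> aeval s = aeval t.
Proof.
elim=> //= {s t}.
- by move=> s t u _ -> _ ->.
- by move=> s s' t t' _ -> _ ->.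
- by move=> s s' t t' _ -> _ ->.
- by move=> s t u; rewrite addrA.
- by move=> s t; rewrite addrC.
- by move=> s; rewrite (nhom0 fP) add0r.
- by move=> s; rewrite (nhomN fP) mulNr (aeval1 s).1 addNr (nhom0 fP).
- by move=> s t u; rewrite mulrA.
- by move=> s; rewrite (aeval1 s).1.
- by move=> s; rewrite (aeval1 s).2.
- by move=> s t u; rewrite mulrDl.
- by move=> s t u; rewrite mulrDr.
- by move=> a b; rewrite (nhomD fP).
- by move=> a b; rewrite (nhomM fP).
- move=> c s; rewrite (nhomC fP) -mulrA (aeval1 s).1 in_calgC.
  by rewrite in_calgC mulrA (aeval1 s).2.
Qed.

Lemma alift_aof t : alift (aof R t) = aeval t.
Proof. by apply: aeval_cong; apply: arepr. Qed.
Lemma alift_cst a : alift (acst R a) = f a.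
Proof. exact: alift_aof. Qed.
Lemma alift_var x : alift (avar R x) = g x.
Proof. exact: alift_aof. Qed.

Lemma alift_nhom : is_nhom alift.
Proof.
split=> [s t|s t|c].
- by elim/quotW: s => s; elim/quotW: t => t;
  rewrite -[LHS]/(alift (aof R s + aof R t))
    -aofD !alift_aof.
- by elim/quotW: s => s; elim/quotW: t => t;
  rewrite -[LHS]/(alift (aof R s * aof R t))
    -aofM !alift_aof.
- by rewrite -[LHS]/(alift (acst R (in_calg c))) -[1]/(acst R 1) !alift_cst (nhomC fP).
Qed.
End AdjoinLift.
Arguments alift {k A X R S} f g t.

(** The last two conditions place [z] in the corner at [e], which makes it unique. *)
Definition corner_inv (R : pzRingType) (e x z : R) : Prop :=
  [/\ x * z = e, z * x = e, e * z = z & z * e = z].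

Lemma corner_inv_uniq (R : pzRingType) (e x z z' : R) :
  corner_inv e x z -> corner_inv e x z' -> z = z'.
Proof.
by move=> [_ zx _ ze] [xz' _ ez' _]; rewrite -ze -xz' mulrA zx.
Qed.

Lemma corner_invM (R : pzRingType) (e x y x' y' : R) :
  e * x = x -> e * y = y ->
  corner_inv e x x' -> corner_inv e y y' -> corner_inv e (x * y) (y' * x').
Proof.
move=> ex ey [xx' x'x ex' x'e] [yy' y'y ey' y'e]; split.
- by rewrite -mulrA [y * _]mulrA yy' ex'.
- by rewrite -mulrA [x' * _]mulrA x'x ey.
- by rewrite mulrA ey'.
- by rewrite -mulrA x'e.
Qed.

Lemma nhom_corner_inv (k : fieldType) (A S : calgType k) (f : A -> S) e x z :
  is_nhom f -> corner_inv e x z -> corner_inv (f e) (f x) (f z).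
Proof. by move=> fP [xz zx ez ze]; split;
  rewrite -(nhomM fP) ?xz ?zx ?ez ?ze. Qed.

Section LocLift.
Variables (k : fieldType) (I : finType) (A : balg k I).
Variables (T : Type) (v : T -> I) (x : T -> A).

Lemma loc_invK t :
  corner_inv (idm (localise v x) (v t)) (to_loc v x (x t)) (loc_inv v x t).
Proof.
have E : loc_inv v x t = idm (localise v x) (v t) * loc_inv v x t
                         * idm (localise v x) (v t).
  by rewrite -[LHS]/(aof _ _) (aof_rel (loc_corner v x t)) !aofM.
split.
- by rewrite -aofM (aof_rel (loc_invr v x t)).
- by rewrite -aofM (aof_rel (loc_invl v x t)).
- by rewrite {1}E !mulrA idm_mul eqxx -E.
- by rewrite {1}E -!mulrA idm_mul eqxx mulrA -E.
Qed.

Lemma to_loc_hom : is_calg_hom (to_loc v x).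
Proof.
by split=> // a b; [exact: acstD|exact: acstM].
Qed.

Lemma loc_lift (S : calgType k) (f : A -> S) (g : T -> S) :
    is_nhom f ->
    (forall t, corner_inv (f (idm A (v t))) (f (x t)) (g t)) ->
  exists h : localise v x -> S,
    [/\ is_nhom h, forall a, h (to_loc v x a) = f a
      & forall t, h (loc_inv v x t) = g t].
Proof.
move=> fP gP.
have g1 t : f 1 * g t = g t /\ g t * f 1 = g t.
  case: (gP t) => _ _ Hl Hr; split; first by rewrite -Hl mulrA (nhom1l fP).
  by rewrite -Hr -mulrA (nhom1r fP).
have Rg s t : loc_rel v x s t -> aeval f g s = aeval f g t.
  by case=> {s t} t /=; case: (gP t) => // _ _ -> ->.
exists (alift f g); split; first exact: alift_nhom.
- by move=> a; apply: alift_cst.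
- by move=> t; apply: alift_var.
Qed.

Lemma loc_ind (P : localise v x -> Prop) :
    (forall a, P (to_loc v x a)) ->
    (forall t, P (loc_inv v x t)) ->
    (forall y z, P y -> P z -> P (y + z)) ->
    (forall y z, P y -> P z -> P (y * z)) ->
  forall y, P y.
Proof. exact: adjoin_ind. Qed.
End LocLift.

(** * The fusion algebra *)

(** Generation is phrased as an induction principle, so that no subalgebra has to be formed. *)
Definition generated_by (k : fieldType) (B : calgType k) (G : B -> Prop) :
    Prop :=
  forall K : B -> Prop, (forall c, K (in_calg c)) ->
    (forall x y, K x -> K y -> K (x + y)) ->
    (forall x y, K x -> K y -> K (x * y)) ->
    (forall x, G x -> K x) -> forall x, K x.

Section FusionMap.
Variables (k : fieldType) (I : finType) (A : balg k I) (i j : I).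
Hypothesis ij : i != j.

Local Notation Abar := (fus_bar A i j).
Local Notation Afus := (fusion A i j).
Local Notation "x ^b" := (@to_bar k I A i j x) (at level 2, format "x ^b").
Local Notation Eij := (eij A i j).
Local Notation Eji := (eji A i j).
Local Notation ep := (eps Abar j).

Lemma bar_hom : is_calg_hom (@to_bar k I A i j).
Proof. by split=> // a b; [exact: acstD|exact: acstM]. Qed.

Lemma barD x y : (x + y)^b = x^b + y^b. Proof. exact: acstD. Qed.
Lemma barM x y : (x * y)^b = x^b * y^b. Proof. exact: acstM. Qed.
Lemma bar_lin : is_lin (@to_bar k I A i j).
Proof. by apply: nhom_lin; case/calg_hom_nhom: bar_hom. Qed.

Let mu (p q : bool) : Abar :=
  match p, q with
  | false, false => (idm A i)^b
  | false, true => Eij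
  | true, false => Eji
  | true, true => (idm A j)^b
  end.

Let muM s t u v : mu s t * mu u v = if t == u then mu s v else 0.
Proof.
have E p q : mu p q = aof _ (munit A i j p q) by case: p; case: q.
rewrite (E s t) (E u v) -aofM (aof_rel (fus_unit A i j s t u v)).
by case: ifP => // _; rewrite -E.
Qed.

Lemma e_eij : (idm A i)^b * Eij = Eij. Proof. exact: (muM false false false true). Qed.
Lemma eij_e : Eij * (idm A j)^b = Eij. Proof. exact: (muM false true true true). Qed.
Lemma e_eji : (idm A j)^b * Eji = Eji. Proof. exact: (muM true true true false). Qed.
Lemma eji_e : Eji * (idm A i)^b = Eji. Proof. exact: (muM true false false false). Qed.
Lemma eij_eji : Eij * Eji = (idm A i)^b. Proof. exact: (muM false true true false). Qed.
Lemma eji_eij : Eji * Eij = (idm A j)^b. Proof. exact: (muM true false false true). Qed.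

Lemma bar_idm_mul s t :
  (idm A s)^b * (idm A t)^b = if s == t then (idm A s)^b else 0.
Proof. by rewrite -barM idm_mul; case: ifP. Qed.

Lemma epE : ep = 1 - (idm A j)^b. Proof. by []. Qed.

Lemma bar_ep : (eps A j)^b = ep.
Proof. by rewrite /eps bar_lin.1 (is_linN bar_lin). Qed.

Lemma ep_idm s : ep * (idm A s)^b = if s == j then 0 else (idm A s)^b.
Proof.
rewrite epE mulrBl mul1r bar_idm_mul [j == s]eq_sym.
by case: eqP => [->|_]; rewrite ?subrr ?subr0.
Qed.
Lemma idm_ep s : (idm A s)^b * ep = if s == j then 0 else (idm A s)^b.
Proof.
by rewrite epE mulrBr mulr1 bar_idm_mul; case: ifP; rewrite ?subrr ?subr0.
Qed.
Lemma ep_eij : ep * Eij = Eij.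
Proof. by rewrite -e_eij mulrA ep_idm (negPf ij). Qed.
Lemma eji_ep : Eji * ep = Eji.
Proof. by rewrite -eji_e -mulrA idm_ep (negPf ij). Qed.
Lemma ep_eji : ep * Eji = 0.
Proof. by rewrite -e_eji mulrA ep_idm eqxx mul0r. Qed.
Lemma eij_ep : Eij * ep = 0.
Proof. by rewrite -eij_e -mulrA idm_ep eqxx mulr0. Qed.

(* For x in e_p A e_q this is one of x, e_ij x, x e_ji and e_ij x e_ji, *)
(* according to which of p and q are equal to j. *)
Definition fus_emb (x : A) : Afus := cproj j ((ep + Eij) * x^b * (ep + Eji)).

Lemma fus_emb_val x : cval (fus_emb x) = (ep + Eij) * x^b * (ep + Eji).
Proof.
rewrite -[LHS]/(ep * ((ep + Eij) * x^b * (ep + Eji)) * ep).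
by rewrite !mulrA (mulrDr ep) epsK ep_eij -!mulrA (mulrDl _ _ ep) epsK eji_ep.
Qed.

Lemma cval_inj : injective (@cval k I Abar j).
Proof. exact: val_inj. Qed.

Lemma cvalM (x y : Afus) : cval (x * y) = cval x * cval y.
Proof. exact: cmulE. Qed.

Lemma cval_nhom : is_nhom (@cval k I Abar j : Afus -> Abar).
Proof.
split; [by []|exact: cvalM|move=> c].
rewrite -[LHS]/(cval (@corner_in k I Abar j c)) corner_inE; congr (_ * _).
by rewrite -[RHS]/(ep * 1 * ep) mulr1 epsK.
Qed.

Lemma cvalZ c (x : Afus) : cval (in_calg c * x) = in_calg c * cval x.
Proof. exact: (nhom_lin cval_nhom).2. Qed.

Lemma fus_emb_lin : is_lin fus_emb.
Proof.
split=> [x y|c x]; apply: cval_inj.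
  by rewrite [RHS]cvalD !fus_emb_val barD (mulrDr (ep + Eij)) mulrDl.
rewrite [RHS]cvalZ !fus_emb_val barM.
have -> : (in_calg c)^b = in_calg c by [].
by rewrite mulrA -[in LHS]in_calgC -!mulrA.
Qed.

Let gg : (ep + Eji) * (ep + Eij) = 1 + Eij + Eji.
Proof.
rewrite (mulrDl ep) (mulrDr ep) (mulrDr Eji) epsK ep_eij eji_ep eji_eij epE.
by rewrite [Eji + _]addrC addrACA subrK addrA.
Qed.

Let gg_idm s : (idm A s)^b * (1 + Eij + Eji) * (idm A s)^b = (idm A s)^b.
Proof.
have h1 : (idm A s)^b * Eij * (idm A s)^b = 0.
  case: (eqVneq s j) => [->|sj].
    by rewrite -e_eij !mulrA bar_idm_mul eq_sym (negPf ij) !mul0r.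
  by rewrite -eij_e -!mulrA bar_idm_mul eq_sym (negPf sj) !mulr0.
have h2 : (idm A s)^b * Eji * (idm A s)^b = 0.
  case: (eqVneq s j) => [->|sj].
    by rewrite -eji_e -!mulrA bar_idm_mul (negPf ij) !mulr0.
  by rewrite -e_eji !mulrA bar_idm_mul (negPf sj) !mul0r.
by rewrite !(mulrDr (idm A s)^b) !mulrDl h1 h2 !addr0 mulr1 bar_idm_mul eqxx.
Qed.

(** The factor [(ep + Eji) * (ep + Eij)] arising between [x] and [y] equals [1 + Eij + Eji]; cut by
    e_s on both sides, its off-diagonal units vanish because i and j differ. The common idempotent
    matters: e_i e_j = 0, whereas both e_i and e_j are sent to e_i. *)
Lemma fus_embM x y s : x * idm A s = x -> idm A s * y = y ->
  fus_emb (x * y) = fus_emb x * fus_emb y.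
Proof.
move=> xs sy; apply: cval_inj; rewrite cvalM !fus_emb_val.
rewrite -!mulrA; congr (_ * _); rewrite !mulrA; congr (_ * _).
rewrite -[in RHS]xs -[in RHS]sy !barM -!mulrA [(ep + Eji) * _]mulrA gg.
have -> : (idm A s)^b * ((1 + Eij + Eji) * ((idm A s)^b * y^b))
  = (idm A s)^b * y^b by rewrite !mulrA gg_idm.
by rewrite -[(idm A s)^b * _]barM sy.
Qed.

Lemma g_idm s : (ep + Eij) * (idm A s)^b = if s == j then Eij else (idm A s)^b.
Proof.
rewrite mulrDl ep_idm; case: eqVneq => [->|sj]; first by rewrite eij_e add0r.
by rewrite -eij_e -mulrA bar_idm_mul eq_sym (negPf sj) mulr0 addr0.
Qed.
Lemma idm_g s : (idm A s)^b * (ep + Eji) = if s == j then Eji else (idm A s)^b.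
Proof.
rewrite mulrDr idm_ep; case: eqVneq => [->|sj]; first by rewrite e_eji add0r.
by rewrite -e_eji mulrA bar_idm_mul (negPf sj) mul0r addr0.
Qed.

Lemma cval_idm s : cval (idm Afus s) = if s == j then 0 else (idm A s)^b.
Proof.
rewrite -[LHS]/(ep * (idm A s)^b * ep) ep_idm.
by case: eqVneq => [_|sj]; rewrite ?mul0r // idm_ep (negPf sj).
Qed.

Lemma fus_emb_idm s : fus_emb (idm A s) = idm Afus (if s == j then i else s).
Proof.
apply: cval_inj; rewrite fus_emb_val g_idm cval_idm.
case: eqVneq => [_|sj].
  by rewrite (negPf ij) mulrDr eij_ep add0r eij_eji.
by rewrite idm_g (negPf sj).
Qed.

Lemma fus_emb_t t : type_t j t -> fus_emb t = gen_t i j t.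
Proof.
move=> tP; apply: cval_inj; rewrite fus_emb_val -[RHS]/(ep * t^b * ep).
have Ht : t^b = ep * t^b * ep by rewrite {1}tP !barM bar_ep.
rewrite Ht; rewrite !mulrA (mulrDl ep) !epsK eij_ep addr0.
by rewrite -!mulrA (mulrDr ep) !epsK ep_eji addr0.
Qed.
Lemma fus_emb_u u : type_u j u -> fus_emb u = gen_u i j u.
Proof.
move=> uP; apply: cval_inj; rewrite fus_emb_val -[RHS]/(ep * (Eij * u^b) * ep).
have Hu : u^b = (idm A j)^b * u^b * ep by rewrite {1}uP !barM bar_ep.
rewrite Hu !mulrA g_idm eqxx ep_eij eij_e -!mulrA (mulrDr ep) epsK ep_eji.
by rewrite addr0.
Qed.
Lemma fus_emb_v v : type_v j v -> fus_emb v = gen_v i j v.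
Proof.
move=> vP; apply: cval_inj; rewrite fus_emb_val -[RHS]/(ep * (v^b * Eji) * ep).
have Hv : v^b = ep * v^b * (idm A j)^b by rewrite {1}vP !barM bar_ep.
rewrite Hv !mulrA (mulrDl ep) !epsK eij_ep addr0 -!mulrA idm_g eqxx eji_ep.
by rewrite e_eji.
Qed.

Section Bracket.
Variable H : hdqp A.
Variables (dbar : Abar -> Abar -> tens2 Abar) (dres : Afus -> Afus ->
  tens2 Afus).
Hypothesis dbarP : is_dbar H dbar.
Hypothesis dresP : forall x y, tmap (@cinc k I A i j) (dres x y) =
  dbar (cinc x) (cinc y).

Let cproj_lin : is_lin (fun x : Abar => cproj j x : Afus).
Proof.
split; first exact: cprojD.
move=> c x; apply: cval_inj; rewrite [RHS]cvalZ.
rewrite -[LHS]/(ep * (in_calg c * x) * ep) -[cval _]/(ep * x * ep).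
by rewrite mulrA -in_calgC -!mulrA.
Qed.
Let cval_lin : is_lin (@cinc k I A i j).
Proof. exact: nhom_lin cval_nhom. Qed.

(** The extended bracket vanishes on [ep], [Eij] and [Eji], so multiplying an argument by [ep + Eij]
    or [ep + Eji] only multiplies the value, by an outer action for the second argument and an inner
    one for the first. *)
Lemma dres_emb x y : dres (fus_emb x) (fus_emb y) = tmap fus_emb (dbr H x y).
Proof.
case: dbarP => dP dbE dbij dbji.
have dg z : dbar (ep + Eij) z = 0.
  rewrite (brDl dP) dbij addr0 epE (brDl dP) (brNl dP).
  have -> : (1 : Abar) = \sum_(s in verts A) idm Abar s by
    rewrite (idm_sum Abar).
  rewrite (br_idml dP) oppr0 addr0.
  elim/big_rec: _ => [|s t _ IH]; first exact: br0l dP _.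
  by rewrite (brDl dP) IH (br_idml dP) addr0.
have dg' z : dbar (ep + Eji) z = 0.
  by move: (dg z); rewrite !(brDl dP) dbij dbji.
have dgr z : dbar z (ep + Eij) = 0 by rewrite (brC dP) dg tflip0 oppr0.
have dgr' z : dbar z (ep + Eji) = 0 by rewrite (brC dP) dg' tflip0 oppr0.
have gl : is_lin (fun x => (ep + Eij) * x^b * (ep + Eji)).
  exact: comp_lin (comp_lin bar_lin (mull_lin _)) (mulr_lin _).
have dE : dbar (cinc (fus_emb x)) (cinc (fus_emb y)) =
    tmap (fun x => (ep + Eij) * x^b * (ep + Eji)) (dbr H x y).
  rewrite /cinc !fus_emb_val !(brMl dP) !dg dg' !(brMr dP) !dgr !dgr' dbE.
  rewrite !(outer0, inner0) !(add0r, addr0).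
  elim/tens_ind: (dbr H x y) => [a b|p q IHp IHq|c p IHp].
  - rewrite (tmap_ptens bar_lin) !(outer_pure, inner_pure) (tmap_ptens gl).
    by rewrite !(mul1r, mulr1) !mulrA.
  - by rewrite (tmapD bar_lin) (tmapD gl) !outerD !innerD IHp IHq.
  - by rewrite (tmapZ bar_lin) (tmapZ gl) !outerZ !innerZ IHp.
(* The inclusion of the corner remains injective on tensors, since [cproj] is a linear retraction of
   it. *)
have cK : cancel (tmap (@cinc k I A i j)) (tmap (fun x : Abar =>
  cproj j x : Afus)).
  move=> p; rewrite (tmap_comp _ cval_lin cproj_lin) -[RHS]tmap_id.
  apply: eq_tmap; [exact: comp_lin cval_lin cproj_lin|exact: id_lin|].
  exact: cprojE.
by rewrite -[LHS]cK dresP dE tmap_comp.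
Qed.
End Bracket.

(** Insert 1 = [ep] + e_j between the factors and write e_j = [Eji * Eij]: the part of the product
    passing through e_j is rerouted through the corner. *)
Let cprojM0 (z z' : Abar) : cproj j (z * z') =
  cproj j z * cproj j z' + cproj j (z * Eji) * cproj j (Eij * z') :> Afus.
Proof.
apply: cval_inj; rewrite [RHS]cvalD !cvalM.
rewrite -[LHS]/(ep * (z * z') * ep) -[cval (cproj j z)]/(ep * z * ep).
rewrite -[cval (cproj j z')]/(ep * z' * ep).
rewrite -[cval (cproj j (z * _))]/(ep * (z * Eji) * ep).
rewrite -[cval (cproj j (_ * z'))]/(ep * (Eij * z') * ep).
have -> : ep * z * ep * (ep * z' * ep) = ep * z * ep * z' * ep.
  by rewrite !mulrA -[_ * ep * ep]mulrA epsK.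
have -> : ep * (z * Eji) * ep * (ep * (Eij * z') * ep)
  = ep * z * (idm A j)^b * z' * ep.
  rewrite -eji_eij -[in RHS]eji_ep -[in RHS]ep_eij.
  by rewrite !mulrA.
by rewrite -!mulrDl -mulrDr epE subrK mulr1 !mulrA.
Qed.

Lemma fus_generated (G : A -> Prop) :
    generated_by G -> G (idm A i) ->
    (forall x, G x -> exists p q, x = idm A p * x * idm A q) ->
  generated_by (fun y : Afus => exists2 x, G x & y = fus_emb x).
Proof.
move=> GA Gi Gpq K Kc KD KM KG.
have K0 : K 0 by rewrite -(in_calg0 Afus); apply: Kc.
(* These are the four blocks of [z] transported to the corner. By [cprojM0] the conjunction is
   stable under products; its first condition alone need not be. *)
pose K4 (z : Abar) := [/\ K (cproj j z), K (cproj j (Eij * z)),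
  K (cproj j (z * Eji)) & K (cproj j (Eij * z * Eji))].
have c0 : cproj j (0 : Abar) = 0 by apply: cval_inj; rewrite /= mulr0 mul0r.
have cE (z z' : Abar) : ep * z * ep = z' -> K (cproj j z') -> K (cproj j z).
  move=> <-; congr (K _); apply: cval_inj.
  by rewrite -[LHS]/(ep * (ep * z * ep) * ep) -[RHS]/(ep * z * ep) !mulrA epsK
    -!mulrA epsK.
have Ke : K (cproj j (idm A i)^b).
  by apply: KG; exists (idm A i) => //; rewrite fus_emb_idm (negPf ij).
have cZ c (z : Abar) : cproj j (in_calg c * z) = in_calg c * cproj j z :> Afus.
  apply: cval_inj; rewrite [RHS]cvalZ.
  rewrite -[LHS]/(ep * (in_calg c * z) * ep) -[cval _]/(ep * z * ep).
  by rewrite mulrA -in_calgC -!mulrA.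
have Kij : K (cproj j Eij) by apply: (cE _ 0);
  rewrite ?c0 // -mulrA eij_ep mulr0.
have Kji : K (cproj j Eji) by apply: (cE _ 0); rewrite ?c0 // ep_eji mul0r.
have K4M (y z : Abar) : K4 y -> K4 z -> K4 (y * z).
  move=> [y1 y2 y3 y4] [z1 z2 z3 z4].
  have e2 : Eij * (y * z) = (Eij * y) * z := mulrA _ _ _.
  have e3 : (y * z) * Eji = y * (z * Eji) := esym (mulrA _ _ _).
  have e4 : Eij * (z * Eji) = Eij * z * Eji := mulrA _ _ _.
  have e5 : Eij * (y * z) * Eji = (Eij * y) * (z * Eji) by rewrite e2 -mulrA.
  rewrite /K4 e5 e2 e3 (cprojM0 y z) (cprojM0 (Eij * y) z) (cprojM0 y (z * Eji)).
  rewrite (cprojM0 (Eij * y) (z * Eji)) e4.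
  by split; apply: KD; apply: KM.
suff KK z : K4 z by move=> y; case: (KK (cval y)); rewrite cprojE.
have ijij : Eij * Eij = 0 := muM false true false true.
have jiji : Eji * Eji = 0 := muM true false true false.
elim/adjoin_ind: z => [a|[]|y z [y1 y2 y3 y4] [z1 z2 z3 z4]|y z [y1 y2 y3 y4] [z1 z2 z3 z4]].
- rewrite -/(a^b).
  elim/GA: a => [c|y z [y1 y2 y3 y4] [z1 z2 z3 z4]|y z [y1 y2 y3 y4] [z1 z2 z3 z4]|x Gx].
  + have -> : (in_calg c)^b = in_calg c by [].
    split; first exact: Kc.
    * by rewrite -in_calgC cZ; apply: KM.
    * by rewrite cZ; apply: KM.
    * by rewrite -in_calgC -mulrA cZ eij_eji; apply: KM.
  + by rewrite barD /K4 !(mulrDl, mulrDr) !cprojD; split; apply: KD.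
  + by rewrite barM; apply: K4M.
  + have [p [q xE]] := Gpq x Gx.
    (* Each of the four blocks of a generator cut by [p] and [q] is either 0 or the image of the
       generator under [fus_emb]. *)
    have gl (al : Abar) : al = 1 \/ al = Eij ->
      ep * al * (idm A p)^b = 0 \/ ep * al * (idm A p)^b =
        (ep + Eij) * (idm A p)^b.
      rewrite g_idm => -[] ->.
        by rewrite mulr1 ep_idm; case: ifP; [left|right].
      rewrite ep_eij; case: (eqVneq p j) => [->|pj]; first by right;
        rewrite eij_e.
      by left; rewrite -eij_e -mulrA bar_idm_mul eq_sym (negPf pj) mulr0.
    have gr (be : Abar) : be = 1 \/ be = Eji ->
      (idm A q)^b * (be * ep) = 0 \/ (idm A q)^b * (be * ep) =
        (idm A q)^b * (ep + Eji).
      rewrite idm_g => -[] ->.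
        by rewrite mul1r idm_ep; case: ifP; [left|right].
      rewrite eji_ep; case: (eqVneq q j) => [->|pj]; first by right;
        rewrite e_eji.
      by left; rewrite -e_eji mulrA bar_idm_mul (negPf pj) mul0r.
    have Kab al be : al = 1 \/ al = Eij -> be = 1 \/ be = Eji ->
        K (cproj j (al * x^b * be)).
      move=> /gl Hl /gr Hr.
      apply: (cE _ (ep * al * (idm A p)^b * x^b * ((idm A q)^b * (be * ep)))).
        by rewrite {1}xE !barM !mulrA.
      case: Hl => ->; first by rewrite !mul0r c0.
      case: Hr => ->; first by rewrite !mulr0 c0.
      apply: KG; exists x => //; rewrite /fus_emb; congr cproj.
      by rewrite {2}xE !barM !mulrA.
    split.
    * by rewrite -[_^b]mul1r -[_ * _^b]mulr1; apply: Kab; left.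
    * by rewrite -[_ * _^b]mulr1; apply: Kab; [right|left].
    * by rewrite -[_^b]mul1r; apply: Kab; [left|right].
    * by apply: Kab; right.
- rewrite -/Eij; split=> //.
  + by rewrite ijij c0.
  + by rewrite eij_eji.
  + by rewrite ijij mul0r c0.
- rewrite -/Eji; split=> //.
  + by rewrite eij_eji.
  + by rewrite jiji c0.
  + by rewrite -mulrA jiji mulr0 c0.
- by rewrite /K4 !(mulrDl, mulrDr) !cprojD; split; apply: KD.
- exact: K4M.
Qed.

(** The elements [u] and [v] are the images of e_ij and e_ji. The map is the restriction to the
    corner of a morphism on the extended algebra, so it sends 1 to the image of 1 - e_j, which is
    only an idempotent. *)
Lemma fus_lift (S : calgType k) (f : A -> S) (u v : S) :
    is_nhom f ->
    u * v = f (idm A i) -> v * u = f (idm A j) ->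
    f (idm A i) * u = u -> u * f (idm A j) = u ->
    f (idm A j) * v = v -> v * f (idm A i) = v ->
  exists h : Afus -> S,
    [/\ is_nhom h, forall s, s != j -> h (idm Afus s) = f (idm A s)
      & forall p q x, x = idm A p * x * idm A q ->
        h (fus_emb x) = (if p == j then u else f (idm A p)) * f x
                    * (if q == j then v else f (idm A q))].
Proof.
move=> fP uv vu iu uj jv vi.
pose g (x : funit) := if x is Defs.Eij then u else v.
have fi : f (idm A i) * f (idm A i) = f (idm A i) by
  rewrite -(nhomM fP) idm_mul eqxx.
have fj : f (idm A j) * f (idm A j) = f (idm A j) by
  rewrite -(nhomM fP) idm_mul eqxx.
have fij : f (idm A i) * f (idm A j) = 0.
  by rewrite -(nhomM fP) idm_mul (negPf ij) (nhom0 fP).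
have fji : f (idm A j) * f (idm A i) = 0.
  by rewrite -(nhomM fP) idm_mul eq_sym (negPf ij) (nhom0 fP).
have g1 x : f 1 * g x = g x /\ g x * f 1 = g x.
  case: x => /=; split.
  - by rewrite -iu mulrA (nhom1l fP).
  - by rewrite -uj -mulrA (nhom1r fP).
  - by rewrite -jv mulrA (nhom1l fP).
  - by rewrite -vi -mulrA (nhom1r fP).
have uu : u * u = 0 by rewrite -{1}uj -{2}iu mulrA -[u * _ * _]mulrA fji mulr0 mul0r.
have vv : v * v = 0 by rewrite -{1}vi -{2}jv mulrA -[v * _ * _]mulrA fij mulr0 mul0r.
have ui : u * f (idm A i) = 0 by rewrite -uj -mulrA fji mulr0.
have ju : f (idm A j) * u = 0 by rewrite -iu mulrA fji mul0r.
have vj : v * f (idm A j) = 0 by rewrite -vi -mulrA fij mulr0.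
have iv : f (idm A i) * v = 0 by rewrite -jv mulrA fij mul0r.
have Rg s t : fus_rel i j s t -> aeval f g s = aeval f g t.
  case=> {s t} [] [] [] [] [] /=; rewrite ?(nhom0 fP) //.
pose h0 : Abar -> S := alift f g.
have h0P : is_nhom h0 by apply: alift_nhom.
have h0b a : h0 a^b = f a by apply: alift_cst.
have h0ij : h0 Eij = u by apply: (@alift_var _ _ _ _ _ f g).
have h0ji : h0 Eji = v by apply: (@alift_var _ _ _ _ _ f g).
exists (fun z : Afus => h0 (cval z)); split.
- split; first by move=> x y; rewrite cvalD (nhomD h0P).
    by move=> x y; rewrite cvalM (nhomM h0P).
  by move=> c; rewrite (nhomC cval_nhom) (nhom_lin h0P).2.
- by move=> s sj; rewrite cval_idm (negPf sj) h0b.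
- move=> p q x xE; rewrite fus_emb_val {1}xE !barM.
  have -> : (ep + Eij) * ((idm A p)^b * x^b * (idm A q)^b) * (ep + Eji)
    = ((ep + Eij) * (idm A p)^b) * x^b * ((idm A q)^b * (ep + Eji)).
    by rewrite !mulrA.
  rewrite g_idm idm_g !(nhomM h0P) h0b.
  by congr (_ * _ * _); case: ifP; rewrite ?h0ij ?h0ji ?h0b.
Qed.

(** In terms of [fus_emb], the component at [j] becomes an element at the vertex [i]; orthogonality
    of the idempotents then isolates the components of the sum. *)
Lemma fus_mom (H : hdqp A) (Hf : hdqp Afus) :
    cinc (mom Hf) =
        to_bar i j (mcomp (mom H) i) * eij A i j * to_bar i j (mcomp (mom H) j) * eji A i j
        + \sum_(s in verts A :\: [set i; j]) to_bar i j (mcomp (mom H) s) ->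
  mcomp (mom Hf) i = fus_emb (mcomp (mom H) i) * fus_emb (mcomp (mom H) j) /\
  forall s, s \in verts A -> s != i -> s != j ->
    mcomp (mom Hf) s = fus_emb (mcomp (mom H) s).
Proof.
move=> momE.
have Pe s : idm A s * mcomp (mom H) s = mcomp (mom H) s.
  by rewrite /mcomp !mulrA idm_mul eqxx.
have Pr s : mcomp (mom H) s * idm A s = mcomp (mom H) s.
  by rewrite /mcomp -!mulrA idm_mul eqxx.
move: momE Pe Pr; move: (mcomp (mom H)) => Phi momE Pe Pr.
have PE s : Phi s = idm A s * Phi s * idm A s by rewrite Pe Pr.
have embP s : s != j -> cval (fus_emb (Phi s)) = (Phi s)^b.
  move=> sj; rewrite fus_emb_val {1}PE !barM.
  have -> : (ep + Eij) * ((idm A s)^b * (Phi s)^b * (idm A s)^b) * (ep + Eji)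
    = ((ep + Eij) * (idm A s)^b) * (Phi s)^b * ((idm A s)^b * (ep + Eji)).
    by rewrite !mulrA.
  by rewrite g_idm idm_g (negPf sj) -!barM Pe Pr.
have embPj : cval (fus_emb (Phi j)) = Eij * (Phi j)^b * Eji.
  rewrite fus_emb_val {1}PE !barM.
  have -> : (ep + Eij) * ((idm A j)^b * (Phi j)^b * (idm A j)^b) * (ep + Eji)
    = ((ep + Eij) * (idm A j)^b) * (Phi j)^b * ((idm A j)^b * (ep + Eji)).
    by rewrite !mulrA.
  by rewrite g_idm idm_g eqxx.
have momE' : mom Hf = fus_emb (Phi i) * fus_emb (Phi j)
    + \sum_(s in verts A :\: [set i; j]) fus_emb (Phi s) :> Afus.
  apply: cval_inj; rewrite [RHS]cvalD cvalM embPj (embP _ ij).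
  rewrite (is_lin_sum (nhom_lin cval_nhom)) -[LHS]/(cinc _) momE !mulrA.
  by congr (_ + _); apply: eq_bigr => s;
    rewrite !inE negb_or => /andP[/andP[_ /embP ->]].
have ei s : s != j -> idm Afus s = fus_emb (idm A s) by move=> sj;
  rewrite fus_emb_idm (negPf sj).
have el s : s != j -> idm Afus s * fus_emb (Phi s) = fus_emb (Phi s).
  by move=> sj; rewrite ei // -(@fus_embM _ _ s) ?idm_mul ?eqxx ?Pe.
have er s : s != j -> fus_emb (Phi s) * idm Afus s = fus_emb (Phi s).
  by move=> sj; rewrite ei // -(@fus_embM _ _ s) ?idm_mul ?eqxx ?Pr.
have erj : fus_emb (Phi j) * idm Afus i = fus_emb (Phi j).
  have -> : idm Afus i = fus_emb (idm A j) by rewrite fus_emb_idm eqxx.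
  by rewrite -(@fus_embM _ _ j) ?idm_mul ?eqxx ?Pr.
have os s t : s != j -> t != j -> s != t -> idm Afus s * fus_emb (Phi t) = 0.
  by move=> sj tj st; rewrite -(el t) // mulrA idm_mul (negPf st) mul0r.
split.
  rewrite /mcomp momE' mulrDr mulrA el // mulr_sumr big1 ?addr0 => [|s].
    by rewrite -mulrA erj.
  rewrite !inE negb_or => /andP[/andP[si sj] _].
  by rewrite os // eq_sym.
move=> s sA si sj; rewrite /mcomp momE' mulrDr mulrA os // mul0r add0r mulr_sumr.
rewrite (bigD1 s) /=; last by rewrite !inE negb_or si sj.
rewrite el // big1 ?addr0 => [|t]; first by rewrite er.
rewrite !inE negb_or => /andP[/andP[/andP[ti tj] _] ts].
by rewrite os // eq_sym.
Qed.
End FusionMap.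

Arguments fus_emb_lin {k I A i j} ij.
Arguments fus_emb_idm {k I A i j} ij s.

(** * Successive fusions *)

Lemma filter_ltnS n (m : 'I_n) :
  [seq l : 'I_n <- enum 'I_n | (l < m.+1)%N] =
  [seq l : 'I_n <- enum 'I_n | (l < m)%N] ++ [:: m].
Proof.
have E j : (j <= n)%N ->
    map val [seq l : 'I_n <- enum 'I_n | (l < j)%N] = iota 0 j.
  move=> jn; rewrite -(filter_map val (fun i => i < j)%N) val_enum_ord.
  exact: (@filter_iota_ltn 0 n j).
apply: (inj_map val_inj); rewrite map_cat !E ?(ltnW (ltn_ord m)) //.
by rewrite -addn1 iotaD.
Qed.

Section Stages.
Variables (k : fieldType) (n : nat) (c1 : 'I_n).
Hypothesis c1_0 : c1 = 0%N :> nat.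
Local Notation L := ('I_n * bool)%type.
Local Notation half := (2%:R^-1 : k).

Definition opp_lab (p : L) : L := (p.1, ~~ p.2).

Lemma opp_labK : involutive opp_lab.
Proof. by case=> l s; rewrite /opp_lab /= negbK. Qed.

(* Data in S that define a morphism out of every stage of the fusion: m consists *)
(* of matrix units, y and z are the images of the generators before fusion, and *)
(* fusing only multiplies y by elements m p q. *)
Record matrix_rep (S : calgType k) (m : L -> L -> S) (y : L -> S) (z : 'I_n ->
  S) :
    Prop := {
  rep_m : forall p q q' r, p.2 = q.2 -> q'.2 = r.2 ->
    m p q * m q' r = if q == q' then m p r else 0;
  rep_y : forall p, m p p * y p * m (opp_lab p) (opp_lab p) = y p;
  rep_z : forall l, corner_inv (m (l, true) (l, true))
    (m (l, true) (l, true) + y (l, true) * y (l, false)) (z l)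
}.

(* t s is the number of copies whose idempotent e_(s, l) has already been *)
(* fused onto that of the first copy. *)
Definition fused_lab (t : bool -> nat) (p : L) : L :=
  if (p.1 < t p.2)%N then (c1, p.2) else p.

Section StageDef.
Variables (A : balg k L) (t : bool -> nat) (x : L -> A) (pv : 'I_n -> A).

Definition lab (p : L) : A := idm A (fused_lab t p).

(* x (l, true) and x (l, false) are c_l and d_l. *)
Record fusion_stage : Prop := {
  st_verts : verts A = [set p : L | (t p.2 <= p.1)%N || (p.1 == c1)];
  st_xl : forall p, lab p * x p = x p;
  st_xr : forall p, x p * lab (opp_lab p) = x p;
  st_pv : forall l, corner_inv (lab (l, true))
    (lab (l, true) + x (l, true) * x (l, false)) (pv l);
  st_gen : generated_by (fun a => (exists p, a = idm A p) \/
    (exists p, a = x p) \/ exists l, a = pv l);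
  st_lift : forall (S : calgType k) m y z, @matrix_rep S m y z ->
    exists h : A -> S, [/\ is_nhom h,
      forall p, p \in verts A -> h (idm A p) = m p p
      & forall p, h (x p) = m (fused_lab t p) p * y p *
          m (opp_lab p) (fused_lab t (opp_lab p))]
}.

(** At e_1 this is (e_1 + d c)^-1, written as e_1 - d P^-1 c, so that the single inverse [pv] of
    each copy suffices. *)
Definition copy_mom (p : L) : A :=
  if p.2 then lab p + x p * x (opp_lab p)
  else lab p - x p * pv p.1 * x (opp_lab p).

(** The copies already attached to the vertex [p], in the order of fusion, which is the order of the
    factors of the moment map. An unfused vertex carries its own copy only. *)
Definition fused_copies (p : L) : seq 'I_n :=
  if p.1 == c1 then [seq l : 'I_n <- enum 'I_n | (l < t p.2)%N] else [:: p.1].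

(** In a bracket between copies i < l, each test asks whether one of the two vertices of the later
    copy [l] is already fused; that fusion contributes exactly the term guarded by the test. Once
    both tests hold, the brackets are those of the fully fused algebra. *)
Record fusion_stage_hdqp (H : hdqp A) : Prop := {
  hst_xx : forall p, dbr H (x p) (x p) = 0;
  hst_cd : forall l, dbr H (x (l, true)) (x (l, false)) =
    half *: (lab (l, false) ⊗ (x (l, true) * x (l, false))
      + (x (l, false) * x (l, true)) ⊗ lab (l, true))
    + lab (l, false) ⊗ lab (l, true);
  hst_lt1 : forall (i l : 'I_n) s, (i < l)%N -> dbr H (x (i, s)) (x (l, s)) =
    - (half *: ((if (l < t s)%N then x (i, s) ⊗ x (l, s) else 0)
               + (if (l < t (~~ s))%N then x (l, s) ⊗ x (i, s) else 0)));
  hst_lt2 : forall (i l : 'I_n) s, (i < l)%N -> dbr H (x (i, s)) (x (l, ~~ s)) =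
    half *: ((if (l < t s)%N then (x (l, ~~ s) * x (i, s)) ⊗ lab (i, s) else 0)
      + (if (l < t (~~ s))%N then lab (i, ~~ s) ⊗ (x (i, s) * x (l, ~~ s)) else 0));
  hst_mom : forall p, p \in verts A -> mcomp (mom H) p =
    \prod_(l <- fused_copies p) copy_mom (l, p.2) * idm A p
}.
End StageDef.

(** * One fusion step *)

Section Step.
Variables (A : balg k L) (t : bool -> nat) (x : L -> A) (pv : 'I_n -> A).
Variables (l0 : 'I_n) (s0 : bool).
Hypotheses (t_gt0 : forall s, (0 < t s)%N) (tl0 : t s0 = l0).
Hypothesis stA : fusion_stage t x pv.

Let t' s := if s == s0 then (t s).+1 else t s.
Let i0 : L := (c1, s0).
Let j0 : L := (l0, s0).
Local Notation Afus := (fusion A i0 j0).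
Local Notation et := (@fus_emb _ _ A i0 j0).

Let l0_neq : c1 != l0.
Proof. by rewrite -val_eqE /= c1_0 -tl0 neq_ltn t_gt0. Qed.
Let ij : i0 != j0. Proof. by rewrite xpair_eqE (negPf l0_neq). Qed.

Let fused_labE p : fused_lab t' p =
  if fused_lab t p == j0 then i0 else fused_lab t p.
Proof.
rewrite /fused_lab /t'; case: p => l s /=.
case: (eqVneq s s0) => [->|ss0]; last first.
  by case: ifP => _; rewrite xpair_eqE (negPf ss0) andbF.
rewrite ltnS tl0 leq_eqVlt; case: ltnP => /= ll0.
  by rewrite orbT /= xpair_eqE (negPf l0_neq).
by rewrite orbF xpair_eqE eqxx andbT -val_eqE.
Qed.

Let jA : j0 \in verts A.
Proof. by rewrite (st_verts stA) inE /= tl0 leqnn. Qed.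
Let iA : i0 \in verts A.
Proof. by rewrite (st_verts stA) inE /= eqxx orbT. Qed.

Let X p : Afus := et (x p).
Let lab' := lab Afus t'.

Let emb_lab p : et (lab A t p) = lab' p.
Proof. by rewrite /lab' /lab (fus_emb_idm ij) fused_labE. Qed.

Let lab_idem p : lab A t p * lab A t p = lab A t p.
Proof. by rewrite /lab idm_mul eqxx. Qed.

Let etM a b p : a * lab A t p = a -> lab A t p * b = b ->
  et (a * b) = et a * et b.
Proof. exact: fus_embM. Qed.

Let xxM l s : et (x (l, s) * x (l, ~~ s)) = X (l, s) * X (l, ~~ s).
Proof. by apply: (@etM _ _ (l, ~~ s));
  [exact: (st_xr stA (l, s))|exact: (st_xl stA)]. Qed.

(** The generators pass through [fus_emb], which is multiplicative on the products involved since
    their factors meet at a common label. A lift of the previous stage extends once images of the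
    two new matrix units are given. *)
Lemma fusion_stage_step : fusion_stage t' X (et \o pv).
Proof.
have Xl p : lab' p * X p = X p.
  by rewrite -emb_lab -(@etM _ _ p) ?lab_idem // (st_xl stA).
have Xr p : X p * lab' (opp_lab p) = X p.
  by rewrite -emb_lab -(@etM _ _ (opp_lab p)) ?lab_idem // (st_xr stA).
split=> //.
- apply/setP => -[l s]; rewrite -[verts _]/(verts A :\ j0) (st_verts stA) !inE /=.
  rewrite /t' xpair_eqE; case: (eqVneq s s0) => [->|_]; last by rewrite andbF.
  rewrite andbT tl0 -val_eqE; case: (eqVneq l c1) => [->|lc].
    by rewrite !orbT andbT /= c1_0 -tl0 neq_ltn t_gt0.
  by rewrite !orbF ltn_neqAle eq_sym.
- move=> l; have [xz zx ez ze] := st_pv stA l.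
  set P := _ + _ in xz zx; set e := lab A t (l, true) in xz zx ez ze.
  have Pe : P * e = P.
    by rewrite mulrDl lab_idem -mulrA (st_xr stA (l, false)).
  have eP : e * P = P.
    by rewrite mulrDr lab_idem mulrA (st_xl stA (l, true)).
  have -> : lab' (l, true) + X (l, true) * X (l, false) = et P.
    by rewrite (fus_emb_lin ij).1 -emb_lab -(xxM l true).
  rewrite -[lab Afus t' _]/(lab' _) -emb_lab -/e.
  by split; rewrite -(@etM _ _ (l, true)) ?xz ?zx ?ez ?ze ?lab_idem.
- have := fus_generated ij (st_gen stA).
  move=> gen K Kc KD KM KG; apply: gen => // [|a|a].
  + by left; exists i0.
  + case=> [[p ->]|[[p ->]|[l ->]]].
    * by exists p, p; rewrite !idm_mul eqxx idm_mul eqxx.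
    * exists (fused_lab t p), (fused_lab t (opp_lab p)).
      by rewrite (st_xl stA) (st_xr stA).
    * exists (fused_lab t (l, true)), (fused_lab t (l, true)).
      by have [_ _ -> ->] := st_pv stA l.
  + case=> b Gb ->; apply: KG; case: Gb => [[p ->]|[[p ->]|[l ->]]].
    * by left; rewrite (fus_emb_idm ij); eexists.
    * by right; left; exists p.
    * by right; right; exists l.
- move=> S m y z rep; have [f [fP fe fx]] := st_lift stA rep.
  have m_ii := rep_m rep.
  (* The units of [m] between the two labels being fused serve as images of e_ij and e_ji. *)
  have := fus_lift (u := m i0 j0) (v := m j0 i0) ij fP.
  rewrite !fe // !m_ii // !eqxx => /(_ erefl erefl erefl erefl erefl erefl).
  case=> h [hP he hx]; exists h; split=> //.
    move=> p; rewrite -[verts _]/(verts A :\ j0) in_setD1 => /andP[pj pA].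
    by rewrite he // fe.
  move=> p; rewrite /X (hx (fused_lab t p) (fused_lab t (opp_lab p)));
    last first.
    by rewrite (st_xl stA) (st_xr stA).
  have flA q : fused_lab t q \in verts A.
    rewrite (st_verts stA) inE /fused_lab; case: ltnP => /=;
      first by rewrite eqxx orbT.
    by move->.
  have fl2 q : (fused_lab t q).2 = q.2 by rewrite /fused_lab; case: ifP.
  rewrite !fe // fx !fused_labE.
  have E1 q : (if fused_lab t q == j0 then m i0 j0 else m (fused_lab t q) (fused_lab t q))
      * m (fused_lab t q) q = m (if fused_lab t q == j0 then i0 else fused_lab t q) q.
    case: ifP => [/eqP E|_]; last by rewrite m_ii ?eqxx ?fl2.
    by rewrite E m_ii ?eqxx // -(fl2 q) E.
  have E2 q : m q (fused_lab t q) * (if fused_lab t q == j0 then m j0 i0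
        else m (fused_lab t q) (fused_lab t q))
      = m q (if fused_lab t q == j0 then i0 else fused_lab t q).
    case: ifP => [/eqP E|_]; last by rewrite m_ii ?eqxx ?fl2.
    by rewrite E m_ii ?eqxx // -(fl2 q) E.
  by rewrite !mulrA E1 -!mulrA E2 !mulrA.
Qed.
Section StepHdqp.
Variables (H : hdqp A) (Hf : hdqp Afus).
Hypothesis hstA : fusion_stage_hdqp t x pv H.

Section StepBracket.
Let Xl p : lab' p * X p = X p.
Proof. exact: (st_xl fusion_stage_step p). Qed.
Let Xr p : X p * lab' (opp_lab p) = X p.
Proof. exact: (st_xr fusion_stage_step p). Qed.
Let E := idm Afus i0.

Let lab_i0 (l : 'I_n) : (l <= l0)%N -> lab' (l, s0) = E.
Proof.
by move=> ll0; rewrite /lab' /lab /fused_lab /= /t' eqxx ltnS tl0 ll0.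
Qed.
Let E_lab (p : L) : (p.2 != s0) || (l0 < p.1)%N ->
  E * lab' p = 0 /\ lab' p * E = 0.
Proof.
move=> pP; rewrite /E /lab' /lab !idm_mul.
have : i0 != fused_lab t' p.
  apply/eqP; rewrite /fused_lab /t'; case: p pP => l s /=.
  have [->|ss0] := eqVneq s s0; last first.
    move=> _ ieq; case/eqP: ss0; move/(congr1 snd): ieq.
    by case: ifP.
  move=> /= ll0; rewrite tl0 ltnS leqNgt ll0 /= => /(congr1 fst) /= lc.
  by move: ll0; rewrite -lc c1_0.
by move=> iN; rewrite [fused_lab _ _ == _]eq_sym (negPf iN).
Qed.

Let EX (p : L) : (p.2 != s0) || (l0 < p.1)%N -> E * X p = 0.
Proof. by move=> /E_lab[H1 _]; rewrite -Xl mulrA H1 mul0r. Qed.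
Let XE (p : L) : (p.2 == s0) || (l0 < p.1)%N -> X p * E = 0.
Proof.
move=> pP; rewrite -Xr -mulrA; suff /E_lab[_ ->] : ((opp_lab p).2 != s0) || (l0 < (opp_lab p).1)%N.
  by rewrite mulr0.
by move: pP; case: p => l [] /=; case: (s0).
Qed.



Let labN (p : L) : p.2 != s0 \/ p.1 != l0 -> fused_lab t p != j0.
Proof.
case: p => l s /= pP; rewrite /fused_lab; case: ifP => _.
  by rewrite xpair_eqE (negPf l0_neq).
by rewrite xpair_eqE; case: pP => /negPf -> //; rewrite andbF.
Qed.
Let epsl (a : A) p : fused_lab t p != j0 -> lab A t p * a = a ->
  eps A j0 * a = a.
Proof.
move=> pj pa; rewrite /eps mulrBl mul1r -pa mulrA idm_mul eq_sym (negPf pj).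
by rewrite mul0r subr0.
Qed.
Let epsr (a : A) p : fused_lab t p != j0 -> a * lab A t p = a ->
  a * eps A j0 = a.
Proof.
move=> pj pa; rewrite /eps mulrBr mulr1 -pa -mulrA idm_mul (negPf pj).
by rewrite mulr0 subr0.
Qed.
Let lab_j0 : lab A t j0 = idm A j0.
Proof. by rewrite /lab /fused_lab /= tl0 ltnn. Qed.

(** The vertex [j0] still belongs to copy [l0] alone: [x j0] has it on the left (type u), the
    opposite generator has it on the right (type v), and the generators of the other copies avoid it
    (type t). *)
Let Xt (p : L) : p.1 != l0 -> X p = gen_t i0 j0 (x p) /\ type_t j0 (x p).
Proof.
move=> pl; have tP : type_t j0 (x p).
  rewrite /type_t (epsl _ (st_xl stA p)) ?(epsr _ (st_xr stA p)) //;
    by apply: labN; right.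
by split=> //; apply: (fus_emb_t ij).
Qed.
Let Xu : X j0 = gen_u i0 j0 (x j0) /\ type_u j0 (x j0).
Proof.
have uP : type_u j0 (x j0).
  rewrite /type_u -lab_j0 (st_xl stA) (epsr _ (st_xr stA j0)) //.
  by apply: labN; left; rewrite /= ; case: (s0).
by split=> //; apply: (fus_emb_u ij).
Qed.
Let Xv : X (opp_lab j0) = gen_v i0 j0 (x (opp_lab j0)) /\ type_v j0 (x (opp_lab j0)).
Proof.
have vP : type_v j0 (x (opp_lab j0)).
  have := st_xr stA (opp_lab j0); rewrite opp_labK lab_j0 /type_v => xr.
  rewrite (epsl _ (st_xl stA _)) ?xr //.
  by apply: labN; left; rewrite /= ; case: (s0).
by split=> //; apply: (fus_emb_v ij).
Qed.

Variables (dbar : fus_bar A i0 j0 -> fus_bar A i0 j0 ->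
  tens2 (fus_bar A i0 j0)).
Variables (dres dfus : Afus -> Afus -> tens2 Afus).
Hypothesis dbarP : is_dbar H dbar.
Hypothesis dresP : forall y z, tmap (@cinc _ _ A i0 j0) (dres y z) =
  dbar (cinc y) (cinc z).
Hypothesis dfusP : is_dfus dfus.
Hypothesis HfE : forall y z, dbr Hf y z = dres y z + dfus y z.

Let dP := dfus_double_bracket dfusP.

Let brE p q : dbr Hf (X p) (X q) = tmap et (dbr H (x p) (x q)) +
  dfus (X p) (X q).
Proof. by rewrite HfE (dres_emb ij dbarP dresP). Qed.

Let XX0 (p q : L) : p.2 = q.2 -> X p * X q = 0.
Proof.
move=> pq; rewrite -Xr -[X q]Xl -mulrA [lab' _ * _]mulrA /lab' /lab idm_mul.
case: eqP => [|_]; last by rewrite mul0r mulr0.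
move/(congr1 snd); rewrite /fused_lab.
by do 2!case: ifP => _; rewrite /= pq; case: (q.2).
Qed.

Let dfus_t (p q : L) : p.1 != l0 -> q.1 != l0 -> dfus (X p) (X q) = 0.
Proof.
by move=> /Xt[-> pt] /Xt[-> qt]; apply: (dfus_tt dfusP).
Qed.
Let dfus_u (p : L) : p.1 != l0 ->
  dfus (X p) (X j0) = half *: (E ⊗ (X p * X j0) - (E * X p) ⊗ X j0).
Proof.
by move=> /Xt[-> pt]; have [-> jt] := Xu; apply: (dfus_tu dfusP).
Qed.
Let dfus_v (p : L) : p.1 != l0 -> dfus (X p) (X (opp_lab j0)) =
  half *: ((X (opp_lab j0) * X p) ⊗ E - X (opp_lab j0) ⊗ (X p * E)).
Proof.
by move=> /Xt[-> pt]; have [-> jt] := Xv; apply: (dfus_tv dfusP).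
Qed.
(** Fusion leaves the brackets inside a copy unchanged: every term of the uu, uv and vv formulas
    contains a product whose inner idempotents do not match. *)
Let dfus_l0 s s' : dfus (X (l0, s)) (X (l0, s')) = 0.
Proof.
have uv : dfus (X j0) (X (opp_lab j0)) = 0.
  have EV : E * X (opp_lab j0) = 0 by apply: EX; rewrite /=; case: (s0).
  have UE : X j0 * E = 0 by apply: XE; rewrite /= eqxx.
  move: EV UE; have [-> uP] := Xu; have [-> vP] := Xv => EV UE.
  by rewrite (dfus_uv dfusP) // EV UE ptens0r ptens0r subrr scaler0.
have uu : dfus (X j0) (X j0) = 0.
  have := @XX0 j0 j0 erefl; have [-> uP] := Xu => U0.
  by rewrite (dfus_uu dfusP) // U0 ptens0r ptens0l subrr scaler0.
have vv : dfus (X (opp_lab j0)) (X (opp_lab j0)) = 0.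
  have := @XX0 (opp_lab j0) (opp_lab j0) erefl; have [-> vP] := Xv => V0.
  by rewrite (dfus_vv dfusP) // V0 ptens0r ptens0l subrr scaler0.
have vu : dfus (X (opp_lab j0)) (X j0) = 0 by rewrite (brC dP) uv tflip0 oppr0.
have Ej b : (l0, b) = j0 \/ (l0, b) = opp_lab j0.
  by rewrite /opp_lab /j0 /=; case: b; case: (s0); [left|right|right|left].
by case: (Ej s) => ->; case: (Ej s') => ->.
Qed.
(** A generator of a copy not yet reached is killed by [E] on both sides, and every term of the tu
    and tv formulas contains such a product. *)
Let dfus_gt (p q : L) : (l0 < p.1)%N -> q.1 = l0 -> dfus (X p) (X q) = 0.
Proof.
move=> lp ql; have pl : p.1 != l0 by rewrite -val_eqE neq_ltn lp orbT.
have EXp : E * X p = 0 by apply: EX; rewrite lp orbT.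
have XpE : X p * E = 0 by apply: XE; rewrite lp orbT.
have Ej : lab' j0 = E by rewrite (lab_i0 (leqnn _)).
have [->|->] : q = j0 \/ q = opp_lab j0.
  by case: q ql => l b /= ->; rewrite /opp_lab /j0 /=; case: b; case: (s0);
    [left|right|right|left].
- by rewrite dfus_u // -[X j0]Xl Ej mulrA XpE EXp mul0r ptens0r ptens0l subrr scaler0.
- rewrite dfus_v // -[X (opp_lab j0)]Xr opp_labK Ej -mulrA EXp XpE mulr0.
  by rewrite ptens0r ptens0l subrr scaler0.
Qed.

Let emb_lin : is_lin et. Proof. exact: fus_emb_lin ij. Qed.

Let tmapX p q : tmap et (x p ⊗ x q) = X p ⊗ X q.
Proof. exact: tmap_ptens emb_lin _ _. Qed.

Let t's s : s != s0 -> t' s = t s. Proof. by rewrite /t' => /negPf ->. Qed.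
Let t's0 : t' s0 = l0.+1. Proof. by rewrite /t' eqxx tl0. Qed.

(** Passing from [t] to [t'] changes a test only for [l = l0], at the vertex [s0]. The fusion
    bracket supplies exactly the term switched on, as its other term contains a product of two
    generators of the same direction, which vanishes. *)
Let step_lt1 (i l : 'I_n) s : (i < l)%N -> dbr Hf (X (i, s)) (X (l, s)) =
    - (half *: ((if (l < t' s)%N then X (i, s) ⊗ X (l, s) else 0)
               + (if (l < t' (~~ s))%N then X (l, s) ⊗ X (i, s) else 0))).
Proof.
move=> il; rewrite brE (hst_lt1 hstA s il) (tmapN emb_lin) (tmapZ emb_lin).
rewrite (tmapD emb_lin) !(fun_if (tmap et)) !tmapX (tmap0 emb_lin).
have [ll0|ll0] := eqVneq l l0; last first.
  have -> : dfus (X (i, s)) (X (l, s)) = 0.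
    have [il0|il0] := eqVneq i l0; last exact: dfus_t.
    rewrite (brC dP) dfus_gt ?tflip0 ?oppr0 //=.
    by rewrite -il0.
  have tl b : (l < t' b)%N = (l < t b)%N.
    rewrite /t'; case: eqP => [->|//]; rewrite tl0 ltnS leq_eqVlt -[in RHS]tl0.
    by rewrite tl0 val_eqE (negPf ll0).
  by rewrite addr0 !tl.
have il0 : i != l0 by rewrite -ll0 -val_eqE neq_ltn il.
have [ss0|ss0] := eqVneq s s0.
  have -> : (l, s) = j0 by rewrite ll0 ss0.
  rewrite dfus_u // ll0 ss0 t's0 tl0 ltnn leqnn add0r XX0 // ptens0r sub0r.
  have Ei : E * X (i, s0) = X (i, s0).
    by rewrite -(@lab_i0 i) ?Xl // -ll0 ltnW.
  rewrite Ei t's; last by case: (s0).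
  by rewrite scalerN -opprD -scalerDr addrC.
have lj : (l, s) = opp_lab j0.
  by rewrite ll0 /opp_lab /=; case: (s) ss0; case: (s0).
have ss1 : ~~ s = s0 by case: (s) ss0; case: (s0).
have Ei : X (i, s) * E = X (i, s).
  by rewrite -(@lab_i0 i) -?ss1 ?(Xr (i, s)) // -ll0 ltnW.
have -> : dfus (X (i, s)) (X (l, s)) = - (half *: (X (l, s) ⊗ X (i, s))).
  by rewrite {1}lj dfus_v // -lj XX0 // ptens0l sub0r scalerN Ei.
by rewrite ll0 ss1 t's0 tl0 ltnn leqnn addr0 t's // -opprD -scalerDr.
Qed.

Let labM p q : fused_lab t (opp_lab p) = fused_lab t q ->
  et (x p * x q) = X p * X q.
Proof.
move=> pq; apply: (@etM _ _ (opp_lab p)); first exact: (st_xr stA).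
by rewrite /lab pq; exact: (st_xl stA).
Qed.

Let step_lt2 (i l : 'I_n) s : (i < l)%N -> dbr Hf (X (i, s)) (X (l, ~~ s)) =
    half *: ((if (l < t' s)%N then (X (l, ~~ s) * X (i, s)) ⊗ lab' (i, s) else 0)
      + (if (l < t' (~~ s))%N then lab' (i, ~~ s) ⊗ (X (i, s) * X (l, ~~ s)) else 0)).
Proof.
move=> il; rewrite brE (hst_lt2 hstA s il) (tmapZ emb_lin).
rewrite (tmapD emb_lin) !(fun_if (tmap et)) (tmap0 emb_lin) !(tmap_ptens emb_lin).
rewrite !emb_lab.
(* The two factors meet at a common label before this fusion only when the vertex between them is
   already fused; the test guarding the term says so. *)
have E1 : (l < t s)%N -> et (x (l, ~~ s) * x (i, s)) = X (l, ~~ s) * X (i, s).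
  move=> lt; apply: labM; rewrite /opp_lab /fused_lab /= negbK lt.
  by rewrite (ltn_trans il lt).
have E2 : (l < t (~~ s))%N -> et (x (i, s) * x (l, ~~ s)) =
  X (i, s) * X (l, ~~ s).
  by move=> lt; apply: labM; rewrite /opp_lab /fused_lab /= lt (ltn_trans il lt).
have [ll0|ll0] := eqVneq l l0; last first.
  have -> : dfus (X (i, s)) (X (l, ~~ s)) = 0.
    have [il0|il0] := eqVneq i l0; last exact: dfus_t.
    rewrite (brC dP) dfus_gt ?tflip0 ?oppr0 //=.
    by rewrite -il0.
  have tl b : (l < t' b)%N = (l < t b)%N.
    rewrite /t'; case: eqP => [->|//]; rewrite tl0 ltnS leq_eqVlt -[in RHS]tl0.
    by rewrite tl0 val_eqE (negPf ll0).
  rewrite addr0 !tl; congr (_ *: (_ + _)); case: ifP => // lt.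
    by rewrite E1.
  by rewrite E2.
have il0 : i != l0 by rewrite -ll0 -val_eqE neq_ltn il.
have li : (i <= l0)%N by rewrite -ll0 ltnW.
have [ss0|ss0] := eqVneq s s0.
  have -> : (l, ~~ s) = opp_lab j0 by rewrite ll0 ss0.
  rewrite dfus_v // [X (i, s) * E]XE ?ss0 ?eqxx // ptens0r subr0.
  rewrite t's0 ll0 tl0 ltnn leqnn add0r lab_i0 // t's; last by case: (s0).
  move: E2; rewrite ll0 ss0 => E2.
  rewrite -scalerDr addrC; congr (_ *: (_ + _)); case: ifP => // lt.
  by rewrite -E2.
have ss1 : ~~ s = s0 by case: (s) ss0; case: (s0).
have lj : (l, ~~ s) = j0 by rewrite ll0 ss1.
rewrite lj dfus_u // [E * X _]EX ?ss0 // ptens0l subr0.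
rewrite ss1 t's0 ll0 tl0 ltnn leqnn addr0 lab_i0 // t's //.
move: E1; rewrite ll0 ss1 => E1.
rewrite -scalerDr; congr (_ *: (_ + _)); case: ifP => // lt.
by rewrite -E1.
Qed.

Let step_xx p : dbr Hf (X p) (X p) = 0.
Proof.
rewrite brE (hst_xx hstA) (tmap0 emb_lin) add0r.
have [pl|pl] := eqVneq p.1 l0; last exact: dfus_t.
by case: p pl => l s /= ->; apply: dfus_l0.
Qed.

Let step_cd l : dbr Hf (X (l, true)) (X (l, false)) =
    half *: (lab' (l, false) ⊗ (X (l, true) * X (l, false))
      + (X (l, false) * X (l, true)) ⊗ lab' (l, true))
    + lab' (l, false) ⊗ lab' (l, true).
Proof.
rewrite brE (hst_cd hstA) (tmapD emb_lin) (tmapZ emb_lin) (tmapD emb_lin).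
rewrite !(tmap_ptens emb_lin) !emb_lab (xxM l true) (xxM l false).
have -> : dfus (X (l, true)) (X (l, false)) = 0; last by rewrite addr0.
by have [->|pl] := eqVneq l l0; [exact: dfus_l0|exact: dfus_t].
Qed.
Lemma fusion_stage_br : [/\ forall p, dbr Hf (X p) (X p) = 0,
  forall l, dbr Hf (X (l, true)) (X (l, false)) =
    half *: (lab' (l, false) ⊗ (X (l, true) * X (l, false))
      + (X (l, false) * X (l, true)) ⊗ lab' (l, true))
    + lab' (l, false) ⊗ lab' (l, true),
  forall (i l : 'I_n) s, (i < l)%N -> dbr Hf (X (i, s)) (X (l, s)) =
    - (half *: ((if (l < t' s)%N then X (i, s) ⊗ X (l, s) else 0)
               + (if (l < t' (~~ s))%N then X (l, s) ⊗ X (i, s) else 0)))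
& forall (i l : 'I_n) s, (i < l)%N -> dbr Hf (X (i, s)) (X (l, ~~ s)) =
    half *: ((if (l < t' s)%N then (X (l, ~~ s) * X (i, s)) ⊗ lab' (i, s) else 0)
      + (if (l < t' (~~ s))%N then lab' (i, ~~ s) ⊗ (X (i, s) * X (l, ~~ s)) else 0))].
Proof. by split. Qed.
End StepBracket.

Let cm := copy_mom t x pv.
Let cm' := copy_mom t' X (et \o pv).

Let cm_l p : lab A t p * cm p = cm p.
Proof.
rewrite /cm /copy_mom; case: ifP => _;
  first by rewrite mulrDr lab_idem mulrA (st_xl stA).
by rewrite mulrBr lab_idem !mulrA (st_xl stA).
Qed.
Let cm_r p : cm p * lab A t p = cm p.
Proof.
have xr : x (opp_lab p) * lab A t p = x (opp_lab p).
  by have := st_xr stA (opp_lab p); rewrite opp_labK.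
rewrite /cm /copy_mom; case: ifP => _;
  first by rewrite mulrDl lab_idem -mulrA xr.
by rewrite mulrBl lab_idem -!mulrA xr.
Qed.

Let emb_cm p : et (cm p) = cm' p.
Proof.
have eD := (fus_emb_lin ij).1; have eN := is_linN (fus_emb_lin ij).
rewrite /cm /cm' /copy_mom; case: ifPn => p2.
  by rewrite eD emb_lab; case: p {p2} => l s; rewrite xxM.
have pE : p = (p.1, false) by case: p p2 => l [].
have [_ _ zl zr] := st_pv stA p.1.
have xz : x p * lab A t (p.1, true) = x p by have := st_xr stA p; rewrite {2}pE.
rewrite eD eN emb_lab (@etM _ _ (p.1, true)) ?(@etM _ _ (p.1, true)) //.
  by rewrite -mulrA zr.
by have := st_xl stA (opp_lab p); rewrite {1}pE.
Qed.

Let prod_l q r : (forall l, l \in r -> fused_lab t (l, q.2) = q) ->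
  fused_lab t q = q ->
  idm A q * (\prod_(l <- r) cm (l, q.2) * idm A q)
    = \prod_(l <- r) cm (l, q.2) * idm A q.
Proof.
move=> rq tq; elim: r rq => [|l r IH] rq;
  first by rewrite big_nil mul1r idm_mul eqxx.
rewrite big_cons !mulrA -[in RHS](cm_l (l, q.2)) /lab rq ?mem_head //.
Qed.

Let emb_prod q r : (forall l, l \in r -> fused_lab t (l, q.2) = q) ->
  fused_lab t q = q ->
  et (\prod_(l <- r) cm (l, q.2) * idm A q) =
    \prod_(l <- r) cm' (l, q.2) * lab' q.
Proof.
move=> rq tq; have qE : idm A q = lab A t q by rewrite /lab tq.
elim: r rq => [|l r IH] rq; first by rewrite !big_nil !mul1r qE emb_lab.
have lq : lab A t (l, q.2) = idm A q by rewrite /lab rq ?mem_head.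
have rq' l' : l' \in r -> fused_lab t (l', q.2) = q.
  by move=> lr; apply: rq; rewrite inE lr orbT.
rewrite !big_cons -!mulrA (@etM _ _ (l, q.2)) ?cm_r // ?emb_cm ?IH //.
by rewrite lq prod_l.
Qed.

Let fl_id p : p \in verts A -> fused_lab t p = p.
Proof.
rewrite (st_verts stA) inE /fused_lab; case: p => l s /= /orP[tl|/eqP ->].
  by rewrite ltnNge tl.
by rewrite if_same.
Qed.

Let fc_lab p l : p \in verts A -> l \in fused_copies t p ->
  fused_lab t (l, p.2) = p.
Proof.
move=> pA; rewrite /fused_copies; case: eqP => [pc|pc].
  by rewrite mem_filter /fused_lab /= => /andP[-> _]; rewrite -pc; case: (p).
by rewrite inE => /eqP ->; rewrite -surjective_pairing fl_id.
Qed.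

(** For the moment map: the new component at [i0] is the old one times that of [j0], so [l0] is
    appended to the copies at [i0]. The other components are only transported. *)
Lemma fusion_stage_hdqp_step : is_fusion_hdqp H Hf ->
  fusion_stage_hdqp t' X (et \o pv) Hf.
Proof.
case=> _ [dbar [dres [dfus [dbarP dresP dfusP HfE]]]] momE.
have [h1 h2 h3 h4] := fusion_stage_br dbarP dresP dfusP HfE.
split=> // p pA'.
have [momi momo] := fus_mom ij momE.
have pA : p \in verts A by move: pA';
  rewrite -[verts _]/(verts A :\ j0) in_setD1 => /andP[].
have pj : p != j0 by move: pA'; rewrite -[verts _]/(verts A :\ j0) in_setD1 =>
  /andP[].
have fl' : fused_lab t' p = p by rewrite fused_labE fl_id // (negPf pj).
have mE q : q \in verts A -> et (mcomp (mom H) q) =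
    \prod_(l <- fused_copies t q) cm' (l, q.2) * lab' q.
  move=> qA; rewrite (hst_mom hstA) // -/cm emb_prod // ?fl_id //.
  by move=> l; apply: fc_lab.
have [pi|pi] := eqVneq p i0; last first.
  rewrite momo // mE // /lab' /lab fl'; congr (_ * _).
  rewrite /fused_copies; case: eqP => // pc.
  congr bigop; apply: eq_filter => l; rewrite /t'; case: eqP => // ps.
  by case/eqP: pi; rewrite /i0 -pc -ps -surjective_pairing.
rewrite pi momi !mE //.
have fcj : fused_copies t j0 = [:: l0] by
  rewrite /fused_copies eq_sym (negPf l0_neq).
have fci : fused_copies t' i0 = fused_copies t i0 ++ [:: l0].
  by rewrite /fused_copies /= eqxx /t' eqxx tl0 filter_ltnS.
rewrite fci fcj big_cat !big_seq1 /= -!mulrA; congr (_ * _).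
have li : lab' i0 = idm Afus i0 by rewrite /lab' /lab -pi fl'.
have lj : lab' j0 = idm Afus i0 by rewrite /lab' /lab fused_labE fl_id // eqxx.
rewrite li lj mulrA; congr (_ * _).
rewrite -/(cm' j0) -emb_cm.
by rewrite -lj -emb_lab -(@etM _ _ j0) ?cm_l ?lab_idem.
Qed.
End StepHdqp.

End Step.
End Stages.

(** * Euler continuants *)

(** The identity (1 + dc)^-1 = 1 - d (1 + cd)^-1 c, relating the corners at the two vertices. *)
Lemma corner_inv_swap (R : pzRingType) (e1 e2 c d z : R) :
    e1 * e1 = e1 -> e2 * c = c -> c * e1 = c -> e1 * d = d -> d * e2 = d ->
    corner_inv e2 (e2 + c * d) z ->
  corner_inv e1 (e1 + d * c) (e1 - d * z * c).
Proof.
move=> ee ec ce ed de [Pz zP ez ze].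
have E1 : d * (c * d) * z = d - d * z.
  have {3}-> : d = d * z + d * (c * d) * z.
    by rewrite -{1}de -Pz mulrDl ez mulrDr !mulrA.
  by rewrite addrAC subrr add0r.
have E2 : d * z * (c * d) = d - d * z.
  have {3}-> : d = d * z + d * z * (c * d).
    by rewrite -{1}de -zP mulrDr ze mulrDr !mulrA.
  by rewrite addrAC subrr add0r.
split.
- rewrite mulrBr !mulrDl ee -[d * c * e1]mulrA ce !mulrA ed.
  have -> : d * c * d * z * c = d * c - d * z * c.
    by rewrite -[d * c * d]mulrA E1 mulrBl.
  by rewrite [d * z * c + _]addrC subrK addrK.
- rewrite mulrBl !mulrDr ee -[d * z * c * e1]mulrA ce !mulrA ed.
  have -> : d * z * c * d * c = d * c - d * z * c.
    by rewrite -[d * z * c * d]mulrA E2 mulrBl.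
  by rewrite [d * z * c + _]addrC subrK addrK.
- by rewrite mulrBr ee !mulrA ed.
- by rewrite mulrBl ee -!mulrA ce.
Qed.

Section Words.
Variable n : nat.
Implicit Types (i : 'I_n).

Lemma take_enumS i : take i.+1 (enum 'I_n) = rcons (take i (enum 'I_n)) i.
Proof. by rewrite (take_nth i) ?size_enum_ord // nth_ord_enum. Qed.

Lemma word_abS i : word_ab n i.+1 = word_ab n i ++ [:: La i; Lb i].
Proof. by rewrite /word_ab take_enumS map_rcons flatten_rcons. Qed.

Lemma rev_word_abS i : rev (word_ab n i.+1) =
  [:: Lb i, La i & rev (word_ab n i)].
Proof. by rewrite word_abS rev_cat. Qed.

Lemma word_ab0 : word_ab n 0 = [::].
Proof. by rewrite /word_ab take0. Qed.

Definition pred_ord i : 'I_n := Ordinal (leq_ltn_trans (leq_pred i) (ltn_ord i)).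

Lemma pred_ordK i : (0 < i)%N -> (pred_ord i).+1 = i.
Proof. exact: prednK. Qed.

Definition is_La (y : letter n) : bool := if y is La _ then true else false.
Definition alternating : seq (letter n) -> bool :=
  sorted (fun y z => is_La y != is_La z).

(** Each stage adds two letters; the induction also carries the word that contains only the first of
    them. *)
Lemma alternating_word m : (m <= n)%N -> alternating (word_ab n m).
Proof.
case: m => [|m] mn; first by rewrite word_ab0.
have -> : m.+1 = (Ordinal mn).+1 by [].
move: (Ordinal mn) => {mn} {}m; case: m => m mn.
have H : alternating (rcons (word_ab n m) (La (Ordinal mn))) /\
   alternating (word_ab n m.+1).
  elim: m mn => [|m IH] mn; first by rewrite (word_abS (Ordinal mn)) word_ab0.
  have [H1 H2] := IH (ltnW mn).
  have H3 : alternating (rcons (word_ab n m.+1) (La (Ordinal mn))).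
    move: H2; rewrite (word_abS (Ordinal (ltnW mn))) /=.
    rewrite /alternating -[_ ++ _]cats0 -!cats1 -!catA /=.
    case: (word_ab n m) => [|y w] //=; rewrite !cat_path /=.
    by rewrite !andbT.
  split=> //; rewrite (word_abS (Ordinal mn)).
  move: H3; rewrite /alternating -cats1.
  case: (word_ab n m.+1) => [|y w] //=; rewrite !cat_path /=.
  by move=> /and3P[-> -> _].
by case: H.
Qed.
End Words.

Section Continuants.
Variables (k : fieldType) (n : nat) (A : balg k bool) (a b : 'I_n -> A).
Hypotheses (al : forall i, idm A true * a i = a i)
  (ar : forall i, a i * idm A false = a i)
  (bl : forall i, idm A false * b i = b i)
  (br : forall i, b i * idm A true = b i).

Local Notation rc := (rcontinuant a b).
Local Notation val_ := (letter_val a b).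

Let val_l y : idm A (is_La y) * val_ y = val_ y.
Proof. by case: y. Qed.
Let val_r y : val_ y * idm A (~~ is_La y) = val_ y.
Proof. by case: y. Qed.
Let idmE (y : letter n) : letter_idm A y = idm A (is_La y).
Proof. by case: y. Qed.

Lemma rcontinuant_cons3 y1 y2 y3 w :
  rc [:: y1, y2, y3 & w] = rc [:: y2, y3 & w] * val_ y1 + rc (y3 :: w).
Proof. by []. Qed.

(** The definition recurses on the last letter of a continuant; this is the mirror recursion on its
    first letter. It follows by induction from the symmetry of the recursion, alternation being
    needed to match the idempotents in words of length two. *)
Lemma rcontinuant_rcons w y y' : w <> [::] ->
  alternating (rcons (rcons w y) y') ->
  rc (rcons (rcons w y) y') = val_ y' * rc (rcons w y) + rc w.
Proof.
have [m] := ubnP (size w); elim: m w => // m IH [|z1 [|z2 w]] sw w0;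
  first by case: w0.
  rewrite /alternating /= !andbT => /andP[zy yy'].
  rewrite !idmE mulrDl mulrDr mulrA.
  have -> : idm A (is_La y') * val_ z1 = val_ z1.
    rewrite -[in RHS]val_l; congr (idm A _ * _).
    by move: zy yy'; case: (is_La z1); case: (is_La y); case: (is_La y').
  have -> : val_ y' * idm A (is_La y) = val_ y'.
    rewrite -[in RHS]val_r; congr (_ * idm A _).
    by move: yy'; case: (is_La y); case: (is_La y').
  by rewrite addrC [val_ z1 + _]addrC addrA.
move=> alt {w0}.
have alt1 : alternating (rcons (rcons (z2 :: w) y) y').
  by move: alt; rewrite /alternating /= => /andP[].
have -> : rc [:: z1, z2 & rcons (rcons w y) y'] =
    rc (rcons (rcons (z2 :: w) y) y') * val_ z1 + rc (rcons (rcons w y) y').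
  by case: w {sw alt alt1} => [|z3 w] //=; case: w.
have -> : rc [:: z1, z2 & rcons w y] =
    rc (rcons (z2 :: w) y) * val_ z1 + rc (rcons w y).
  by case: w {sw alt alt1}.
rewrite (IH (z2 :: w)) //.
case: w sw alt alt1 => [|z3 w] sw alt alt1.
  rewrite [in LHS]/= [rc [:: z1; z2]]/= !idmE.
  have -> : is_La y' = is_La z2.
    move: alt1; rewrite /alternating /= andbT => /andP[].
    by case: (is_La z2); case: (is_La y); case: (is_La y').
  rewrite /= !idmE (mulrDl _ (val_ z2)) [in RHS]mulrDr [in RHS]mulrA.
  by rewrite [idm _ _ + val_ y' * _]addrC addrACA [X in _ + X]addrC.
rewrite (IH (z3 :: w)) //.
- have -> : rc [:: z1, z2, z3 & w] = rc [:: z2, z3 & w] * val_ z1 +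
  rc (z3 :: w) by [].
  by rewrite mulrDl mulrDr mulrA addrACA.
- exact: ltnW sw.
- by move: alt1; rewrite /alternating /= => /andP[].
Qed.


(* In the notation of the paper, Fc m = (a_1, ..., b_m), Xc m = (a_1, ..., a_m), *)
(* Gc m = (b_m, ..., a_1) and Yc m = (a_m, ..., a_1), with the conventions for *)
(* m = 0 that make the recursions below uniform. *)
Definition Fc (m : nat) : A := if m is 0 then idm A true else euler a b m true.
Definition Xc (m : nat) : A :=
  if m is 0 then 0 else rc (behead (rev (word_ab n m))).
Definition Gc (m : nat) : A := if m is 0 then idm A false else euler a b m false.
Definition Yc (m : nat) : A :=
  if m is 0 then 0 else rc (rev (behead (rev (word_ab n m)))).

Lemma Fc_euler m : (0 < m)%N -> Fc m = euler a b m true.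
Proof. by case: m. Qed.
Lemma Gc_euler m : (0 < m)%N -> Gc m = euler a b m false.
Proof. by case: m. Qed.

Let FcE m : (0 < m)%N -> Fc m = rc (rev (word_ab n m)).
Proof. by case: m. Qed.
Let GcE m : (0 < m)%N -> Gc m = rc (word_ab n m).
Proof. by case: m => // m _; rewrite /Gc /euler /continuant /word_ba revK. Qed.

Lemma Xc_rec (i : 'I_n) : Xc i.+1 = Fc i * a i + Xc i.
Proof.
rewrite /Xc rev_word_abS /behead; case: (posnP i) => [->|i_gt0].
  by rewrite word_ab0 /= addr0 al.
rewrite FcE // -(pred_ordK i_gt0) rev_word_abS.
by case: (rev _).
Qed.

Lemma Fc_rec (i : 'I_n) : Fc i.+1 = Xc i.+1 * b i + Fc i.
Proof.
rewrite FcE // /Xc rev_word_abS /behead; case: (posnP i) => [->|i_gt0].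
  by rewrite word_ab0 /= addrC.
by rewrite FcE // -(pred_ordK i_gt0) rev_word_abS.
Qed.

(** Here the new letter stands at the front of the continuant, whence the mirror recursion, except
    at index 0 where the conventions apply. *)
Lemma Yc_rec (i : 'I_n) : Yc i.+1 = a i * Gc i + Yc i.
Proof.
have alt : alternating (rev (behead (rev (word_ab n i.+1)))).
  have := alternating_word (ltn_ord i);
    rewrite word_abS rev_cat /= rev_cons revK.
  rewrite /alternating -cats1; case: (word_ab n i) => //= y w.
  by rewrite !cat_path => /andP[-> /= /andP[-> _]].
move: alt; rewrite /Yc rev_word_abS /behead rev_cons revK.
case: (posnP i) => [->|i_gt0].
  by rewrite word_ab0 /= addr0 ar.
rewrite -{1 2 4 5}(pred_ordK i_gt0) rev_word_abS word_abS /behead rev_cons revK.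
rewrite -cat1s catA !cats1 => alt.
rewrite rcontinuant_rcons //; last by case: (word_ab n _).
by rewrite GcE // -[in word_ab _ (nat_of_ord i)](pred_ordK i_gt0) word_abS -cat1s catA !cats1.
Qed.

Lemma Gc_rec (i : 'I_n) : Gc i.+1 = b i * Yc i.+1 + Gc i.
Proof.
have := alternating_word (ltn_ord i).
rewrite GcE // /Yc rev_word_abS /behead rev_cons revK word_abS -cat1s catA !cats1.
case: (posnP i) => [->|i_gt0] alt; first by rewrite word_ab0 /= addrC.
rewrite rcontinuant_rcons ?GcE // -(pred_ordK i_gt0) word_abS.
by case: (word_ab n _).
Qed.
End Continuants.

Lemma rcontinuant_hom (k : fieldType) (n : nat) (A A' : balg k bool)
    (f : A -> A') (a b : 'I_n -> A) w :
  is_nhom f -> f 1 = 1 -> (forall s, f (idm A s) = idm A' s) ->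
  f (rcontinuant a b w) = rcontinuant (f \o a) (f \o b) w.
Proof.
move=> fP f1 fe.
have fl y : f (letter_val a b y) = letter_val (f \o a) (f \o b) y by case: y.
have fi (y : letter n) : f (letter_idm A y) = letter_idm A' y by case: y =>
  i /=.
have [m] := ubnP (size w); elim: m w => // m IH [|y [|y1 [|y2 w]]] sw //;
  first exact: fl.
  by rewrite [in LHS]/= (nhomD fP) (nhomM fP) fi !fl.
rewrite !rcontinuant_cons3 (nhomD fP) (nhomM fP) fl !IH //.
exact: ltnW sw.
Qed.

Lemma euler_hom (k : fieldType) (n : nat) (A A' : balg k bool)
    (f : A -> A') (a b : 'I_n -> A) m s :
  is_nhom f -> f 1 = 1 -> (forall s, f (idm A s) = idm A' s) ->
  f (euler a b m s) = euler (f \o a) (f \o b) m s.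
Proof. exact: rcontinuant_hom. Qed.

(** * The direct sum of copies of B(Gamma_1) *)

Section PathLift.
Variables (k : fieldType) (n : nat).
Local Notation P := (path_alg k n).

Lemma path_a_corner (i : 'I_n) :
  idm P true * path_a_ k i = path_a_ k i /\ path_a_ k i * idm P false =
    path_a_ k i.
Proof.
have E : path_a_ k i = idm P true * path_a_ k i * idm P false.
  by rewrite -[LHS]/(aof _ _) (aof_rel (path_a k i)) !aofM.
by split; rewrite {1}E -?mulrA ?idm_mul ?eqxx ?mulrA -?E // idm_mul eqxx -E.
Qed.

Lemma path_b_corner (i : 'I_n) :
  idm P false * path_b_ k i = path_b_ k i /\ path_b_ k i * idm P true =
    path_b_ k i.
Proof.
have E : path_b_ k i = idm P false * path_b_ k i * idm P true.
  by rewrite -[LHS]/(aof _ _) (aof_rel (path_b k i)) !aofM.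
by split; rewrite {1}E -?mulrA ?idm_mul ?eqxx ?mulrA -?E // idm_mul eqxx -E.
Qed.

Lemma path_generated : generated_by (fun x : P => (exists s, x = idm P s) \/
  exists i, x = path_a_ k i \/ x = path_b_ k i).
Proof.
move=> K Kc KD KM KG; elim/adjoin_ind => [c|[s|i|i]|x y|x y].
- exact: (Kc c).
- by apply: KG; left; exists s.
- by apply: KG; right; exists i; left.
- by apply: KG; right; exists i; right.
- exact: KD.
- exact: KM.
Qed.

Lemma path_lift (S : calgType k) (e : bool -> S) (a b : 'I_n -> S) :
    (forall s t, e s * e t = if s == t then e s else 0) ->
    (forall i, e true * a i = a i /\ a i * e false = a i) ->
    (forall i, e false * b i = b i /\ b i * e true = b i) ->
  exists h : P -> S,
    [/\ is_nhom h, forall s, h (idm P s) = e s,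
      forall i, h (path_a_ k i) = a i & forall i, h (path_b_ k i) = b i].
Proof.
move=> ee ea eb.
(* The unit of [S] may be larger than the sum of the two idempotents, so scalars are sent to
   multiples of [p]. *)
pose p : S := e false + e true.
have pe s : p * e s = e s /\ e s * p = e s.
  by rewrite /p mulrDl mulrDr !ee; case: s; rewrite /= ?add0r ?addr0.
have pp : p * p = p by rewrite {2}/p mulrDr !(pe _).1.
pose f (c : k^o) : S := @in_calg k S c * p.
pose g (x : qgen n) : S := match x with Ge s => e s | Ga i => a i | Gb i =>
  b i end.
have f1 : f 1 = p by rewrite /f in_calg1 mul1r.
have fP : is_nhom f.
  split=> [c d|c d|c]; first by rewrite /f in_calgD mulrDl.
    rewrite /f in_calgM -[RHS]mulrA [p * (_ * _)]mulrA -[p * in_calg _]in_calgC.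
    by rewrite -!mulrA pp.
  by rewrite f1.
have g1 x : f 1 * g x = g x /\ g x * f 1 = g x.
  rewrite f1; case: x => [s|i|i] /=; first exact: pe.
    have [<- <-] := ea i; rewrite !mulrA (pe _).1 -!mulrA (pe _).2.
    by rewrite ?ee ?eqxx; split.
  have [<- <-] := eb i; rewrite !mulrA (pe _).1 -!mulrA (pe _).2.
  by rewrite ?ee ?eqxx; split.
have Rg s t : path_rel s t -> aeval f g s = aeval f g t.
  case=> {s t} [s t||i|i] /=.
  - by rewrite ee; case: ifP => //= _; rewrite (nhom0 fP).
  - by rewrite f1.
  - by have [-> ->] := ea i.
  - by have [-> ->] := eb i.
exists (alift f g); split; first exact: alift_nhom.
- by move=> s; apply: (@alift_var _ _ _ _ _ f g).
- by move=> i; apply: (@alift_var _ _ _ _ _ f g).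
- by move=> i; apply: (@alift_var _ _ _ _ _ f g).
Qed.
End PathLift.

Section BoalchFacts.
Variables (k : fieldType) (n : nat).
Local Notation B := (boalch k n).

Lemma to_boalch_nhom : is_nhom (@to_boalch k n).
Proof. by have /calg_hom_nhom[] := to_loc_hom (fun s : bool => s)
  (euler (@path_a_ k n) (@path_b_ k n) n). Qed.

Lemma bo_a_corner (i : 'I_n) :
  idm B true * bo_a k i = bo_a k i /\ bo_a k i * idm B false = bo_a k i.
Proof.
by have [H1 H2] := path_a_corner k i; rewrite -!(nhomM to_boalch_nhom) H1 H2.
Qed.
Lemma bo_b_corner (i : 'I_n) :
  idm B false * bo_b k i = bo_b k i /\ bo_b k i * idm B true = bo_b k i.
Proof.
by have [H1 H2] := path_b_corner k i; rewrite -!(nhomM to_boalch_nhom) H1 H2.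
Qed.

Lemma boalch_generated : generated_by (fun x : B =>
  [\/ exists s, x = idm B s, exists i, x = bo_a k i, exists i, x = bo_b k i
    | exists s, x = bo_inv k n s]).
Proof.
move=> K Kc KD KM KG x; elim/loc_ind: x => [x|s|x y|x y].
- elim/path_generated: x => [c|x y Kx Ky|x y Kx Ky|x].
  + exact: Kc.
  + by rewrite -/(to_boalch _) (nhomD to_boalch_nhom); apply: KD.
  + by rewrite -/(to_boalch _) (nhomM to_boalch_nhom); apply: KM.
  + case=> [[s ->]|[i [->|->]]]; apply: KG.
    * by constructor 1; exists s.
    * by constructor 2; exists i.
    * by constructor 3; exists i.
- by apply: KG; constructor 4; exists s.
- exact: KD.
- exact: KM.
Qed.

Lemma to_boalch_euler m s :
  to_boalch (euler (@path_a_ k n) (@path_b_ k n) m s) =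
    euler (@bo_a k n) (@bo_b k n) m s.
Proof. by rewrite (euler_hom _ _ _ _ to_boalch_nhom). Qed.

Lemma bo_invP s :
  corner_inv (idm B s) (euler (@bo_a k n) (@bo_b k n) n s) (bo_inv k n s).
Proof. by rewrite -to_boalch_euler; apply: loc_invK. Qed.

Lemma boalch_lift (S : calgType k)
    (h0 : path_alg k n -> S) (g : bool -> S) :
    is_nhom h0 ->
    (forall s, corner_inv (h0 (idm _ s))
      (h0 (euler (@path_a_ k n) (@path_b_ k n) n s)) (g s)) ->
  exists h : B -> S, [/\ is_nhom h, forall x, h (to_boalch x) = h0 x
    & forall s, h (bo_inv k n s) = g s].
Proof. exact: loc_lift. Qed.
End BoalchFacts.

Section BoalchOne.
Variable k : fieldType.
Local Notation B := (boalch k 1).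

Lemma euler1 (A : balg k bool) (a b : 'I_1 -> A) s :
  euler a b 1 s = if s then idm A true + a ord0 * b ord0
                  else idm A false + b ord0 * a ord0.
Proof.
have w : word_ab 1 1 = [:: La ord0; Lb ord0].
  by have := word_abS (ord0 : 'I_1); rewrite word_ab0.
by rewrite /euler /continuant /word_ba w; case: s.
Qed.

(** Both sides invert e_1 + d c in the corner at e_1. Hence a copy is generated with the inverse at
    e_2 alone. *)
Lemma bo_inv1_false : bo_inv k 1 false =
  idm B false - bo_b k ord0 * bo_inv k 1 true * bo_a k ord0.
Proof.
have [a1 a2] := bo_a_corner k (ord0 : 'I_1).
have [b1 b2] := bo_b_corner k (ord0 : 'I_1).
have := bo_invP k 1 false; have := bo_invP k 1 true.
rewrite !euler1 => ht hf; apply: corner_inv_uniq hf _.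
by apply: (corner_inv_swap _ a1 a2 b1 b2 ht); rewrite idm_mul.
Qed.
End BoalchOne.

Section DirectSumFacts.
Variables (k : fieldType) (n : nat) (I : finType) (A : balg k I).

Lemma dsum_inM (l m : 'I_n) (x y : A) :
  @GRing.mul (dsum n A) (dsum_in l x) (dsum_in m y) =
    if l == m then dsum_in l (x * y) else 0.
Proof.
apply/ffunP => i; rewrite ffunE [dsum_in l x i]ffunE [dsum_in m y i]ffunE.
have [<-|lm] := eqVneq l m; first by rewrite ffunE; case: ifP; rewrite ?mulr0.
rewrite ffunE; have [->|_] := eqVneq i l; last by rewrite mul0r.
by rewrite (negPf lm) mulr0.
Qed.

Lemma dsum_in_nhom (l : 'I_n) : @is_nhom k A (dsum n A) (dsum_in l).
Proof.
split=> [x y|x y|c]; last 1 first.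
- apply/ffunP => i; rewrite ![in RHS]ffunE !ffunE.
  by case: ifP; rewrite ?mulr0 ?mulr1.
- by apply/ffunP => i; rewrite !ffunE; case: ifP; rewrite ?addr0.
- by rewrite [RHS]dsum_inM eqxx.
Qed.

Lemma dsum_decomp (f : dsum n A) : f = \sum_l dsum_in l ((f : {ffun 'I_n ->
  A}) l).
Proof.
apply/ffunP => i; rewrite sum_ffunE (bigD1 i) //= big1 => [|j ji].
  by rewrite addr0 ffunE eqxx.
by rewrite ffunE eq_sym (negPf ji).
Qed.
End DirectSumFacts.

Lemma tmap_boalch_br (k : fieldType) (A A' : calgType k) (f : A -> A') (h : k)
    (e1 e2 c d : A) : is_nhom f ->
  tmap f (h *: (e1 ⊗ (c * d) + (d * c) ⊗ e2) + e1 ⊗ e2) =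
  h *: (f e1 ⊗ (f c * f d) + (f d * f c) ⊗ f e2) + f e1 ⊗ f e2.
Proof.
move=> fP; have fl := nhom_lin fP.
by rewrite (tmapD fl) (tmapZ fl) (tmapD fl) !(tmap_ptens fl) !(nhomM fP).
Qed.

(** * The initial stage: the unfused direct sum *)

Section BaseStage.
Variables (k : fieldType) (n : nat) (c1 : 'I_n).
Hypothesis c1_0 : c1 = 0%N :> nat.
Local Notation L := ('I_n * bool)%type.
Local Notation B := (boalch k 1).
Local Notation D := (dsum n (boalch k 1)).
Local Notation a0 := (bo_a k (ord0 : 'I_1)).
Local Notation b0 := (bo_b k (ord0 : 'I_1)).

Definition base_gen (p : L) : D := dsum_in p.1 (if p.2 then a0 else b0).
Definition base_inv (l : 'I_n) : D := dsum_in l (bo_inv k 1 true).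
(** The first copy counts as fused from the start, onto itself. *)
Let t (s : bool) : nat := 1%N.

Let flE p : fused_lab c1 t p = p.
Proof.
rewrite /fused_lab ltnS leqn0; case: p => l s /=; case: eqP => // l0.
by congr (_, _); apply: val_inj; rewrite /= c1_0.
Qed.

Let labE p : lab c1 D t p = dsum_in p.1 (idm B p.2).
Proof. by rewrite /lab flE. Qed.

Let gen_l s : idm B s * (if s then a0 else b0) = if s then a0 else b0.
Proof. by case: s; [case: (bo_a_corner k (ord0 : 'I_1))|case: (bo_b_corner k (ord0 : 'I_1))]. Qed.
Let gen_r s : (if s then a0 else b0) * idm B (~~ s) = if s then a0 else b0.
Proof. by case: s; [case: (bo_a_corner k (ord0 : 'I_1))|case: (bo_b_corner k (ord0 : 'I_1))]. Qed.

(** The maps out of the individual copies have mutually orthogonal images, because the diagonal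
    elements of [m] are orthogonal; their sum is therefore multiplicative on the direct sum. *)
Let base_lift (S : calgType k) m y z : @matrix_rep k n S m y z ->
  exists h : D -> S, [/\ is_nhom h, forall p, p \in verts D ->
    h (idm D p) = m p p
      & forall p, h (base_gen p) = m (fused_lab c1 t p) p * y p *
          m (opp_lab p) (fused_lab c1 t (opp_lab p))].
Proof.
move=> rep; have mM := rep_m rep.
have me p : m p p * m p p = m p p by rewrite mM ?eqxx.
have yl p : m p p * y p = y p by rewrite -(rep_y rep p) !mulrA me.
have yr p : y p * m (opp_lab p) (opp_lab p) = y p.
  by rewrite -(rep_y rep p) -!mulrA me.
have hl l : exists h : B -> S, [/\ is_nhom h, forall s, h (idm B s) =
  m (l, s) (l, s),
    h a0 = y (l, true) & h b0 = y (l, false)].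
  have := @path_lift k 1 S (fun s => m (l, s) (l, s)) (fun _ => y (l, true))
    (fun _ => y (l, false)).
  case=> [s s'|i|i|h0 [h0P h0e h0a h0b]].
  - by rewrite mM // xpair_eqE eqxx; case: eqP => [->|].
  - by rewrite (yl (l, true)) (yr (l, true)).
  - by rewrite (yl (l, false)) (yr (l, false)).
  pose g (s : bool) := if s then z l else m (l, false) (l, false) - y (l,
    false) * z l * y (l, true).
  have := @boalch_lift k 1 S h0 g h0P; case=> [s|h [hP hx _]].
    rewrite h0e euler1; case: s => /=;
      rewrite (nhomD h0P) (nhomM h0P) !h0e !h0a !h0b.
      exact: rep_z rep l.
    by apply: (corner_inv_swap _ _ _ _ _ (rep_z rep l)) => //;
      rewrite ?(yl (l, true)) ?(yr (l, true)) ?(yl (l, false)) ?(yr (l, false)).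
  exists h; split=> // [s||]; first by rewrite -h0e -hx.
    by rewrite -(h0a ord0) -hx.
  by rewrite -(h0b ord0) -hx.
have [h hP] := boolp.choice hl.
have hN l : is_nhom (h l) by case: (hP l).
have h1 l : h l 1 = m (l, false) (l, false) + m (l, true) (l, true).
  have [_ he _ _] := hP l; rewrite -(idm_sum B) (eq_bigl xpredT) => [|s];
    last by rewrite in_setT.
  by rewrite big_bool /= (nhomD (hN l)) !he addrC.
have h11 l l' : l != l' -> h l 1 * h l' 1 = 0.
  move=> ll; rewrite !h1 !mulrDl !mulrDr !mM // !xpair_eqE (negPf ll) /=.
  by rewrite !addr0.
have hh l l' x x' : l != l' -> h l x * h l' x' = 0.
  move=> ll; rewrite -(nhom1r (hN l)) -(nhom1l (hN l')) -mulrA [h l 1 * _]mulrA h11 //.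
  by rewrite mul0r mulr0.
pose hD (f : D) : S := \sum_l h l ((f : {ffun 'I_n -> B}) l).
have hDin l x : hD (dsum_in l x) = h l x.
  rewrite /hD (bigD1 l) //= ffunE eqxx big1 ?addr0 // => l' ll.
  by rewrite ffunE (negPf ll) (nhom0 (hN l')).
exists hD; split.
- split=> [f g|f g|c].
  + by rewrite /hD -big_split; apply: eq_bigr => l _;
    rewrite ffunE (nhomD (hN l)).
  + rewrite /hD big_distrlr /=; apply: eq_bigr => l _.
    rewrite (bigD1 l) //= big1 ?addr0 => [|l' ll]; last by rewrite hh // eq_sym.
    by rewrite ffunE (nhomM (hN l)).
  + rewrite /hD mulr_sumr; apply: eq_bigr => l _.
    by rewrite !ffunE (nhomC (hN l)).
- move=> [l s] _; rewrite -[idm D _]/(dsum_in l (idm B s)) hDin.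
  by have [_ -> _ _] := hP l.
- move=> p; rewrite !flE yl yr /base_gen hDin; case: p => l s /=.
  by have [_ _ ha hb] := hP l; case: s.
Qed.

Lemma base_stage : fusion_stage c1 t base_gen base_inv.
Proof.
have dM (l : 'I_n) := nhomM (dsum_in_nhom B l).
split=> //.
- by apply/setP => -[l s]; rewrite !inE /= lt0n -val_eqE /= c1_0; case: (val l).
- by move=> p; rewrite labE /base_gen -(dM p.1) gen_l.
- by move=> p; rewrite labE /base_gen -(dM p.1) gen_r.
- move=> l; have := bo_invP k 1 true; rewrite euler1 labE => inv1.
  have := nhom_corner_inv (dsum_in_nhom B l) inv1.
  by rewrite (nhomD (dsum_in_nhom B l)) (dM l).
- move=> K Kc KD KM KG f; rewrite (dsum_decomp f).
  have K0 : K 0 by rewrite -(in_calg0 D); apply: Kc.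
  have KN y : K y -> K (- y) by move=> Ky; rewrite -in_calgN1; apply: KM.
  have Ke p : K (idm D p) by apply: KG; left; exists p.
  apply: (big_ind K) => // l _; move: (fun_of_fin _ _) => y {f}.
  elim/boalch_generated: y => [c|y z Ky Kz|y z Ky Kz|y].
  + rewrite (nhomC (dsum_in_nhom B l)); apply: KM => //.
    rewrite -[X in dsum_in _ X](idm_sum B) (eq_bigl xpredT) => [|s];
      last by rewrite in_setT.
    rewrite big_bool (nhomD (dsum_in_nhom B l)).
    by apply: KD; [exact: (Ke (l, true))|exact: (Ke (l, false))].
  + by rewrite (nhomD (dsum_in_nhom B l)); apply: KD.
  + by rewrite (nhomM (dsum_in_nhom B l)); apply: KM.
  + have Ka i : K (dsum_in l (bo_a k i)).
      by apply: KG; right; left; exists (l, true); rewrite (ord1 i).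
    have Kb i : K (dsum_in l (bo_b k i)).
      by apply: KG; right; left; exists (l, false); rewrite (ord1 i).
    have Kv : K (dsum_in l (bo_inv k 1 true)).
      by apply: KG; right; right; exists l.
    case=> [[s ->]|[i ->]|[i ->]|[[] ->]] //; first exact: (Ke (l, s)).
    rewrite bo_inv1_false (nhomD (dsum_in_nhom B l)) (nhomN (dsum_in_nhom B l)).
    apply: KD; first exact: (Ke (l, false)).
    by apply: KN; rewrite !(nhomM (dsum_in_nhom B l)); apply: (KM) => //;
      apply: KM.
Qed.

(** Brackets between copies vanish, in accordance with the tests [l < 1], which fail as soon as
    [i < l]. At e_1 the moment map of a copy is its inverse in the form chosen for [copy_mom]. *)
Lemma base_stage_hdqp (H1 : hdqp B) (Hs : hdqp D) :
  is_boalch_hdqp H1 -> is_dsum_hdqp H1 Hs ->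
  fusion_stage_hdqp c1 t base_gen base_inv Hs.
Proof.
move=> [aa bb ab momE] [dE mE].
have dN (l : 'I_n) := dsum_in_nhom B l.
have dl (l : 'I_n) := nhom_lin (dN l).
have tl0 (i l : 'I_n) s : (i < l)%N -> (l < t s)%N = false.
  by move=> il; rewrite /t ltnS leqn0 (gtn_eqF (leq_ltn_trans _ il)).
have dEl (l : 'I_n) x y :
    dbr Hs (dsum_in l x) (dsum_in l y) = @tmap k B D (dsum_in l) (dbr H1 x y).
  by rewrite dE eqxx.
split.
- case=> l s; rewrite /base_gen dEl.
  have -> : dbr H1 (if s then a0 else b0) (if s then a0 else b0) = 0.
    by case: s; rewrite ?aa ?bb subrr sgz0 mulr0 scale0r.
  exact: tmap0 (dl l).
- move=> l; rewrite !labE /base_gen dEl ab ltnn eqxx.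
  exact: (tmap_boalch_br _ _ _ _ _ (dN l)).
- move=> i l s il; rewrite dE -val_eqE (ltn_eqF il).
  by rewrite !(tl0 _ _ _ il) addr0 scaler0 oppr0.
- move=> i l s il; rewrite dE -val_eqE (ltn_eqF il).
  by rewrite !(tl0 _ _ _ il) addr0 scaler0.
- case=> l s _.
  have -> : fused_copies c1 t (l, s) = [:: l].
    rewrite /fused_copies /=; case: eqP => // ->;
      rewrite /t -{1}c1_0 filter_ltnS c1_0.
    by rewrite (eq_filter (a2 := pred0)) ?filter_pred0.
  rewrite big_seq1.
  have mcE : mcomp (mom Hs) (l, s) = dsum_in l (mcomp (mom H1) s).
    rewrite /mcomp mE -[idm D _]/(dsum_in l (idm B s)) mulr_sumr mulr_suml.
    rewrite (bigD1 l) // big1 => [|m mP];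
      first by rewrite [LHS]addr0 !(nhomM (dN l)).
    have ml : l != m by case/andP: mP; rewrite eq_sym.
    by rewrite dsum_inM (negPf ml) mul0r.
  rewrite mcE momE.
  have [a1 a2] := bo_a_corner k (ord0 : 'I_1).
  have [b1 b2] := bo_b_corner k (ord0 : 'I_1).
  have ee s' : idm B s' * idm B s' = idm B s' by rewrite idm_mul eqxx.
  have [_ _ i1 i2] := bo_invP k 1 false.
  have et : idm B true * idm B false = 0 by rewrite idm_mul.
  have ef : idm B false * idm B true = 0 by rewrite idm_mul.
  have cmE : copy_mom c1 t base_gen base_inv (l, s) =
      dsum_in l (if s then idm B true + a0 * b0 else bo_inv k 1 false).
    rewrite /copy_mom labE /base_gen /base_inv; case: s {mcE}.
      by rewrite (nhomD (dN l)) (nhomM (dN l)).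
    by rewrite bo_inv1_false (nhomD (dN l)) (nhomN (dN l)) !(nhomM (dN l)).
  rewrite cmE -[idm D _]/(dsum_in l (idm B s)) -(nhomM (dN l)) euler1 /mcomp.
  congr dsum_in; case: s {mcE cmE}.
    rewrite mulrDr -[bo_inv k 1 false]i1 !mulrA et !mul0r addr0.
    by rewrite mulrDr mulrA ee a1.
  have efa : idm B false * a0 = 0 by rewrite -a1 mulrA ef mul0r.
  by rewrite mulrDr mulrDl i1 i2 mulrDr ef add0r mulrA efa !mul0r add0r.
Qed.
End BaseStage.

(** * Fusing all the copies *)

Section AllStages.
Variables (k : fieldType) (n : nat) (n_gt0 : (0 < n)%N).
Local Notation L := ('I_n * bool)%type.
Local Notation c1 := (copy1 n_gt0).
Local Notation pairs := (fun l : 'I_n => [:: ((c1, false), (l, false));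
  ((c1, true), (l, true))]).

(** Induction on the number of copies left. A copy takes two fusions, one at each vertex, and
    between them the two counters differ; this is why [t] depends on the vertex. *)
Lemma fuse_seq_stage m (A : balg k L) (H : hdqp A) t x pv (ls : seq (L * L)) :
    (0 < m)%N -> (m <= n)%N -> (forall s, t s = m) ->
    fusion_stage c1 t x pv -> fusion_stage_hdqp c1 t x pv H ->
    ls = flatten [seq pairs l | l <- drop m (enum 'I_n)] ->
  forall H' : hdqp (fuse_seq ls A), is_fuse_seq_hdqp H H' ->
  exists t' x' pv', [/\ forall s, t' s = n, fusion_stage c1 t' x' pv'
    & fusion_stage_hdqp c1 t' x' pv' H'].
Proof.
have c1_0 : c1 = 0%N :> nat by [].
move=> m0 mn.
have [j jE] : exists j, (n - m)%N = j by exists (n - m)%N.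
elim: j m m0 mn jE A H t x pv ls => [|j IH] m m0 mn jE A H t x pv ls tm st hst lsE.
  have nm : m = n by apply/eqP; rewrite eqn_leq mn -subn_eq0 jE.
  rewrite lsE drop_oversize ?size_enum_ord ?nm //= => H' /= ->.
  by exists t, x, pv; split=> // s; rewrite tm nm.
have m_n : (m < n)%N by rewrite -subn_gt0 jE.
pose l := Ordinal m_n.
have dE : drop m (enum 'I_n) = l :: drop m.+1 (enum 'I_n).
  by rewrite (drop_nth l) ?size_enum_ord // -[m]/(nat_of_ord l) nth_ord_enum.
rewrite lsE dE /= => H' [H1 H1P [H2 H2P HP]].
have t0 s : (0 < t s)%N by rewrite tm.
have st1 := fusion_stage_step c1_0 t0 (tm false : t false = l) st.
have hst1 := fusion_stage_hdqp_step c1_0 t0 (tm false : t false = l) st hst H1P.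
pose t1 s := if s == false then (t s).+1 else t s.
have t10 s : (0 < t1 s)%N by rewrite /t1; case: ifP.
have t1t : t1 true = l by rewrite /t1 /= tm.
have st2 := fusion_stage_step c1_0 t10 t1t st1.
have hst2 := fusion_stage_hdqp_step c1_0 t10 t1t st1 hst1 H2P.
apply: (IH m.+1 _ _ _ _ _ _ _ _ _ _ st2 hst2 erefl H' HP) => //.
  by rewrite subnS jE.
by case; rewrite /t1 /= tm.
Qed.

Lemma A_fus_stage (H : hdqp (A_fus k n_gt0)) : is_A_fus_hdqp H ->
  exists t x pv, [/\ forall s, t s = n, fusion_stage c1 t x pv
    & fusion_stage_hdqp c1 t x pv H].
Proof.
case=> H1 [Hs [H1P HsP HP]].
have c1_0 : c1 = 0%N :> nat by [].
apply: (fuse_seq_stage (ltn0Sn 0) n_gt0 _ (base_stage k c1_0)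
  (base_stage_hdqp c1_0 H1P HsP) _ HP) => //.
rewrite /fus_pairs; congr (flatten (map _ _)).
have eE : enum 'I_n = c1 :: drop 1 (enum 'I_n).
  by rewrite -{1}[enum 'I_n]drop0 (drop_nth c1) ?size_enum_ord // -[X in nth _ _ X]c1_0
    nth_ord_enum.
have := enum_uniq 'I_n; move: (drop 1 _) eE => d eE.
rewrite eE /= => /andP[c1N _].
by apply/all_filterP/allP => l lE; apply: contraNneq c1N => <-.
Qed.
End AllStages.

(** * Brackets in the fused algebra *)

Section BilinearForms.
Variables (k : fieldType) (A : calgType k).
Implicit Types (x y : A).

Definition sym_tens x y : tens2 A := x ⊗ y + y ⊗ x.

Lemma sym_tensC x y : sym_tens x y = sym_tens y x.
Proof. exact: addrC. Qed.
Lemma flip_sym_tens x y : tflip (sym_tens x y) = sym_tens x y.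
Proof. by rewrite tflipD !tflip_pure addrC. Qed.
Lemma sym_tensBl x y z : sym_tens (x - y) z = sym_tens x z - sym_tens y z.
Proof. by rewrite /sym_tens ptensDl ptensNl ptensDr ptensNr addrACA -opprD. Qed.
Lemma sym_tensBr x y z : sym_tens x (y - z) = sym_tens x y - sym_tens x z.
Proof. by rewrite ![sym_tens x _]sym_tensC sym_tensBl. Qed.
Lemma sym_tens0l x : sym_tens 0 x = 0.
Proof. by rewrite /sym_tens ptens0l ptens0r addr0. Qed.
(** The common shape of the brackets between an element of type a and one of type b. It is additive
    in [x], so it passes to the differences c_l - u_(l-1). *)
Definition prod_tens (e1 e2 x y : A) : tens2 A := e1 ⊗ (x * y) + (y * x) ⊗ e2.

Lemma prod_tensBl e1 e2 x y z :
  prod_tens e1 e2 (x - y) z = prod_tens e1 e2 x z - prod_tens e1 e2 y z.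
Proof.
by rewrite /prod_tens mulrBl mulrBr ptensDr ptensNr ptensDl ptensNl addrACA -opprD.
Qed.
Lemma prod_tens0 e1 e2 x : prod_tens e1 e2 0 x = 0.
Proof. by rewrite /prod_tens mul0r mulr0 ptens0l ptens0r addr0. Qed.
End BilinearForms.

(** The formula D(x^-1) = - x^-1 D(x) x^-1, in a corner. *)
Lemma dder_invE (k : fieldType) (A B : calgType k) (f : A -> B) D x z e :
  is_dder f D -> {morph f : a b / a * b} -> corner_inv e x z -> D e = 0 ->
  D z = - outer (f z) (f z) (D x).
Proof.
move=> Dd fM [xz zx ez _] De.
have /(congr1 (outer (f z) 1)) := dderM Dd x z.
rewrite xz De outer0 outerD !outer_outer mulr1 mul1r -fM zx.
have -> : outer (f e) 1 (D z) = D z.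
  by rewrite -[in RHS]ez (dderM Dd) De outer0 add0r.
by move/esym/eqP; rewrite addrC addr_eq0 => /eqP.
Qed.

Lemma sgz_subz_lt (R : pzRingType) (i j : nat) : (i < j)%N ->
  (sgz (i%:Z - j%:Z))%:~R = -1 :> R.
Proof. by move=> ij; rewrite ltr0_sgz // subr_lt0 ltz_nat. Qed.
Lemma sgz_subz_gt (R : pzRingType) (i j : nat) : (j < i)%N ->
  (sgz (i%:Z - j%:Z))%:~R = 1 :> R.
Proof. by move=> ij; rewrite gtr0_sgz // subr_gt0 ltz_nat. Qed.

(** * Brackets of c_l, u_l and d_l, then of the images of a_l and b_l *)

Section FusedBrackets.
Variables (k : fieldType) (n : nat) (I : finType) (A : balg k I).
Variables (d : A -> A -> tens2 A) (lb : bool -> I).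
Variables (x : 'I_n * bool -> A) (pv : 'I_n -> A).
Local Notation half := (2%:R^-1 : k).
Hypothesis dP : is_double_bracket d.
Hypothesis half2 : half + half = 1.
Let e s := idm A (lb s).
Hypothesis lb_inj : lb false != lb true.
Hypothesis xl : forall p, e p.2 * x p = x p.
Hypothesis xr : forall p, x p * e (~~ p.2) = x p.
Hypothesis pvP : forall l, corner_inv (e true) (e true +
  x (l, true) * x (l, false)) (pv l).
Hypothesis br_xx : forall p, d (x p) (x p) = 0.
Hypothesis br_cd : forall l, d (x (l, true)) (x (l, false)) =
  half *: prod_tens (e false) (e true) (x (l, true)) (x (l, false)) +
    e false ⊗ e true.
Hypothesis br_lt1 : forall (i l : 'I_n) s, (i < l)%N ->
  d (x (i, s)) (x (l, s)) = - (half *: sym_tens (x (i, s)) (x (l, s))).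
Hypothesis br_lt2 : forall (i l : 'I_n) s, (i < l)%N ->
  d (x (i, s)) (x (l, ~~ s)) =
    half *: ((x (l, ~~ s) * x (i, s)) ⊗ e s +
      e (~~ s) ⊗ (x (i, s) * x (l, ~~ s))).

Let halfD (v : tens2 A) : half *: v + half *: v = v.
Proof. by rewrite -scalerDl half2 scale1r. Qed.

Let ee s : e s * e s = e s. Proof. by rewrite /e idm_mul eqxx. Qed.
Let eo s : e s * e (~~ s) = 0.
Proof.
rewrite /e idm_mul; case: s => /=; last by rewrite (negPf lb_inj).
by rewrite eq_sym (negPf lb_inj).
Qed.
Let eo' s : e (~~ s) * e s = 0.
Proof. by have := eo (~~ s); rewrite negbK. Qed.

Let cor s y := e s * y = y /\ y * e (~~ s) = y.
(* If y = x_(l, s), the derivation {y, -} is inner on the other copies, equal to *)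
(* the commutator with w (+- 1/2) y s.  It then suffices to check this on the *)
(* generators of a copy to obtain it on their inverses. *)
Let w (h : k) y s : tens2 A := h *: (e (~~ s) ⊗ y - y ⊗ e s).

Let corM0 s y z : cor s y -> cor s z -> y * z = 0.
Proof. by move=> [_ <-] [<- _]; rewrite mulrA -[y * _ * _]mulrA eo' mulr0 mul0r. Qed.
Let cor_e0 s y : cor s y -> e (~~ s) * y = 0 /\ y * e s = 0.
Proof. by move=> [yl yr]; rewrite -{1}yl -{2}yr mulrA eo' mul0r -mulrA eo' mulr0. Qed.

Let comm_same h s y z : cor s y -> cor s z ->
  comm_dder id (w h y s) z = h *: sym_tens z y.
Proof.
move=> cy cz; rewrite /comm_dder /w !outerZ !outerD !outerN !outer_pure.
rewrite !mul1r !mulr1 (corM0 cz cy) (corM0 cy cz) cz.2 cz.1.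
by rewrite ptens0l ptens0r oppr0 addr0 add0r scalerN opprK -scalerDr.
Qed.

Let comm_opp h s y z : cor s y -> cor (~~ s) z ->
  comm_dder id (w h y s) z = - (h *: ((z * y) ⊗ e s + e (~~ s) ⊗ (y * z))).
Proof.
move=> cy cz; rewrite /comm_dder /w !outerZ !outerD !outerN !outer_pure.
have [z1 z2] := cor_e0 cz; rewrite negbK in z1.
rewrite !mul1r !mulr1 z1 z2 ptens0l ptens0r oppr0 addr0 add0r.
by rewrite scalerN -opprD -scalerDr.
Qed.

Let comm_e h s y r : cor s y -> comm_dder id (w h y s) (e r) = 0.
Proof.
move=> cy; have [y1 y2] := cor_e0 cy.
rewrite /comm_dder /w !outerZ !outerD !outerN !outer_pure !mul1r !mulr1.
have [->|->] : r = s \/ r = ~~ s by case: r; case: (s); [left|right|right|left].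
  by rewrite eo ee cy.1 y2 ptens0l ptens0r subrr.
by rewrite ee eo y1 cy.2 ptens0l ptens0r subrr.
Qed.

(** Exchanging the two elements changes only the sign of [h]: an inner expression for the bracket in
    one argument can be read as one in the other. *)
Let flip_comm h s r y z : cor s y -> cor r z ->
  - tflip (comm_dder id (w h y s) z) = comm_dder id (w (- h) z r) y.
Proof.
move=> cy cz; have [E|E] : r = s \/ r = ~~ s.
    by case: (r); case: (s); [left|right|right|left].
  rewrite E in cz *; rewrite !comm_same // tflipZ flip_sym_tens scaleNr sym_tensC.
  by [].
rewrite E in cz *; have cy' : cor (~~ ~~ s) y by rewrite negbK.
rewrite (comm_opp h cy cz) (comm_opp (- h) cz cy') negbK.
by rewrite tflipN tflipZ tflipD !tflip_pure opprK scaleNr opprK addrC.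
Qed.

Let xc p : cor p.2 (x p). Proof. by split; [exact: xl|exact: xr]. Qed.

Let u l := pv l * x (l, true).

Let uc l : cor true (u l).
Proof.
have [_ _ zl _] := pvP l.
by split; rewrite /u ?mulrA ?zl // -mulrA (xr (l, true)).
Qed.

(** Two double derivations that agree on c_l and d_l agree on P_l = e_2 + c_l d_l, hence on its
    inverse, hence on u_l. *)
Let comm_u h s y l : cor s y ->
  (forall r, d y (x (l, r)) = comm_dder id (w h y s) (x (l, r))) ->
  d y (u l) = comm_dder id (w h y s) (u l).
Proof.
move=> cy dyx.
have Dd := br_dder dP y.
have Dd' := comm_dderP (w h y s) (id_lin A) (fun _ _ => erefl).
have De r : d y (e r) = comm_dder id (w h y s) (e r) by
  rewrite (br_idmr dP) comm_e.
have [xz zx ez _] := pvP l.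
apply: (dder_eqM Dd Dd') => //.
apply: (dder_eq_inv Dd Dd' _ xz zx ez) => //.
by apply: (dder_eqD Dd Dd') => //; apply: (dder_eqM Dd Dd').
Qed.

Let sg (l i : 'I_n) : k := if (i < l)%N then half else - half.
Let sgN l i : l != i -> - sg l i = sg i l.
Proof. by rewrite -val_eqE /sg /=; case: ltngtP; rewrite ?opprK. Qed.

Let br_x p q : p.1 != q.1 ->
  d (x p) (x q) = comm_dder id (w (sg p.1 q.1) (x p) p.2) (x q).
Proof.
wlog pq : p q / (p.1 < q.1)%N => [IH|].
  move=> pq; have := pq; rewrite -val_eqE neq_ltn => /orP[lt|lt];
    first exact: IH.
  by rewrite (brC dP) IH // 1?eq_sym // (flip_comm _ (xc q) (xc p)) sgN // eq_sym.
move=> _; rewrite /sg ltnNge ltnW //=.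
case: p q pq => l s [i r] /= li.
have [E|E] : r = s \/ r = ~~ s.
    by case: (r); case: (s); [left|right|right|left].
  rewrite E (comm_same _ (xc (l, s)) (xc (i, s))) br_lt1 // scaleNr sym_tensC.
  by [].
rewrite E (comm_opp _ (xc (l, s)) (xc (i, ~~ s))) br_lt2 // scaleNr opprK.
by [].
Qed.

Let br_xu p l : p.1 != l -> d (x p) (u l) =
  comm_dder id (w (sg p.1 l) (x p) p.2) (u l).
Proof. by move=> pl; apply: (comm_u (xc p)) => r; apply: br_x. Qed.

Let br_ux p l : p.1 != l -> d (u l) (x p) =
  comm_dder id (w (sg l p.1) (u l) true) (x p).
Proof.
by move=> pl; rewrite (brC dP) br_xu // (flip_comm _ (xc p) (uc l)) sgN.
Qed.

(** A second use of [comm_u], now deriving by u_i: antisymmetry has put the brackets with u_i in the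
    same inner form. *)
Let br_uu i l : i != l -> d (u i) (u l) =
  comm_dder id (w (sg i l) (u i) true) (u l).
Proof.
by move=> il; apply: (comm_u (uc i)) => r; apply: br_ux; rewrite eq_sym.
Qed.

Section SameCopy.
Variable l : 'I_n.
Let c := x (l, true).
Let dd := x (l, false).
Let z := pv l.
Let P := e true + c * dd.
Let ul := u l.

Let Pz : P * z = e true. Proof. by case: (pvP l). Qed.
Let zP : z * P = e true. Proof. by case: (pvP l). Qed.
Let ez : e true * z = z. Proof. by case: (pvP l). Qed.
Let ze : z * e true = z. Proof. by case: (pvP l). Qed.
Let cl : e true * c = c. Proof. exact: (xl (l, true)). Qed.
Let cr : c * e false = c. Proof. exact: (xr (l, true)). Qed.
Let dl : e false * dd = dd. Proof. exact: (xl (l, false)). Qed.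
Let dr : dd * e true = dd. Proof. exact: (xr (l, false)). Qed.
Let Pu : P * ul = c. Proof. by rewrite /ul /u mulrA Pz cl. Qed.
Let zE : z = e true - ul * dd.
Proof. by rewrite -{1}zP mulrDr ze mulrA addrK. Qed.
Let dzc : dd * z * c = dd * ul. Proof. by rewrite mulrA. Qed.

(** The constant term of {c, d} contributes c (x) e_2; its two halves complete c d to P in each of
    the two summands. *)
Let br_cP : d c P = half *: (c ⊗ P + (P * c) ⊗ e true).
Proof.
rewrite /P (brDr dP) (br_idmr dP) add0r (brMr dP) br_xx outer0 add0r br_cd.
rewrite outerD outerZ outerD !outer_pure !mulr1 cr -/c -/dd mulrDl cl ptensDl ptensDr.
by rewrite addrACA !scalerDr halfD -!mulrA [RHS]addrC.
Qed.

Let br_cz : d c z = - (half *: (ul ⊗ e true + c ⊗ z)).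
Proof.
rewrite (dder_invE (br_dder dP c) _ (pvP l)) ?(br_idmr dP) // br_cP.
by rewrite outerZ outerD !outer_pure Pz mulrA zP cl ez.
Qed.

Let br_cu : d c ul = - (half *: sym_tens c ul).
Proof.
rewrite /ul /u (brMr dP) br_xx outer0 addr0 br_cz outerN outerZ outerD !outer_pure.
by rewrite !mul1r cl addrC.
Qed.

Let br_dc : d dd c = - (half *: ((c * dd) ⊗ e false + e true ⊗ (dd * c)))
  - e true ⊗ e false.
Proof.
by rewrite (brC dP) br_cd tflipD tflipZ tflipD !tflip_pure opprD.
Qed.

Let br_dP : d dd P = - (half *: (P ⊗ dd + e true ⊗ (dd * P))).
Proof.
rewrite /P (brDr dP) (br_idmr dP) add0r (brMr dP) br_xx outer0 addr0 br_dc.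
rewrite outerD !outerN outerZ outerD !outer_pure !mul1r dl mulrDr dr ptensDl ptensDr.
by rewrite addrACA !scalerDr halfD -opprD -!mulrA [in RHS]addrC.
Qed.

Let br_dz : d dd z = half *: (e true ⊗ (dd * z) + z ⊗ dd).
Proof.
rewrite (dder_invE (br_dder dP dd) _ (pvP l)) ?(br_idmr dP) // br_dP.
by rewrite outerN opprK outerZ outerD !outer_pure zP ze -mulrA Pz dr.
Qed.

(** The Leibniz rule leaves - z (x) e_1. Substituting z = e_2 - u d isolates the constant - e_2 (x)
    e_1 and reverses the sign of the half-term in u d. *)
Let br_du : d dd ul = half *: (e true ⊗ (dd * ul) + (ul * dd) ⊗ e false)
  - e true ⊗ e false.
Proof.
rewrite {1}/ul /u (brMr dP) br_dz br_dc outerZ !outerD !outerN outerZ !outerD !outer_pure.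
rewrite !mulr1 !mul1r ze mulrA -/ul dzc.
have -> : z ⊗ e false = e true ⊗ e false - (ul * dd) ⊗ e false.
  by rewrite {1}zE ptensDl ptensNl.
rewrite !scalerDr opprD !opprD opprK -/c -/(u l) -/ul.
rewrite -[in X in _ + (_ + X)](halfD ((ul * dd) ⊗ e false)).
rewrite [- (_ *: _) - _]addrC -!addrA; congr (_ + _); rewrite addNKr.
by rewrite addrCA addKr addrC.
Qed.

Let br_ud : d ul dd = - (half *: prod_tens (e false) (e true) ul dd)
  + e false ⊗ e true.
Proof.
rewrite (brC dP) br_du tflipD tflipN tflipZ tflipD !tflip_pure opprD opprK.
by rewrite /prod_tens addrC [in RHS]addrC; congr (_ - _ *: _); rewrite addrC.
Qed.

Let br_uc : d ul c = half *: sym_tens c ul.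
Proof. by rewrite (brC dP) br_cu tflipN tflipZ flip_sym_tens opprK. Qed.

(** The relation P u = c gives c d u = c - u, which eliminates the mixed terms. *)
Let br_uP : d ul P = half *: (ul ⊗ P + c ⊗ e true).
Proof.
rewrite /P (brDr dP) (br_idmr dP) add0r (brMr dP) br_uc br_ud.
rewrite outerD outerN !outerZ !outerD !outer_pure !mulr1 !mul1r cr ptensDr.
have -> : c * (dd * ul) = c - ul.
  have cE : c = ul + c * (dd * ul) by rewrite -{1}Pu mulrDl (uc l).1 mulrA.
  by rewrite {2}cE addrAC subrr add0r.
rewrite ptensDl ptensNl -[X in _ + (_ + X)](halfD (c ⊗ e true)).
rewrite !scalerDr !scalerN !opprD opprK [half *: _ +
  half *: (ul ⊗ _)]addrC -!addrA addNKr.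
rewrite [- _ + (_ + _)]addrCA addKr addrCA; congr (_ + _).
Qed.

Let br_uz : d ul z = - (half *: ((z * ul) ⊗ e true + ul ⊗ z)).
Proof.
rewrite (dder_invE (br_dder dP ul) _ (pvP l)) ?(br_idmr dP) // br_uP.
by rewrite outerZ outerD !outer_pure Pz ez.
Qed.

Let br_ulul : d ul ul = 0.
Proof.
rewrite {2}/ul /u (brMr dP) br_uz br_uc outerN !outerZ !outerD !outer_pure.
by rewrite !mul1r !mulr1 cl [in X in _ + X]addrC addNr.
Qed.

Lemma br_same_copy :
  [/\ d c ul = - (half *: sym_tens c ul), d ul ul = 0
    & d ul dd = - (half *: prod_tens (e false) (e true) ul dd) +
      e false ⊗ e true].
Proof. by split; [exact: br_cu|exact: br_ulul|exact: br_ud]. Qed.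
End SameCopy.

Let c l := x (l, true).
Let b l := x (l, false).
Definition prev_u (i : 'I_n) : A := if (0 < i)%N then u (pred_ord i) else 0.
Definition boalch_a (i : 'I_n) : A := c i - prev_u i.

Let br_cc (i j : 'I_n) : (i < j)%N -> d (c i) (c j) =
  - (half *: sym_tens (c i) (c j)).
Proof. exact: br_lt1. Qed.
Let neq_lt (i j : 'I_n) : (i < j)%N -> i != j.
Proof. by rewrite -val_eqE neq_ltn => ->. Qed.
Let sg_lt (i j : 'I_n) : (i < j)%N -> sg i j = - half.
Proof. by move=> ij; rewrite /sg ltnNge (ltnW ij). Qed.
Let sg_gt (i j : 'I_n) : (j < i)%N -> sg i j = half.
Proof. by rewrite /sg => ->. Qed.

Let br_cu_lt (i j : 'I_n) : (i < j)%N ->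
  d (c i) (u j) = - (half *: sym_tens (c i) (u j)).
Proof.
move=> ij; rewrite br_xu ?neq_lt // (comm_same _ (xc (i, true)) (uc j)).
by rewrite sg_lt // scaleNr sym_tensC.
Qed.
Let br_uc_lt (i j : 'I_n) : (i < j)%N ->
  d (u i) (c j) = - (half *: sym_tens (u i) (c j)).
Proof.
move=> ij; rewrite br_ux 1?eq_sym ?neq_lt // (comm_same _ (uc i) (xc (j, true))).
by rewrite sg_lt // scaleNr sym_tensC.
Qed.
Let br_uu_lt (i j : 'I_n) : (i < j)%N ->
  d (u i) (u j) = - (half *: sym_tens (u i) (u j)).
Proof.
move=> ij; rewrite br_uu ?neq_lt // (comm_same _ (uc i) (uc j)).
by rewrite sg_lt // scaleNr sym_tensC.
Qed.

Let br_c_pu (i j : 'I_n) : (i < j)%N ->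
  d (c i) (prev_u j) = - (half *: sym_tens (c i) (prev_u j)).
Proof.
move=> ij; rewrite /prev_u (leq_ltn_trans _ ij) //.
have : (i <= pred_ord j)%N by rewrite -ltnS pred_ordK // (leq_ltn_trans _ ij).
(* When [j] follows [i] immediately, both elements come from the same copy and [br_same_copy] is
   needed. *)
rewrite leq_eqVlt => /orP[/eqP/val_inj ->|]; last exact: br_cu_lt.
by have [-> _ _] := br_same_copy (pred_ord j).
Qed.
Let br_pu_c (i j : 'I_n) : (i <= j)%N ->
  d (prev_u i) (c j) = - (half *: sym_tens (prev_u i) (c j)).
Proof.
move=> ij; rewrite /prev_u; case: ifP => i0; last first.
  by rewrite (br0l dP) sym_tens0l scaler0 oppr0.
by apply: br_uc_lt; rewrite -ltnS pred_ordK.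
Qed.
Let br_pu_pu (i j : 'I_n) : (i < j)%N ->
  d (prev_u i) (prev_u j) = - (half *: sym_tens (prev_u i) (prev_u j)).
Proof.
move=> ij; rewrite /prev_u; case: ifP => i0; last first.
  by rewrite (br0l dP) sym_tens0l scaler0 oppr0.
rewrite (leq_ltn_trans _ ij) //; apply: br_uu_lt.
by rewrite -ltnS !pred_ordK // (leq_ltn_trans _ ij).
Qed.

Let br_aa_lt (i j : 'I_n) : (i < j)%N ->
  d (boalch_a i) (boalch_a j) = - (half *: sym_tens (boalch_a i) (boalch_a j)).
Proof.
move=> ij; rewrite /boalch_a !(brDl dP) !(brNl dP) !(brDr dP) !(brNr dP).
rewrite (br_cc ij) (br_c_pu ij) (br_pu_c (ltnW ij)) (br_pu_pu ij).
rewrite sym_tensBl !sym_tensBr.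
move: (sym_tens (c i) (c j)) (sym_tens (c i) (prev_u j)) => S1 S2.
move: (sym_tens (prev_u i) (c j)) (sym_tens (prev_u i) (prev_u j)) => S3 S4.
by rewrite !scalerBr !opprD !opprK.
Qed.

(** For i = j the two cross terms cancel, because the bracket of u_(j-1) with c_j is a multiple of a
    tensor fixed by the flip. *)
Lemma br_aa (i j : 'I_n) : d (boalch_a i) (boalch_a j) =
  (half * (sgz (i%:Z - j%:Z))%:~R) *: sym_tens (boalch_a i) (boalch_a j).
Proof.
case: (ltngtP i j) => [ij|ij|/val_inj ->].
- by rewrite (br_aa_lt ij) (sgz_subz_lt _ ij) mulrN1 scaleNr.
- rewrite (brC dP) (br_aa_lt ij) tflipN tflipZ flip_sym_tens opprK (sgz_subz_gt _ ij).
  by rewrite mulr1 sym_tensC.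
rewrite subrr sgz0 mulr0 scale0r /boalch_a !(brDl dP) !(brNl dP) !(brDr dP) !(brNr dP).
have -> : d (c j) (c j) = 0 by exact: br_xx.
have -> : d (prev_u j) (prev_u j) = 0.
  rewrite /prev_u; case: ifP => _; last exact: br0l.
  by have [_ -> _] := br_same_copy (pred_ord j).
rewrite [d (c j) (prev_u j)](brC dP) (br_pu_c (leqnn j)) tflipN tflipZ flip_sym_tens.
by rewrite opprK subr0 sub0r opprK addNr.
Qed.

Lemma br_bb (i j : 'I_n) : d (b i) (b j) =
  (half * (sgz (i%:Z - j%:Z))%:~R) *: sym_tens (b i) (b j).
Proof.
case: (ltngtP i j) => [ij|ij|/val_inj ->].
- by rewrite (br_lt1 _ ij) (sgz_subz_lt _ ij) mulrN1 scaleNr.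
- rewrite (brC dP) (br_lt1 _ ij) tflipN tflipZ flip_sym_tens opprK (sgz_subz_gt _ ij).
  by rewrite mulr1 sym_tensC.
by rewrite subrr sgz0 mulr0 scale0r br_xx.
Qed.

Local Notation T := (prod_tens (e false) (e true)).

Let br_cb_lt (i j : 'I_n) : (i < j)%N -> d (c i) (b j) = half *: T (c i) (b j).
Proof. by move=> ij; rewrite (br_lt2 true) // addrC. Qed.
Let br_cb_gt (i j : 'I_n) : (j < i)%N ->
  d (c i) (b j) = - (half *: T (c i) (b j)).
Proof.
move=> ij; rewrite (brC dP) (br_lt2 false) // tflipZ tflipD !tflip_pure.
by [].
Qed.
Let br_ub (i j : 'I_n) : i != j -> d (u i) (b j) = - (sg i j *: T (u i) (b j)).
Proof.
move=> ij; rewrite br_ux 1?eq_sym // (comm_opp _ (uc i) (xc (j, false))).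
by rewrite addrC.
Qed.

Lemma br_ab (i j : 'I_n) : d (boalch_a i) (b j) =
  if (i < j)%N then half *: T (boalch_a i) (b j)
  else if i == j then half *: T (boalch_a i) (b j) + e false ⊗ e true
  else - (half *: T (boalch_a i) (b j))
       - (if (i == j.+1 :> nat) then e false ⊗ e true else 0).
Proof.
(* The copy of [prev_u i] strictly precedes [j] even for [i = j], so on the diagonal the constant
   term comes from the bracket of c_j with d_j alone. *)
have pu_lt : (i <= j)%N -> d (prev_u i) (b j) = half *: T (prev_u i) (b j).
  move=> ij; rewrite /prev_u; case: ifP => i0; last first.
    by rewrite (br0l dP) prod_tens0 scaler0.
  have pij : (pred_ord i < j)%N by rewrite -ltnS pred_ordK.
  by rewrite br_ub ?neq_lt // sg_lt // scaleNr opprK.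
rewrite {1}/boalch_a (brDl dP) (brNl dP).
have TB : T (boalch_a i) (b j) = T (c i) (b j) - T (prev_u i) (b j).
  exact: prod_tensBl.
rewrite TB scalerBr; case: (ltngtP i j) => [ij|ij|/val_inj ij].
- by rewrite (br_cb_lt ij) (pu_lt (ltnW ij)).
- rewrite (br_cb_gt ij) -val_eqE (gtn_eqF ij) opprB.
  have i0 : (0 < i)%N by apply: leq_ltn_trans ij.
  have pE : (pred_ord i).+1 = i by rewrite pred_ordK.
  rewrite /prev_u i0 -[X in X == _.+1]pE eqSS.
  have [pj|pj] := eqVneq (nat_of_ord (pred_ord i)) j.
    have -> : pred_ord i = j by apply: val_inj.
    have [_ _ ->] := br_same_copy j.
    by rewrite opprD opprK addrA [- _ + _]addrC.
  rewrite br_ub //; rewrite sg_gt ?opprK ?subr0 1?addrC //.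
  by rewrite ltn_neqAle eq_sym pj -ltnS pE.
- rewrite pu_lt ?ij // eqxx br_cd addrAC.
  by [].
Qed.
End FusedBrackets.

(** * Continuants as products *)

Section ContinuantCorners.
Variables (k : fieldType) (n : nat) (A : balg k bool) (a b : 'I_n -> A).
Hypotheses (al : forall i, idm A true * a i = a i)
  (ar : forall i, a i * idm A false = a i)
  (bl : forall i, idm A false * b i = b i)
  (br : forall i, b i * idm A true = b i).

Lemma ord_nat_ind (P : nat -> Prop) :
  P 0%N -> (forall i : 'I_n, P i -> P i.+1) -> forall m, (m <= n)%N -> P m.
Proof.
move=> P0 PS; elim=> // m IH mn; exact: (PS (Ordinal mn)) (IH (ltnW mn)).
Qed.

Lemma continuant_corner m : (m <= n)%N ->
  [/\ idm A true * Fc a b m = Fc a b m, Fc a b m * idm A true = Fc a b m,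
      idm A true * Xc a b m = Xc a b m & Xc a b m * idm A false = Xc a b m].
Proof.
move: m; apply: ord_nat_ind => [|i [F1 F2 X1 X2]].
  by rewrite /= idm_mul eqxx mulr0 mul0r.
have X1' : idm A true * Xc a b i.+1 = Xc a b i.+1.
  by rewrite Xc_rec // mulrDr mulrA F1 X1.
have X2' : Xc a b i.+1 * idm A false = Xc a b i.+1.
  by rewrite Xc_rec // mulrDl -mulrA ar X2.
split=> //; first by rewrite Fc_rec mulrDr mulrA X1' F1.
by rewrite Fc_rec mulrDl -mulrA br F2.
Qed.
End ContinuantCorners.

Lemma Fc_hom (k : fieldType) (n : nat) (A A' : balg k bool)
    (f : A -> A') (a b : 'I_n -> A) m :
  is_nhom f -> f 1 = 1 -> (forall s, f (idm A s) = idm A' s) ->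
  f (Fc a b m) = Fc (f \o a) (f \o b) m.
Proof. by move=> fP f1 fe; case: m => [|m]; [exact: fe|exact: euler_hom]. Qed.

Lemma Xc_hom (k : fieldType) (n : nat) (A A' : balg k bool)
    (f : A -> A') (a b : 'I_n -> A) m :
  is_nhom f -> f 1 = 1 -> (forall s, f (idm A s) = idm A' s) ->
  f (Xc a b m) = Xc (f \o a) (f \o b) m.
Proof.
by move=> fP f1 fe; case: m => [|m]; [exact: nhom0|exact: rcontinuant_hom].
Qed.

Section EulerProducts.
Variables (k : fieldType) (n : nat) (A : balg k bool).
Variables (x : 'I_n * bool -> A) (pv : 'I_n -> A).
Local Notation e := (idm A).
Hypothesis xl : forall p, e p.2 * x p = x p.
Hypothesis xr : forall p, x p * e (~~ p.2) = x p.
Hypothesis pvP : forall l, corner_inv (e true) (e true +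
  x (l, true) * x (l, false)) (pv l).

Let c l := x (l, true).
Let b l := x (l, false).
Let a := boalch_a x pv.
Let P l := e true + c l * b l.
Let Q l := e false + b l * c l.
(** The inverse of e_1 + d c given by [corner_inv_swap]. *)
Definition copy_invQ l : A := e false - b l * pv l * c l.

Let cl l : e true * c l = c l. Proof. exact: (xl (l, true)). Qed.
Let cr l : c l * e false = c l. Proof. exact: (xr (l, true)). Qed.
Let bl l : e false * b l = b l. Proof. exact: (xl (l, false)). Qed.
Let br l : b l * e true = b l. Proof. exact: (xr (l, false)). Qed.
Let ee s : e s * e s = e s. Proof. by rewrite idm_mul eqxx. Qed.

Lemma boalch_a_corner i : e true * a i = a i /\ a i * e false = a i.
Proof.
rewrite /a /boalch_a mulrBr mulrBl -/(c i) cl cr /prev_u; case: ifP => _.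
  have [_ _ zl _] := pvP (pred_ord i).
  by rewrite mulrA zl -mulrA -/(c _) cr.
by rewrite mulr0 mul0r.
Qed.

Let al i : e true * a i = a i. Proof. by case: (boalch_a_corner i). Qed.
Let ar i : a i * e false = a i. Proof. by case: (boalch_a_corner i). Qed.

(** The final idempotent makes the empty product the unit of the corner rather than 1. *)
Let PF m := \prod_(l <- take m (enum 'I_n)) P l * e true.
Let QG m := \prod_(l <- rev (take m (enum 'I_n))) Q l * e false.
Let RG m := \prod_(l <- take m (enum 'I_n)) copy_invQ l * e false.

Let Pl l : e true * P l = P l. Proof. by rewrite /P mulrDr mulrA cl ee. Qed.
Let Pr l : P l * e true = P l. Proof. by rewrite /P mulrDl -mulrA br ee. Qed.
Let Ql l : e false * Q l = Q l. Proof. by rewrite /Q mulrDr mulrA bl ee. Qed.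
Let QP l : corner_inv (e false) (Q l) (copy_invQ l).
Proof. exact: corner_inv_swap (ee false) (cl l) (cr l) (bl l) (br l) (pvP l). Qed.
Let iQr l : copy_invQ l * e false = copy_invQ l. Proof. by case: (QP l). Qed.
Let iQl l : e false * copy_invQ l = copy_invQ l. Proof. by case: (QP l). Qed.

Let PF0 : PF 0 = e true. Proof. by rewrite /PF take0 big_nil mul1r. Qed.
Let QG0 : QG 0 = e false. Proof. by rewrite /QG take0 big_nil mul1r. Qed.
Let RG0 : RG 0 = e false. Proof. by rewrite /RG take0 big_nil mul1r. Qed.
Let PFS (i : 'I_n) : PF i.+1 = PF i * P i.
Proof. by rewrite /PF take_enumS big_rcons /= -!mulrA Pl Pr. Qed.
Let QGS (i : 'I_n) : QG i.+1 = Q i * QG i.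
Proof. by rewrite /QG take_enumS rev_rcons big_cons mulrA. Qed.
Let RGS (i : 'I_n) : RG i.+1 = RG i * copy_invQ i.
Proof. by rewrite /RG take_enumS big_rcons /= -!mulrA iQl iQr. Qed.

(** The sum [Fc i * a i + Xc i] telescopes: [Fc i] ends in the factor P of the preceding copy, which
    cancels the P^-1 of [prev_u i], and what remains is [Xc i]. *)
Lemma continuant_prod m : (m <= n)%N ->
  Fc a b m = PF m /\ forall i : 'I_n, i.+1 = m -> Xc a b m = PF i * c i.
Proof.
move: m; apply: ord_nat_ind => [|i [FE XE]]; first by split; rewrite ?PF0.
have X' : Xc a b i.+1 = PF i * c i.
  rewrite Xc_rec // FE {1}/a /boalch_a mulrBr -addrA -[RHS]addr0; congr (_ + _).
  rewrite /prev_u; case: (posnP i) => [->|i0];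
    first by rewrite mulr0 oppr0 addr0.
  rewrite (XE (pred_ord i)) ?pred_ordK // -[in PF (nat_of_ord i)](pred_ordK i0) PFS.
  have [Pz _ _ _] := pvP (pred_ord i).
  by rewrite -mulrA [P _ * _]mulrA Pz -/(c _) cl addNr.
split=> [|j [/val_inj ->]] //; rewrite Fc_rec X' FE PFS /P mulrDr mulrA addrC.
by congr (_ + _); rewrite /PF -mulrA ee.
Qed.

(** The telescoping now rests on P^-1 c Q = c, that is on c Q = P c. *)
Lemma rev_continuant_prod m : (m <= n)%N ->
  Gc a b m = QG m /\ forall i : 'I_n, i.+1 = m -> Yc a b m = c i * QG i.
Proof.
move: m; apply: ord_nat_ind => [|i [GE YE]]; first by split; rewrite ?QG0.
have QGl : e false * QG i = QG i.
  case: (posnP i) => [->|i0]; first by rewrite QG0 ee.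
  by rewrite -(pred_ordK i0) QGS mulrA Ql.
have Y' : Yc a b i.+1 = c i * QG i.
  rewrite Yc_rec // GE {1}/a /boalch_a mulrBl -addrA -[RHS]addr0; congr (_ + _).
  rewrite /prev_u; case: (posnP i) => [->|i0];
    first by rewrite mul0r oppr0 addr0.
  rewrite (YE (pred_ord i)) ?pred_ordK // -[in QG (nat_of_ord i)](pred_ordK i0) QGS.
  have [_ zP _ ze] := pvP (pred_ord i).
  have uQ : pv (pred_ord i) * x (pred_ord i, true) * Q (pred_ord i) =
    c (pred_ord i).
    rewrite /Q mulrDr -[_ * x _ * e false]mulrA cr -!mulrA [c _ * (b _ * _)]mulrA -mulrDr.
    by rewrite -{1}[c _]cl -mulrDl mulrA zP cl.
  by rewrite mulrA uQ addNr.
split=> [|j [/val_inj ->]] //; rewrite Gc_rec // Y' GE QGS /Q mulrDl QGl mulrA.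
by rewrite addrC.
Qed.

Lemma continuant_prod_inv m : (m <= n)%N ->
  exists z, corner_inv (e true) (Fc a b m) z.
Proof.
move=> mn; have [-> _] := continuant_prod mn; move: m mn.
apply: ord_nat_ind => [|i [z zP]].
  by exists (e true); rewrite PF0; split; rewrite ee.
exists (pv i * z); rewrite PFS; apply: corner_invM => //.
  by rewrite /PF; case: (take _ _) => [|j r];
    rewrite ?big_nil ?mul1r ?ee // big_cons !mulrA Pl.
exact: pvP.
Qed.

(** The inverse is given explicitly, since for m = n it is the component of the moment map at
    e_1. *)
Lemma rev_continuant_prod_inv m : (m <= n)%N ->
  corner_inv (e false) (Gc a b m) (RG m).
Proof.
move=> mn; have [-> _] := rev_continuant_prod mn; move: m mn.
apply: ord_nat_ind => [|i zP].
  by rewrite QG0 RG0; split; rewrite ee.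
rewrite QGS RGS; apply: corner_invM => //.
by rewrite /QG; case: (rev _) => [|j r];
  rewrite ?big_nil ?mul1r ?ee // big_cons !mulrA Ql.
Qed.
End EulerProducts.

(** * Matrices *)

Section MatrixAlgebra.
Variables (k : fieldType) (R : calgType k) (N : nat).

Definition mx_in (c : k) : 'M[R]_N := (in_calg c)%:M.

Fact mx_inD : {morph mx_in : x y / x + y}.
Proof. by move=> x y; rewrite /mx_in in_calgD raddfD. Qed.
Fact mx_inM : {morph mx_in : x y / x * y}.
Proof. by move=> x y; rewrite /mx_in in_calgM scalar_mxM. Qed.
Fact mx_in1 : mx_in 1 = 1.
Proof. by rewrite /mx_in in_calg1. Qed.
Lemma mx_inE m c (M : 'M[R]_(N, m)) : mx_in c *m M =
  \matrix_(i, j) (in_calg c * M i j).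
Proof. by apply/matrixP => i j; rewrite mul_scalar_mx !mxE. Qed.
Lemma mx_inEr m c (M : 'M[R]_(m, N)) : M *m mx_in c =
  \matrix_(i, j) (in_calg c * M i j).
Proof.
by apply/matrixP => i j; rewrite /mx_in -diag_const_mx mul_mx_diag !mxE in_calgC.
Qed.
Fact mx_inC c x : mx_in c * x = x * mx_in c.
Proof. by rewrite -[LHS]/(_ *m _) -[RHS]/(_ *m _) mx_inE mx_inEr. Qed.

HB.instance Definition _ :=
  isCentralAlgebra.Build k 'M[R]_N mx_inD mx_inM mx_in1 mx_inC.
End MatrixAlgebra.

Section ElementaryMatrices.
Variables (k : fieldType) (R : calgType k) (T : finType).

Definition emx (v : R) (p q : T) : 'M[R]_#|T| :=
  \matrix_(i, j) (if (i == enum_rank p) && (j == enum_rank q) then v else 0).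

Lemma emxM v w p q q' r :
  emx v p q * emx w q' r = if q == q' then emx (v * w) p r else 0.
Proof.
apply/matrixP => i j; rewrite -[LHS]/((_ *m _) i j) mxE.
rewrite (bigD1 (enum_rank q)) //= big1 ?addr0 => [|l lq]; last first.
  by rewrite !mxE (negPf lq) andbF mul0r.
rewrite !mxE eqxx andbT (inj_eq enum_rank_inj).
have [_|_] := eqVneq q q'; rewrite ?mxE /=.
  by case: eqP => _; case: eqP => _ /=; rewrite ?mul0r ?mulr0.
by rewrite mulr0.
Qed.

Lemma emxD v w p q : emx (v + w) p q = emx v p q + emx w p q.
Proof. by apply/matrixP => i j; rewrite !mxE; case: ifP; rewrite ?addr0. Qed.

Lemma emx_corner_inv e x z p :
  corner_inv e x z -> corner_inv (emx e p p) (emx x p p) (emx z p p).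
Proof. by move=> [xz zx ez ze]; split; rewrite emxM eqxx ?xz ?zx ?ez ?ze. Qed.
End ElementaryMatrices.

Section Collapse.
Variables (k : fieldType) (R : balg k bool) (T : finType) (v : bool -> T).
Hypothesis v_inj : injective v.
Hypothesis vertsR : verts R = setT.
Local Notation f := (idm R).

Let row : 'rV[R]_#|T| := \row_j \sum_s (if j == enum_rank (v s) then f s else 0).
Let col : 'cV[R]_#|T| := \col_j \sum_s (if j == enum_rank (v s) then f s else 0).

(** With f_s placed at the index [v s], [row *m col] is 1 and [col *m row] is a diagonal idempotent
    E. The map identifies the corner at E of the matrix algebra with [R], the sum of the f_s R
    f_t. *)
Definition collapse (M : 'M[R]_#|T|) : R := (row *m M *m col) 0 0.

Let ff s t : f s * f t = if s == t then f s else 0. Proof. exact: idm_mul. Qed.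
Let f1 : \sum_s f s = 1.
Proof. by rewrite -(idm_sum R) vertsR; apply: eq_bigl => s;
  rewrite in_setT. Qed.

Let row_emx w p s t : p = v s -> row *m emx w p (v t) =
  \row_j (if j == enum_rank (v t) then f s * w else 0).
Proof.
move=> ->; apply/matrixP => i j; rewrite !mxE (bigD1 (enum_rank (v s))) //=.
rewrite big1 ?addr0 => [|l ls]; last by rewrite !mxE (negPf ls) mulr0.
rewrite !mxE eqxx /= (bigD1 s) //= eqxx big1 ?addr0 => [|u us]; last first.
  by rewrite (inj_eq enum_rank_inj) (inj_eq v_inj) eq_sym (negPf us).
by case: eqP => _; rewrite ?mulr0.
Qed.

Lemma collapse_emx w s t : collapse (emx w (v s) (v t)) = f s * w * f t.
Proof.
rewrite /collapse (row_emx _ _ erefl) !mxE (bigD1 (enum_rank (v t))) //=.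
rewrite big1 ?addr0 => [|l ls]; last by rewrite !mxE (negPf ls) mul0r.
rewrite !mxE eqxx (bigD1 t) //= eqxx big1 ?addr0 // => u us.
by rewrite (inj_eq enum_rank_inj) (inj_eq v_inj) eq_sym (negPf us).
Qed.

Let col_row : col *m row = \sum_s emx (f s) (v s) (v s).
Proof.
apply/matrixP => i j; rewrite !mxE big_ord1 !mxE summxE mulr_suml.
apply: eq_bigr => s _; rewrite !mxE mulr_sumr (bigD1 s) //= big1 ?addr0 =>
  [|u us].
  by do 2!case: eqP => _ /=; rewrite ?mul0r ?mulr0 // ff eqxx.
by do 2!case: ifP => _; rewrite ?mul0r ?mulr0 // ff eq_sym (negPf us).
Qed.

(** The product [col *m row] inserted between two images is [h 1], which they absorb; it also
    becomes the unit of [R]. *)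
Lemma collapse_nhom (A : calgType k) (h : A -> 'M[R]_#|T|) :
  is_nhom h -> h 1 = \sum_s emx (f s) (v s) (v s) ->
  is_nhom (collapse \o h) /\ (collapse \o h) 1 = 1.
Proof.
move=> hP h1.
have hM x y : row *m h x *m col *m (row *m h y *m col) =
  row *m h (x * y) *m col.
  have -> : h (x * y) = h x *m h 1 *m h y.
    by rewrite -[RHS]/(h x * h 1 * h y) -!(nhomM hP) mulr1.
  by rewrite h1 -col_row !mulmxA.
have h11 : (collapse \o h) 1 = 1.
  rewrite /= h1 -f1 /collapse mulmx_sumr mulmx_suml summxE;
    apply: eq_bigr => s _.
  by rewrite -/(collapse _) collapse_emx !ff eqxx ff eqxx.
split=> //; split=> [x y|x y|c].
- by rewrite /= /collapse (nhomD hP) mulmxDr mulmxDl mxE.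
- by rewrite /= /collapse -hM mxE big_ord1.
- rewrite /= (nhomC hP) /collapse -[in_calg c * _]/(mx_in _ _ c *m _).
  rewrite mulmxA mx_inEr.
  have -> : \matrix_(i, j) (in_calg c * row i j) = (in_calg c)%:M *m row.
    by apply/matrixP => i j; rewrite mul_scalar_mx !mxE.
  by rewrite -!mulmxA mul_scalar_mx mxE !mulmxA.
Qed.
End Collapse.

(** * The localised Boalch algebra *)

Section BoalchLoc.
Variables (k : fieldType) (n : nat).
Local Notation R := (boalch_loc k n).
Local Notation B := (boalch k n).

Lemma to_boalch_loc_nhom : is_nhom (@to_boalch_loc k n).
Proof.
by have /calg_hom_nhom[] := to_loc_hom (fun p : 'I_n.-1 * bool => p.2)
  (fun p => euler (@bo_a k n) (@bo_b k n) p.1.+1 p.2).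
Qed.

Definition loc_a (i : 'I_n) : R := to_boalch_loc (bo_a k i).
Definition loc_b (i : 'I_n) : R := to_boalch_loc (bo_b k i).

Lemma loc_a_corner i :
  idm R true * loc_a i = loc_a i /\ loc_a i * idm R false = loc_a i.
Proof.
by have [H1 H2] := bo_a_corner k i; rewrite -!(nhomM to_boalch_loc_nhom) H1 H2.
Qed.
Lemma loc_b_corner i :
  idm R false * loc_b i = loc_b i /\ loc_b i * idm R true = loc_b i.
Proof.
by have [H1 H2] := bo_b_corner k i; rewrite -!(nhomM to_boalch_loc_nhom) H1 H2.
Qed.

Lemma to_boalch_loc_euler m s :
  to_boalch_loc (euler (@bo_a k n) (@bo_b k n) m s) = euler loc_a loc_b m s.
Proof. by rewrite (euler_hom _ _ _ _ to_boalch_loc_nhom). Qed.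

Lemma loc_euler_inv m s : (0 < m)%N -> (m <= n)%N ->
  exists z, corner_inv (idm R s) (euler loc_a loc_b m s) z.
Proof.
move=> m0; rewrite leq_eqVlt => /orP[/eqP ->|mn].
  exists (to_boalch_loc (bo_inv k n s)); rewrite -to_boalch_loc_euler.
  exact: nhom_corner_inv to_boalch_loc_nhom (bo_invP k n s).
have mP : (m.-1 < n.-1)%N by rewrite -ltnS !prednK // (leq_ltn_trans _ mn).
have := loc_invK (fun p : 'I_n.-1 * bool => p.2)
  (fun p => euler (@bo_a k n) (@bo_b k n) p.1.+1 p.2) (Ordinal mP, s).
by rewrite [to_loc _ _ _]to_boalch_loc_euler /= prednK // => H; eexists;
  exact: H.
Qed.

(** Continuants being polynomials in the generators, the single clause on corner inverses covers
    those adjoined in the Boalch algebra and those of the further localisation. *)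
Lemma boalch_loc_ind (K : R -> Prop) :
    (forall c, K (in_calg c)) ->
    (forall y z, K y -> K z -> K (y + z)) ->
    (forall y z, K y -> K z -> K (y * z)) ->
    (forall s, K (idm R s)) -> (forall i, K (loc_a i)) ->
      (forall i, K (loc_b i)) ->
    (forall s y z, corner_inv (idm R s) y z -> K y -> K z) ->
  forall y, K y.
Proof.
move=> Kc KD KM Ke Ka Kb Ki.
have Krc w : K (rcontinuant loc_a loc_b w).
  have K1 : K 1 by rewrite -(in_calg1 (s := R)); apply: Kc.
  have Kl (y : letter n) : K (letter_val loc_a loc_b y) by case: y.
  have Kl' (y : letter n) : K (letter_idm R y) by case: y => i; apply: Ke.
  have [m] := ubnP (size w); elim: m w => // m IH [|y [|y1 [|y2 w]]] sw //;
    first exact: Kl.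
    by apply: (KD) => //; apply: KM.
  rewrite rcontinuant_cons3; apply: (KD); first by apply: (KM) => //; apply: IH.
  by apply: IH; apply: ltnW sw.
have Ke' m s : K (euler loc_a loc_b m s) by apply: Krc.
move=> y; elim/loc_ind: y => [y|p|//|//].
  elim/boalch_generated: y => [c|y z|y z|y].
  - exact: (Kc c).
  - by move=> Ky Kz; rewrite -/(to_boalch_loc (y +
    z)) (nhomD to_boalch_loc_nhom);
      apply: KD.
  - by move=> Ky Kz; rewrite -/(to_boalch_loc (y * z)) (nhomM to_boalch_loc_nhom);
      apply: KM.
  - case=> [[s ->]|[i ->]|[i ->]|[s ->]]; [exact: Ke|exact: Ka|exact: Kb|].
    apply: (Ki s (euler loc_a loc_b n s) _ _ (Ke' n s)).
    have := nhom_corner_inv to_boalch_loc_nhom (bo_invP k n s).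
    by rewrite to_boalch_loc_euler.
apply: (Ki p.2 (euler loc_a loc_b p.1.+1 p.2) _ _ (Ke' _ _)).
by rewrite -to_boalch_loc_euler; apply: loc_invK.
Qed.

(** A lift from the path algebra, extended through two localisations: invertibility for [m = n]
    serves the first, for [m < n] the second. *)
Lemma boalch_loc_lift (A : balg k bool) (a b : 'I_n -> A) : (0 < n)%N ->
    verts A = setT ->
    (forall i, idm A true * a i = a i /\ a i * idm A false = a i) ->
    (forall i, idm A false * b i = b i /\ b i * idm A true = b i) ->
    (forall m s, (0 < m)%N -> (m <= n)%N ->
       exists z, corner_inv (idm A s) (euler a b m s) z) ->
  exists h : R -> A, [/\ is_nhom h, h 1 = 1, forall s, h (idm R s) = idm A s,
    forall i, h (loc_a i) = a i & forall i, h (loc_b i) = b i].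
Proof.
move=> n0 vA ac bc inv.
have e1 : idm A true + idm A false = 1.
  by rewrite -(idm_sum A) vA (eq_bigl xpredT) => [|s];
    rewrite ?big_bool ?in_setT.
have [h0 [h0P h0e h0a h0b]] := path_lift (@idm_mul _ _ A) ac bc.
have E (B : balg k bool) (h : B -> A) (a' b' : 'I_n -> B) m s : is_nhom h ->
    (forall s, h (idm B s) = idm A s) -> verts B = setT ->
    (forall i, h (a' i) = a i) -> (forall i, h (b' i) = b i) ->
    h 1 = 1 /\ h (euler a' b' m s) = euler a b m s.
  move=> hP he vB ha hb.
  have h1 : h 1 = 1.
    rewrite -(idm_sum B) vB (eq_bigl xpredT) => [|r]; last by rewrite in_setT.
    by rewrite big_bool (nhomD hP) !he.
  split=> //; rewrite (euler_hom _ _ _ _ hP) //; congr (euler _ _ _ _);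
    exact: boolp.funext.
have [g gP] := boolp.choice (fun s => inv n s n0 (leqnn n)).
have [h1 [h1P h1x _]] : exists h : B -> A, [/\ is_nhom h,
    forall y, h (to_boalch y) = h0 y & forall s, h (bo_inv k n s) = g s].
  apply: boalch_lift => // s; rewrite h0e.
  by have [_ ->] := E _ h0 (@path_a_ k n) (@path_b_ k n) n s h0P h0e erefl h0a h0b.
have h1e s : h1 (idm B s) = idm A s by rewrite -h0e -h1x.
have h1a i : h1 (bo_a k i) = a i by rewrite -h0a -h1x.
have h1b i : h1 (bo_b k i) = b i by rewrite -h0b -h1x.
have inv' (p : 'I_n.-1 * bool) :
    exists z, corner_inv (idm A p.2) (euler a b p.1.+1 p.2) z.
  by apply: inv => //; apply: (leq_trans (ltn_ord p.1)); apply: leq_pred.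
have [g' g'P] := boolp.choice inv'.
have [h [hP hx _]] : exists h : R -> A, [/\ is_nhom h,
    forall y, h (to_boalch_loc y) = h1 y & forall p, h (loc_inv _ _ p) = g' p].
  apply: loc_lift => // p; rewrite h1e.
  by have [_ ->] := E _ h1 (@bo_a k n) (@bo_b k n) p.1.+1 p.2 h1P h1e erefl h1a h1b.
have he s : h (idm R s) = idm A s by rewrite -h1e -hx.
have ha i : h (loc_a i) = a i by rewrite -h1a -hx.
have hb i : h (loc_b i) = b i by rewrite -h1b -hx.
have [hh _] := E R h loc_a loc_b 0 true hP he erefl ha hb.
by exists h.
Qed.
End BoalchLoc.

(** * The isomorphism *)

Section FullyFused.
Variables (k : fieldType) (n : nat) (c1 : 'I_n).
Local Notation L := ('I_n * bool)%type.
Variables (A : balg k L) (t : bool -> nat) (x : L -> A) (pv : 'I_n -> A).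
Hypothesis tn : forall s, t s = n.
Hypothesis stA : fusion_stage c1 t x pv.

Let flE p : fused_lab c1 t p = (c1, p.2).
Proof. by rewrite /fused_lab tn ltn_ord. Qed.
Let labE p : lab c1 A t p = idm A (c1, p.2).
Proof. by rewrite /lab flE. Qed.

Lemma fused_verts : verts A = [set (c1, s) | s in [set: bool]].
Proof.
rewrite (st_verts stA); apply/setP => -[l s]; rewrite !inE tn leqNgt ltn_ord /=.
apply/eqP/imsetP => [->|[s' _ [-> _]] //]; exists s => //.
Qed.

Let idm_mul2 s s' : idm A (c1, s) * idm A (c1, s') =
  if s == s' then idm A (c1, s) else 0.
Proof. by rewrite idm_mul xpair_eqE eqxx. Qed.
Let idm_out2 s : s \notin [set: bool] -> idm A (c1, s) = 0.
Proof. by rewrite in_setT. Qed.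
Lemma fused_sum (F : L -> A) : \sum_(p in verts A) F p = \sum_s F (c1, s).
Proof.
rewrite fused_verts big_imset /= => [|s s' _ _ [->] //].
by apply: eq_bigl => s; rewrite in_setT.
Qed.
Let idm_sum2 : \sum_(s in [set: bool]) idm A (c1, s) = 1.
Proof.
rewrite -(idm_sum A) fused_sum; apply: eq_bigl => s; exact: in_setT.
Qed.

(* Only two idempotents remain; they are relabelled by bool because continuants *)
(* are defined over algebras with labels in bool. *)
Definition fused_balg : balg k bool := BAlg idm_mul2 idm_out2 idm_sum2.

Local Notation A2 := fused_balg.
Local Notation R := (boalch_loc k n).
Let a : 'I_n -> A2 := boalch_a x pv.
Let b (l : 'I_n) : A2 := x (l, false).
Let c (l : 'I_n) : A2 := x (l, true).

Lemma fused_xl p : idm A2 p.2 * x p = x p.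
Proof. by have := st_xl stA p; rewrite labE. Qed.
Lemma fused_xr p : x p * idm A2 (~~ p.2) = x p.
Proof. by have := st_xr stA p; rewrite labE. Qed.
Lemma fused_pv l : corner_inv (idm A2 true)
  (idm A2 true + x (l, true) * x (l, false)) (pv l).
Proof. by have := st_pv stA l; rewrite labE. Qed.

Let ac i : idm A2 true * a i = a i /\ a i * idm A2 false = a i.
Proof. exact: (@boalch_a_corner k n A2 x pv fused_xl fused_xr fused_pv i). Qed.
Let bc i : idm A2 false * b i = b i /\ b i * idm A2 true = b i.
Proof. by split; [exact: (fused_xl (i, false))|exact: (fused_xr (i, false))]. Qed.
Let al i := (ac i).1.
Let ar i := (ac i).2.
Let bl i := (bc i).1.
Let br i := (bc i).2.

Let FcP m : (m <= n)%N -> Fc a b m =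
    \prod_(l <- take m (enum 'I_n)) (idm A2 true + c l * b l) * idm A2 true
  /\ forall i : 'I_n, i.+1 = m -> Xc a b m = Fc a b i * c i.
Proof.
move=> mn; have [FE XE] := continuant_prod fused_xl fused_xr fused_pv mn.
split=> // i im; rewrite (XE i im).
by have [-> _] := continuant_prod fused_xl fused_xr fused_pv (ltnW (ltn_ord i)).
Qed.

Lemma psi_exists : exists psi : R -> A2, [/\ is_nhom psi, psi 1 = 1,
  forall s, psi (idm R s) = idm A2 s, forall i, psi (loc_a k i) = a i
  & forall i, psi (loc_b k i) = b i].
Proof.
apply: boalch_loc_lift => //; first by apply: leq_ltn_trans (ltn_ord c1).
case=> // m s _ mn; case: s.
  by have := continuant_prod_inv fused_xl fused_xr fused_pv mn.
by eexists; exact: (rev_continuant_prod_inv fused_xl fused_xr fused_pv mn).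
Qed.

Local Notation f := (idm R).
Local Notation F := (Fc (@loc_a k n) (@loc_b k n)).
Local Notation X := (Xc (@loc_a k n) (@loc_b k n)).

Let La (i : 'I_n) := (loc_a_corner k i).1.
Let Ra (i : 'I_n) := (loc_a_corner k i).2.
Let Lb (i : 'I_n) := (loc_b_corner k i).1.
Let Rb (i : 'I_n) := (loc_b_corner k i).2.

(** The bound is placed under the existential, with the default 0 beyond n, so that choice yields a
    function on all of nat. *)
Let F_inv m : exists z, (m <= n)%N -> corner_inv (f true) (F m) z.
Proof.
case: m => [|m]; first by exists (f true) => _; split;
  exact: (idm_mul R true true).
have [mn|mn] := leqP m.+1 n; last by exists 0.
by have [z zP] := loc_euler_inv k true (ltn0Sn m) mn; exists z.
Qed.

Let FX m (mn : (m <= n)%N) := continuant_corner La Ra Rb mn.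

(** The lifting property asks for images of the unfused generators. In matrices over R indexed by
    all the labels, they are elementary matrices whose positions separate the copies; compression at
    the two surviving labels then leads back to R. *)
Lemma phi_exists (Fi : nat -> R) :
  (forall m, (m <= n)%N -> corner_inv (f true) (F m) (Fi m)) ->
  exists phi : A -> R, [/\ is_nhom phi, phi 1 = 1,
  forall s, phi (idm A (c1, s)) = f s,
  forall i, phi (x (i, true)) = Fi i * X i.+1
  & forall i, phi (x (i, false)) = loc_b k i].
Proof.
move=> FiP.
pose v s : L := (c1, s).
have v_inj : injective v by move=> s s' [].
pose E := @emx k R L.
(* Matrix units relate labels of the same vertex only; 0 is a default value for the other pairs. *)
pose m p q := E (if p.2 == q.2 then f p.2 else 0) p q.
pose yR (p : L) : R := if p.2 then Fi p.1 * X p.1.+1 else loc_b k p.1.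
pose zR (l : 'I_n) : R := Fi l.+1 * F l.
have FC l := FX (ltnW (ltn_ord l)); have FC' (l : 'I_n) := FX (ltn_ord l).
have yl p : f p.2 * yR p = yR p.
  case: p => l []; last exact: (Lb l).
  have [_ _ H _] := FiP l (ltnW (ltn_ord l)).
  by rewrite -[yR _]/(Fi l * X l.+1) mulrA -[(l, true).2]/true H.
have yr p : yR p * f (~~ p.2) = yR p.
  case: p => l []; last exact: (Rb l).
  have [_ _ _ H] := FC' l.
  by rewrite -[yR _]/(Fi l * X l.+1) -mulrA -[~~ _]/false H.
(* By F_(l+1) = X_(l+1) b + F_l, the element P of copy l becomes F_l^-1 F_(l+1), with inverse
   F_(l+1)^-1 F_l, which is [zR]. *)
have PE (l : 'I_n) : f true + yR (l, true) * yR (l, false) = Fi l * F l.+1.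
  have [_ zF _ _] := FiP l (ltnW (ltn_ord l)).
  rewrite -[yR (l, true)]/(Fi l * X l.+1) -[yR (l, false)]/(loc_b k l).
  by rewrite Fc_rec mulrDr zF mulrA addrC.
have zRP (l : 'I_n) : corner_inv (f true) (Fi l * F l.+1) (zR l).
  have [fF Ff _ _] := FC l; have [fF' Ff' _ _] := FC' l.
  have [Fz zF fz zf] := FiP l (ltnW (ltn_ord l)).
  by apply: corner_invM => //; apply: FiP.
have mm (p q q' r : L) : p.2 = q.2 -> q'.2 = r.2 ->
    m p q * m q' r = if q == q' then m p r else 0.
  move=> pq qr; rewrite /m /E emxM pq qr !eqxx.
  by case: eqP => // qq; rewrite qq qr !eqxx idm_mul eqxx.
have rep : @matrix_rep k n 'M[R]_#|{: L}| m (fun p => E (yR p) p (opp_lab p))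
    (fun l => E (zR l) (l, true) (l, true)).
  have me p : m p p = E (f p.2) p p by rewrite /m eqxx.
  split=> [|p|l].
  - exact: mm.
  - by rewrite !me /E emxM eqxx emxM eqxx yl yr.
  - rewrite !me /E emxM /opp_lab /= eqxx -emxD PE.
    exact: emx_corner_inv (zRP l).
have [h [hP he hx]] := st_lift stA rep.
have h1 : h 1 = \sum_s emx (f s) (v s) (v s).
  rewrite -(idm_sum A) (is_lin_sum (nhom_lin hP)).
  rewrite (eq_bigr (fun p => m p p)) => [|p pA]; last exact: he.
  have -> : \sum_(p in verts A) m p p = \sum_s m (c1, s) (c1, s).
    rewrite fused_verts big_imset /= => [|s s' _ _ [->] //].
    by apply: eq_bigl => s; rewrite in_setT.
  by apply: eq_bigr => s _; rewrite /m eqxx.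
have [cP c1E] := collapse_nhom v_inj (erefl : verts R = setT) hP h1.
have cv s : (c1, s) \in verts A by rewrite fused_verts; apply/imsetP;
  exists s; rewrite ?in_setT.
have hxE p : h (x p) = emx (yR p) (v p.2) (v (~~ p.2)).
  rewrite hx !flE /m /E /= !eqxx emxM eqxx emxM eqxx; congr (emx _ _ _).
  by rewrite yl yr.
exists (collapse v \o h); split=> //.
- move=> s; rewrite /= he // /m eqxx (collapse_emx v_inj) //.
  by rewrite !idm_mul eqxx idm_mul eqxx.
- move=> i; rewrite /= hxE (collapse_emx v_inj) // (yl (i, true)).
  exact: (yr (i, true)).
- move=> i; rewrite /= hxE (collapse_emx v_inj) // (yl (i, false)).
  exact: (yr (i, false)).
Qed.

Lemma psi_bijective (psi : R -> A2) : is_nhom psi -> psi 1 = 1 ->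
  (forall s, psi (idm R s) = idm A2 s) -> (forall i, psi (loc_a k i) = a i) ->
  (forall i, psi (loc_b k i) = b i) -> bijective psi.
Proof.
move=> psiP psi1 psie psia psib.
have [Fi FiP] := boolp.choice F_inv.
have [phi [phiP phi1 phie phix phib]] := phi_exists FiP.
have psiF m : psi (F m) = Fc a b m.
  by rewrite (Fc_hom _ _ _ psiP) //; congr (Fc _ _ _); exact: boolp.funext.
have psiX m : psi (X m) = Xc a b m.
  by rewrite (Xc_hom _ _ _ psiP) //; congr (Xc _ _ _); exact: boolp.funext.
have phic (i : 'I_n) : phi (c i) = Fi i * X i.+1 := phix i.
have FXl i := FX (ltnW (ltn_ord (i : 'I_n))).
have FXS (i : 'I_n) := FX (ltn_ord i).
have phipv (i : 'I_n) : phi (pv i) = Fi i.+1 * F i.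
  have inv1 := nhom_corner_inv phiP (fused_pv i).
  apply: corner_inv_uniq inv1 _.
  rewrite (nhomD phiP) (nhomM phiP) phie phic phib.
  have [fF Ff _ _] := FXl i; have [Fz zF fz zf] := FiP i (ltnW (ltn_ord i)).
  have -> : f true + Fi i * X i.+1 * loc_b k i = Fi i * F i.+1.
    by rewrite Fc_rec mulrDr zF mulrA addrC.
  by apply: corner_invM => //; [case: (FXS i)|apply: FiP].
(* Hence phi sends c_i - [prev_u i] to F_i^-1 (X_(i+1) - X_i), which is a_i by the recursion for
   X. *)
have phiprev (i : 'I_n) : phi (prev_u x pv i) = Fi i * X i.
  rewrite /prev_u; case: (posnP i) => [i0|i0];
    first by rewrite (nhom0 phiP) i0 mulr0.
  set j := pred_ord i; have ji : i = j.+1 :> nat by rewrite pred_ordK.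
  rewrite (nhomM phiP) phipv [phi (x _)]phic ji.
  have [Fz _ _ _] := FiP j (ltnW (ltn_ord j)).
  have [_ _ H _] := FXS j.
  by rewrite -mulrA [F j * _]mulrA Fz H.
have phia i : phi (a i) = loc_a k i.
  have [Fz zF fz zf] := FiP i (ltnW (ltn_ord i)).
  rewrite (nhomD phiP) (nhomN phiP) phiprev [phi (x _)]phic -mulrBr Xc_rec //.
  by rewrite addrK mulrA zF; case: (loc_a_corner k i).
have nid : is_nhom (phi \o psi).
  split=> [y z|y z|r] /=; first by rewrite (nhomD psiP) (nhomD phiP).
    by rewrite (nhomM psiP) (nhomM phiP).
  by rewrite (nhomC psiP); exact: (nhom_lin phiP).2.
have pp s : phi (psi (f s)) = f s by rewrite psie phie.
exists phi.
- move=> y; elim/boalch_loc_ind: y => [r|y z|y z|s|i|i|s y z yz].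
  + by rewrite -[RHS]mulr1 -phi1 -psi1; exact: (nhomC nid).
  + by move=> yE zE; rewrite (nhomD psiP) (nhomD phiP) yE zE.
  + by move=> yE zE; rewrite (nhomM psiP) (nhomM phiP) yE zE.
  + exact: pp.
  + by rewrite psia phia.
  + by rewrite psib phib.
  + move=> yE; have := nhom_corner_inv nid yz; rewrite /= pp yE => yz'.
    exact: corner_inv_uniq yz' yz.
have nid' : is_nhom (psi \o phi).
  split=> [y z|y z|r] /=; first by rewrite (nhomD phiP) (nhomD psiP).
    by rewrite (nhomM phiP) (nhomM psiP).
  by rewrite (nhomC phiP); exact: (nhom_lin psiP).2.
have qe s : psi (phi (idm A (c1, s))) = idm A (c1, s) by rewrite phie psie.
have qc i : psi (phi (c i)) = c i.
  rewrite phic (nhomM psiP) psiX; have [_ XE] := FcP (ltn_ord i);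
    rewrite (XE i erefl).
  have := nhom_corner_inv psiP (FiP i (ltnW (ltn_ord i)));
    rewrite psiF psie => -[_ zF _ _].
  by rewrite mulrA zF (fused_xl (i, true)).
have qb i : psi (phi (b i)) = b i by rewrite phib psib.
apply: (st_gen stA) => [r|y z yE zE|y z yE zE|y].
- by rewrite -[RHS]mulr1 -[X in _ * X]psi1 -phi1; exact: (nhomC nid').
- by rewrite (nhomD phiP) (nhomD psiP) yE zE.
- by rewrite (nhomM phiP) (nhomM psiP) yE zE.
case=> [[p ->]|[[p ->]|[l ->]]].
- have [pA|pA] := boolP (p \in verts A); last first.
    by rewrite idm_out // (nhom0 phiP) (nhom0 psiP).
  by move: pA; rewrite fused_verts => /imsetP[s _ ->].
- by case: p => l []; [exact: qc|exact: qb].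
- have := nhom_corner_inv nid' (fused_pv l).
  rewrite /= (nhomD phiP) (nhomM phiP) (nhomD psiP) (nhomM psiP).
  rewrite -!/(phi _) [psi (phi (x (l, true)))]qc [psi (phi (x (l, false)))]qb qe => inv.
  exact: corner_inv_uniq inv (fused_pv l).
Qed.
End FullyFused.

(** * Comparison of the brackets and of the moment maps *)

Section BracketComparison.
Variables (k : fieldType) (n : nat) (I : finType) (A : balg k I).
Variables (psi : boalch_loc k n -> A) (e : bool -> A) (a b : 'I_n -> A).
Hypotheses (psiP : is_nhom psi) (psi1 : psi 1 = 1).
Hypothesis psie : forall s, psi (idm (boalch_loc k n) s) = e s.
Hypothesis psia : forall i, psi (loc_a k i) = a i.
Hypothesis psib : forall i, psi (loc_b k i) = b i.
Variables (d : A -> A -> tens2 A) (HB : hdqp (boalch k n)) (HL : hdqp (boalch_loc k n)).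
Hypothesis dP : is_double_bracket d.
Hypothesis HBP : is_boalch_hdqp HB.
Hypothesis HLP : is_boalch_loc_hdqp HB HL.
Local Notation half := (2%:R^-1 : k).
Local Notation sgn i j := ((sgz (i%:Z - j%:Z))%:~R : k).
Hypothesis d_e : forall s y, d (e s) y = 0.
Hypothesis d_aa : forall i j, d (a i) (a j) =
  (half * sgn i j) *: sym_tens (a i) (a j).
Hypothesis d_bb : forall i j, d (b i) (b j) =
  (half * sgn i j) *: sym_tens (b i) (b j).
Hypothesis d_ab : forall i j : 'I_n, d (a i) (b j) =
  if (i < j)%N then half *: prod_tens (e false) (e true) (a i) (b j)
  else if i == j then half *: prod_tens (e false) (e true) (a i) (b j) +
    e false ⊗ e true
  else - (half *: prod_tens (e false) (e true) (a i) (b j))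
       - (if (i == j.+1 :> nat) then e false ⊗ e true else 0).

Local Notation R := (boalch_loc k n).
Let psi_lin := nhom_lin psiP.
Let LP := dbrP HL.
Let good y z := d (psi y) (psi z) = tmap psi (dbr HL y z).

Let goodC y z : good y z -> good z y.
Proof.
move=> yz; rewrite /good (brC dP) [dbr HL z y](brC LP) (tmapN psi_lin).
by rewrite (tmap_flip psi_lin) yz.
Qed.

Let good_e y s : good y (idm R s).
Proof.
by rewrite /good (br_idmr LP) (tmap0 psi_lin) psie (brC dP) d_e tflip0 oppr0.
Qed.

(** Both sides of [good y] are double derivations along psi in the second variable, so their
    agreement passes from the generators to sums, products and inverses. *)
Let good_gen y : (forall i, good y (loc_a k i)) ->
  (forall i, good y (loc_b k i)) ->
  forall z, good y z.
Proof.
move=> ya yb.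
have D1 := dder_precomp psi_lin (nhomM psiP) (br_dder dP (psi y)).
have D2 := dder_comp psi_lin (nhomM psiP) psi1 (br_dder LP y).
have psiM := nhomM psiP.
elim/boalch_loc_ind => [c|z z'|z z'|s|//|//|s z z' [zz' z'z ez' _] gz].
- have c1 : in_calg c = in_calg c * \sum_(s in verts R) idm R s :> R.
    by rewrite (idm_sum R) mulr1.
  (* A scalar is a multiple of the sum of the vertex idempotents, on which both sides vanish. *)
  have := dderZ D1 c 1; have := dderZ D2 c 1; rewrite mulr1 /= => E2 E1.
  rewrite /good E1 E2; congr (_ *: _); rewrite -/(good y 1) -(idm_sum R).
  apply: big_ind => [|u v|s _]; last exact: good_e.
    by rewrite /good (br0r LP) (tmap0 psi_lin) (nhom0 psiP) (br0r dP).
  by move=> yu yv; exact: (dder_eqD D1 D2 yu yv).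
- by move=> yz yz'; exact: (dder_eqD D1 D2 yz yz').
- by move=> yz yz'; exact: (dder_eqM D1 D2 yz yz').
- exact: good_e.
- exact: (dder_eq_inv D1 D2 psiM zz' z'z ez' (good_e y s) gz).
Qed.

Let g := psi \o @to_boalch_loc k n.
Let g_nhom : is_nhom g.
Proof.
split=> [y z|y z|c] /=.
- by rewrite /g /= (nhomD (@to_boalch_loc_nhom k n)) (nhomD psiP).
- by rewrite /g /= (nhomM (@to_boalch_loc_nhom k n)) (nhomM psiP).
- by rewrite /g /= (nhomC (@to_boalch_loc_nhom k n)); exact: psi_lin.2.
Qed.
Let gl := nhom_lin g_nhom.
Let ga i : g (bo_a k i) = a i. Proof. exact: psia. Qed.
Let gb i : g (bo_b k i) = b i. Proof. exact: psib. Qed.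
Let ge s : g (idm (boalch k n) s) = e s. Proof. exact: psie. Qed.

Let good_loc y z : d (g y) (g z) = tmap g (dbr HB y z) ->
  good (to_boalch_loc y) (to_boalch_loc z).
Proof.
rewrite /good /g /= => ->; rewrite HLP.1 (tmap_comp _ _ psi_lin) //.
exact: nhom_lin (@to_boalch_loc_nhom k n).
Qed.

Let g_prod i j : tmap g (half *: (idm (boalch k n) false ⊗ (bo_a k i * bo_b k j)
    + (bo_b k j * bo_a k i) ⊗ idm (boalch k n) true)) =
  half *: prod_tens (e false) (e true) (a i) (b j).
Proof.
by rewrite (tmapZ gl) (tmapD gl) !(tmap_ptens gl) !(nhomM g_nhom) !ge !ga !gb.
Qed.

Let good_aa i j : good (loc_a k i) (loc_a k j).
Proof.
have [aa _ _ _] := HBP; apply: good_loc.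
by rewrite aa !ga d_aa (tmapZ gl) (tmapD gl) !(tmap_ptens gl) !ga.
Qed.
Let good_bb i j : good (loc_b k i) (loc_b k j).
Proof.
have [_ bb _ _] := HBP; apply: good_loc.
by rewrite bb !gb d_bb (tmapZ gl) (tmapD gl) !(tmap_ptens gl) !gb.
Qed.
Let good_ab i j : good (loc_a k i) (loc_b k j).
Proof.
have [_ _ ab _] := HBP; apply: good_loc.
rewrite ab ga gb d_ab; case: ifP => _; first by rewrite g_prod.
case: eqP => [<-|_]; first by rewrite (tmapD gl) g_prod (tmap_ptens gl) !ge.
rewrite (tmapD gl) !(tmapN gl) g_prod; congr (_ - _).
by case: ifP => _; rewrite ?(tmap0 gl) // (tmap_ptens gl) !ge.
Qed.

Lemma psi_bracket y z : d (psi y) (psi z) = tmap psi (dbr HL y z).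
Proof.
(* Antisymmetry exchanges the variables, so the comparison reduces to generators in each of them in
   turn. *)
apply: (good_gen (y := y)) => i; apply/goodC; apply: good_gen => j //.
by apply/goodC.
Qed.
End BracketComparison.

Section MomentMap.
Variables (k : fieldType) (n : nat) (c1 : 'I_n).
Local Notation L := ('I_n * bool)%type.
Variables (A : balg k L) (t : bool -> nat) (x : L -> A) (pv : 'I_n ->
  A) (H : hdqp A).
Hypothesis tn : forall s, t s = n.
Hypothesis stA : fusion_stage c1 t x pv.
Hypothesis hstA : fusion_stage_hdqp c1 t x pv H.
Local Notation A2 := (fused_balg tn stA).

Let flE p : fused_lab c1 t p = (c1, p.2).
Proof. by rewrite /fused_lab tn ltn_ord. Qed.

Lemma fused_mom : mom H =
  \prod_(l <- enum 'I_n) (idm A2 true +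
    x (l, true) * x (l, false)) * idm A2 true
  + \prod_(l <- enum 'I_n) @copy_invQ k n A2 x pv l * idm A2 false.
Proof.
have [_ -> _] := momP H; rewrite (fused_sum tn stA) big_bool.
have fc s : fused_copies c1 t (c1, s) = enum 'I_n.
  rewrite /fused_copies eqxx; apply/all_filterP/allP => l _.
  by rewrite tn ltn_ord.
have pA s : (c1, s) \in verts A.
  by rewrite (fused_verts tn stA); apply/imsetP; exists s; rewrite ?in_setT.
congr (_ + _); rewrite (hst_mom hstA) // fc; congr (_ * _);
  apply: eq_bigr => l _.
  by rewrite /copy_mom /lab flE.
by rewrite /copy_mom /lab flE.
Qed.
End MomentMap.

Theorem theorem5p1 (k : fieldType) (k_char0 : [pchar k] =i pred0)
    (n : nat) (n_gt0 : (0 < n)%N)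
    (HB : hdqp (boalch k n)) (HBloc : hdqp (boalch_loc k n))
    (HA : hdqp (A_fus k n_gt0))
    (HB_boalch : is_boalch_hdqp HB)
    (HBloc_loc : is_boalch_loc_hdqp HB HBloc)
    (HA_fus : is_A_fus_hdqp HA) :
  exists psi : boalch_loc k n -> A_fus k n_gt0,
    is_hdqp_iso (fun s : bool => (copy1 n_gt0, s)) HBloc HA psi.
Proof.
(* Characteristic zero enters through the invertibility of 2. *)
have half2 : 2%:R^-1 + 2%:R^-1 = 1 :> k.
  have n2 : 2%:R != 0 :> k by have /pcharf0P -> := k_char0.
  by rewrite -[RHS](mulVf n2) mulr_natr mulr2n.
have [t [x [pv [tn st hst]]]] := A_fus_stage HA_fus.
have [psi [psiP psi1 psie psia psib]] := psi_exists tn st.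
have xl := fused_xl tn st; have xr := fused_xr tn st;
  have pvP := fused_pv tn st.
have dP := dbrP HA.
pose lb (s : bool) : 'I_n * bool := (copy1 n_gt0, s).
have lb_inj : lb false != lb true by rewrite xpair_eqE andbF.
have labE p : lab (copy1 n_gt0) (A_fus k n_gt0) t p =
  idm (A_fus k n_gt0) (lb p.2).
  by rewrite /lab /fused_lab tn ltn_ord.
have br_cd l : dbr HA (x (l, true)) (x (l, false)) =
    2%:R^-1 *: prod_tens (idm (A_fus k n_gt0) (lb false))
      (idm (A_fus k n_gt0) (lb true)) (x (l, true)) (x (l, false))
    + idm (A_fus k n_gt0) (lb false) ⊗ idm (A_fus k n_gt0) (lb true).
  by rewrite (hst_cd hst) !labE.
have br_lt1 (i l : 'I_n) s : (i < l)%N ->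
    dbr HA (x (i, s)) (x (l, s)) = - (2%:R^-1 *: sym_tens (x (i, s)) (x (l, s))).
  by move=> il; rewrite (hst_lt1 hst) // !tn ltn_ord.
have br_lt2 (i l : 'I_n) s : (i < l)%N -> dbr HA (x (i, s)) (x (l, ~~ s)) =
    2%:R^-1 *: ((x (l, ~~ s) * x (i, s)) ⊗ idm (A_fus k n_gt0) (lb s)
      + idm (A_fus k n_gt0) (lb (~~ s)) ⊗ (x (i, s) * x (l, ~~ s))).
  by move=> il; rewrite (hst_lt2 hst) // !tn ltn_ord !labE.
have d_aa := br_aa dP half2 lb_inj xl xr pvP (hst_xx hst) br_cd br_lt1 br_lt2.
have d_ab := br_ab dP half2 lb_inj xl xr pvP (hst_xx hst) br_cd br_lt1 br_lt2.
have d_bb := br_bb dP (hst_xx hst) br_lt1.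
exists psi; split.
- by move=> s s' _ _ [].
- exact: fused_verts tn st.
- exact: (psi_bijective psiP psi1 psie psia psib).
- by apply/calg_hom_nhom.
- by move=> s _; exact: psie.
- exact: (@psi_bracket k n _ (A_fus k n_gt0) psi (fun s => idm _ (lb s))
    (boalch_a x pv) (fun l => x (l, false)) psiP psi1 psie psia psib _ HB HBloc
    dP HB_boalch HBloc_loc (fun s y => br_idml dP (lb s) y) d_aa d_bb d_ab).
have [_ _ _ momE] := HB_boalch; have [_ momL] := HBloc_loc.
have euE s : psi (euler (@loc_a k n) (@loc_b k n) n s) =
    euler (boalch_a x pv : 'I_n -> fused_balg tn st) (fun l =>
      x (l, false)) n s.
  rewrite (euler_hom _ _ _ _ psiP psi1 psie); congr (euler _ _ _ _);
    exact: boolp.funext.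
rewrite momL momE (nhomD (@to_boalch_loc_nhom k n)) (nhomD psiP) to_boalch_loc_euler euE.
rewrite (fused_mom tn st hst); congr (_ + _).
  have [FE _] := continuant_prod xl xr pvP (leqnn n).
  by rewrite -Fc_euler // FE take_oversize ?size_enum_ord.
(* At e_1 the inverse adjoined in the Boalch algebra and the product of the inverses of the copies
   invert the same continuant in the same corner, so they agree by uniqueness. *)
have inv1 := rev_continuant_prod_inv xl xr pvP (leqnn n).
rewrite Gc_euler // take_oversize ?size_enum_ord // in inv1.
have inv2 := nhom_corner_inv psiP
  (nhom_corner_inv (@to_boalch_loc_nhom k n) (bo_invP k n false)).
rewrite to_boalch_loc_euler euE in inv2.
apply: corner_inv_uniq inv2 _.
by rewrite [psi _](_ : _ = idm (fused_balg tn st) false) // -psie.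
Qed.
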